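(* Let $\Omega\subset\mathbb R^m$, $m\ge2$, be a bounded connected Lipschitz domain. Let $\mathcal M\subset L^\infty(\Omega)$ be a second-countable embedded real-analytic manifold of dimension $d$, and assume that $\sigma\mapsto\Lambda_\sigma$ is injective on $L^\infty_+(\Omega)\cap\mathcal M$, where $\Lambda_\sigma$ is the Neumann-to-Dirichlet map. Let $\gamma$ be a Gaussian measure on $L^2_\diamond(\partial\Omega)$ with injective covariance. Let $M\ge 2d+1$ and let $(f_1,g_1),\dots,(f_M,g_M)\in L^2_\diamond(\partial\Omega)\times L^2_\diamond(\partial\Omega)$ be independent samples with law $\gamma\otimes\gamma$. Then, with probability one, the following holds for every $\sigma_1,\sigma_2\in L^\infty_+(\Omega)\cap\mathcal M$: if $\langle\Lambda_{\sigma_1}f_i,g_i\rangle_{L^2(\partial\Omega)}=\langle\Lambda_{\sigma_2}f_i,g_i\rangle_{L^2(\partial\Omega)}$ for $i=1,\dots,M$, then $\sigma_1=\sigma_2$.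
   Context: All function spaces are real. $L^\infty_+(\Omega)=\{\sigma\in L^\infty(\Omega):\operatorname{ess\,inf}_\Omega\sigma>0\}$ and $L^2_\diamond(\partial\Omega)=\{f\in L^2(\partial\Omega):\int_{\partial\Omega}f\,ds=0\}$. For $\sigma\in L^\infty_+(\Omega)$ and $f\in L^2_\diamond(\partial\Omega)$, $u_{\sigma,f}\in H^1(\Omega)$ is the weak solution, normalized by $\int_{\partial\Omega}u_{\sigma,f}\,ds=0$, of $-\nabla\cdot(\sigma\nabla u)=0$ in $\Omega$, $\sigma\partial_\nu u=f$ on $\partial\Omega$ (i.e. $\int_\Omega\sigma\nabla u\cdot\nabla v\,dx=\int_{\partial\Omega}f\,v|_{\partial\Omega}\,ds$ for all $v\in H^1(\Omega)$). The Neumann-to-Dirichlet map is $\Lambda_\sigma\colon L^2_\diamond(\partial\Omega)\to L^2_\diamond(\partial\Omega)$, $\Lambda_\sigma f=u_{\sigma,f}|_{\partial\Omega}$. Real analytic map: for real Banach spaces $Y_1,Y_2$ and $U\subset Y_1$ open, $G\colon U\to Y_2$ is real analytic if for every $y\in U$ there are $\rho>0$ and continuous symmetric $j$-linear maps $G_j\colon Y_1^j\to Y_2$, $j\ge0$, with $\sum_{j\ge0}\|G_j\|\rho^j<\infty$ and $G(y+h)=\sum_{j\ge0}G_j(h,\dots,h)$ for $\|h\|_{Y_1}<\rho$. Embedded real-analytic manifold of dimension $d$ in a Banach space $X$: a subset $\mathcal M\subset X$ (with the topology induced by $X$) such that for every $a\in\mathcal M$ there are an open set $V\subset\mathbb R^d$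 and a real-analytic map $\varphi\colon V\to X$ such that $d\varphi_t$ is injective for every $t\in V$ and $\varphi$ is a homeomorphism from $V$ onto an open neighbourhood of $a$ in $\mathcal M$. *)

(* Defs.v *)
From HB Require Import structures.
From mathcomp Require Import all_boot all_order all_algebra perm generic_quotient ring_quotient.
From mathcomp Require Import all_classical all_reals all_analysis.
From mathcomp Require Import measurable_realfun ess_sup_inf.

Set Implicit Arguments.
Unset Strict Implicit.
Unset Printing Implicit Defensive.

Import Order.TTheory GRing.Theory Num.Theory.
Import numFieldNormedType.Exports.

Local Open Scope classical_set_scope.
Local Open Scope ring_scope.

Section Lp_space.
Context d (T : measurableType d) (R : realType).
Variables (mu : {measure set T -> \bar R}) (p : \bar R) (p1 : (1 <= p)%E).

Definition null_Lfun : {pred LfunType mu p1} :=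
  fun f => `[< (f : T -> R) = (0 : LfunType mu p1) %[ae mu] >].

Lemma null_LfunP (f : LfunType mu p1) :
  reflect (\forall x \ae mu, f x = 0) (f \in null_Lfun).
Proof.
apply: (iffP (asboolP _)) => h; near=> x.
  by have -> : f x = (0 : LfunType mu p1) x by near: x; apply: filterS h => x; apply.
by move=> _; near: x.
Unshelve. all: by end_near. Qed.

Lemma null_Lfun_zmod_closed : zmod_closed null_Lfun.
Proof.
split; first by apply/null_LfunP; near=> x.
move=> f g /null_LfunP f0 /null_LfunP g0; apply/null_LfunP; near=> x.
have -> : (f - g) x = f x - g x by [].
by rewrite (near f0 x) // (near g0 x) // subr0.
Unshelve. all: by end_near. Qed.

HB.instance Definition _ := GRing.isZmodClosed.Build _ null_Lfun
  null_Lfun_zmod_closed.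

(* L^p as a normed space: the library's [LfunType mu p1], the measurable
   functions of finite L^p norm, modulo the almost everywhere null ones *)
Definition Lp : Type := Quotient.quot null_Lfun.
HB.instance Definition _ := GRing.Zmodule.on Lp.
Definition Lp_repr (f : Lp) : LfunType mu p1 := repr f.
Definition Lp_class (f : LfunType mu p1) : Lp := \pi_(Quotient.quot null_Lfun)%qT f.

Lemma Lp_reprK : cancel Lp_repr Lp_class.
Proof. exact: reprK. Qed.

Lemma eq_Lp_class (f g : LfunType mu p1) :
  (\forall x \ae mu, f x = g x) <-> Lp_class f = Lp_class g.
Proof.
have E : (Lp_class f == Lp_class g) = (f - g \in null_Lfun).
  by rewrite Quotient.idealrBE.
split=> [fg|/eqP]; last first.
  rewrite E => /null_LfunP; apply: filterS => x.
  by have -> : (f - g) x = f x - g x by [] ; move/eqP; rewrite subr_eq0 => /eqP.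
apply/eqP; rewrite E; apply/null_LfunP; apply: filterS fg => x fg.
by have -> : (f - g) x = f x - g x by []; rewrite fg subrr.
Qed.

Lemma Lp_classK (f : LfunType mu p1) : \forall x \ae mu, Lp_repr (Lp_class f) x = f x.
Proof. by apply/eq_Lp_class; rewrite Lp_reprK. Qed.

Lemma Lp_classD f g : Lp_class (f + g) = Lp_class f + Lp_class g.
Proof. exact: raddfD. Qed.

Definition Lp_scale (a : R) (f : Lp) : Lp := Lp_class (a *: Lp_repr f).

Lemma Lp_classZ a f : Lp_class (a *: f) = Lp_scale a (Lp_class f).
Proof.
apply/eq_Lp_class; apply: filterS (Lp_classK f) => x fx.
by transitivity (a * f x) => //; rewrite -fx.
Qed.

Lemma Lp_scaleA a b f : Lp_scale a (Lp_scale b f) = Lp_scale (a * b) f.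
Proof. by rewrite -[f]Lp_reprK -!Lp_classZ scalerA. Qed.

Lemma Lp_scale1 : left_id 1 Lp_scale.
Proof. by move=> f; rewrite -[f]Lp_reprK -Lp_classZ scale1r. Qed.

Lemma Lp_scaleDr : right_distributive Lp_scale +%R.
Proof.
move=> a f g; rewrite -[f]Lp_reprK -[g]Lp_reprK -!(Lp_classD, Lp_classZ).
by rewrite scalerDr Lp_classD.
Qed.

Lemma Lp_scaleDl f : {morph Lp_scale^~ f : a b / a + b}.
Proof.
by move=> a b; rewrite -[f]Lp_reprK -!Lp_classZ scalerDl Lp_classD.
Qed.

HB.instance Definition _ := GRing.Zmodule_isLmodule.Build R Lp
  Lp_scaleA Lp_scale1 Lp_scaleDr Lp_scaleDl.

Lemma Lp_reprD (f g : Lp) : \forall x \ae mu, Lp_repr (f + g) x = Lp_repr f x + Lp_repr g x.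
Proof.
apply: filterS (Lp_classK (Lp_repr f + Lp_repr g)) => x.
by rewrite Lp_classD !Lp_reprK.
Qed.

Lemma Lp_reprZ a (f : Lp) : \forall x \ae mu, Lp_repr (a *: f) x = a * Lp_repr f x.
Proof. exact: Lp_classK. Qed.

Definition Lp_norm (f : Lp) : R := fine ('N[mu]_p[EFin \o Lp_repr f])%E.

Lemma ae_eq_Lnorm (f g : LfunType mu p1) : (\forall x \ae mu, f x = g x) ->
  ('N[mu]_p[EFin \o f] = 'N[mu]_p[EFin \o g])%E.
Proof.
move=> fg; rewrite unlock /Lnorm; case: p p1 f g fg => [r|//|//] r1 f g fg.
  congr poweR; apply: ge0_ae_eq_integral => //.
  - apply: (measurableT_comp (measurable_poweR r)).
    by apply: measurableT_comp => //; exact/measurable_EFinP.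
  - apply: (measurableT_comp (measurable_poweR r)).
    by apply: measurableT_comp => //; exact/measurable_EFinP.
  - by move=> x _; exact: poweR_ge0.
  - by move=> x _; exact: poweR_ge0.
  - by apply: filterS fg => x /= -> _.
by case: ifPn => // _; apply: eq_ess_sup; apply: filterS fg => x /= ->.
Qed.

Lemma Lp_norm_class f : Lp_norm (Lp_class f) = fine ('N[mu]_p[EFin \o f])%E.
Proof. by congr fine; apply: ae_eq_Lnorm; exact: Lp_classK. Qed.

Lemma ler_Lp_normD f g : Lp_norm (f + g) <= Lp_norm f + Lp_norm g.
Proof.
by rewrite -[f]Lp_reprK -[g]Lp_reprK -Lp_classD !Lp_norm_class ler_LnormD.
Qed.

Lemma Lp_normZ a f : Lp_norm (a *: f) = `|a| * Lp_norm f.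
Proof.
rewrite -[f]Lp_reprK -[a *: _]Lp_classZ !Lp_norm_class.
by apply: EFin_inj; rewrite EFinM !finite_norm_fine LnormZ.
Qed.

Lemma Lp_norm0_eq0 f : Lp_norm f = 0 -> f = 0.
Proof.
move=> /fine_Lnormr_eq0 f0.
rewrite -[f]Lp_reprK -[RHS](raddf0 (\pi_(Quotient.quot null_Lfun)%qT)).
by apply/eq_Lp_class; apply: filterS f0 => x /(_ I).
Qed.

HB.instance Definition _ := Lmodule_isNormed.Build R Lp
  ler_Lp_normD Lp_normZ Lp_norm0_eq0.

End Lp_space.

Coercion Lp_repr : Lp >-> LfunType.

Section power_measure.
Context d (T : measurableType d) (R : realType).

Definition cons_tuple n (p : T * n.-tuple T) : n.+1.-tuple T :=
  [the n.+1.-tuple T of p.1 :: p.2].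

Definition uncons_tuple n (t : n.+1.-tuple T) : T * n.-tuple T :=
  (tnth t ord0, [tuple of behead t]).

Lemma measurable_cons_tuple n : measurable_fun [set: T * n.-tuple T] (@cons_tuple n).
Proof. exact: measurable_cons. Qed.

Lemma measurable_uncons_tuple n : measurable_fun [set: n.+1.-tuple T] (@uncons_tuple n).
Proof.
apply/measurable_fun_pairP; split; first exact: measurable_tnth.
exact: measurable_behead.
Qed.

Lemma cons_tupleK n : cancel (@cons_tuple n) (@uncons_tuple n).
Proof. by move=> [x t]; congr pair; apply: val_inj. Qed.

Section step.
Variables (mu : {sigma_finite_measure set T -> \bar R}) (n : nat).
Variable nu : {sigma_finite_measure set (n.-tuple T) -> \bar R}.

Definition cons_measure : set (n.+1.-tuple T) -> \bar R :=
  pushforward (mu \x nu)%E (@cons_tuple n).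

Let cons_measure0 : cons_measure set0 = 0%E.
Proof. by rewrite /cons_measure /pushforward preimage_set0 measure0. Qed.

Let cons_measure_ge0 A : (0 <= cons_measure A)%E.
Proof. by rewrite /cons_measure /pushforward; exact: (measure_ge0 (mu \x nu)%E). Qed.

Let cons_measure_sigma_additive : semi_sigma_additive cons_measure.
Proof.
move=> F mF tF mUF; rewrite /cons_measure /pushforward preimage_bigcup.
have mcons A : measurable A -> measurable (@cons_tuple n @^-1` A).
  by move=> mA; rewrite -[X in measurable X]setTI; exact: measurable_cons_tuple.
apply: measure_semi_sigma_additive.
- by move=> k; exact: mcons.
- apply/trivIsetP => /= i j _ _ ij; rewrite -preimage_setI.
  by move/trivIsetP : tF => /(_ _ _ _ _ ij) ->//; rewrite preimage_set0.
- by rewrite -preimage_bigcup; exact: mcons.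
Qed.

HB.instance Definition _ := isMeasure.Build _ _ _ cons_measure
  cons_measure0 cons_measure_ge0 cons_measure_sigma_additive.

Lemma sigma_finite_cons_measure : sigma_finite [set: n.+1.-tuple T] cons_measure.
Proof.
have /sigma_finiteP[F [TF ndF Foo]] := sigma_finiteT mu.
have /sigma_finiteP[G [TG ndG Goo]] := sigma_finiteT nu.
exists (fun k => @uncons_tuple n @^-1` (F k `*` G k)).
  apply/esym/seteqP; split => // t _.
  have [i _ Fi] : (\bigcup_i F i) (uncons_tuple t).1 by rewrite -TF.
  have [j _ Gj] : (\bigcup_i G i) (uncons_tuple t).2 by rewrite -TG.
  exists (maxn i j) => //; split.
    by move: Fi; exact/subsetPset/ndF/leq_maxl.
  by move: Gj; exact/subsetPset/ndG/leq_maxr.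
move=> k; have [mF Fk] := Foo k; have [mG Gk] := Goo k; split.
  rewrite -[X in measurable X]setTI.
  by apply: measurable_uncons_tuple => //; exact: measurableX.
rewrite /cons_measure /pushforward -comp_preimage.
have -> : @uncons_tuple n \o @cons_tuple n = id by apply/funext => x; exact: cons_tupleK.
rewrite preimage_id product_measure1E// lte_mul_pinfty// ge0_fin_numE//.
Qed.

HB.instance Definition _ := Measure_isSigmaFinite.Build _ _ _ cons_measure
  sigma_finite_cons_measure.

End step.

(* product measure mu x ... x mu on [n.-tuple T] *)
Fixpoint power_measure (mu : {sigma_finite_measure set T -> \bar R}) n :
    {sigma_finite_measure set (n.-tuple T) -> \bar R} :=
  if n is n'.+1 then
    [the {sigma_finite_measure set _ -> \bar R} of
      cons_measure mu (power_measure mu n')]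
  else [the {sigma_finite_measure set _ -> \bar R} of
    dirac ([tuple] : 0.-tuple T)].

End power_measure.

Section caratheodory_measure.
Context (R : realType) (T : pointedType).

Definition caratheodory_measure (mu : {outer_measure set T -> \bar R}) :
    {measure set (caratheodory_type mu) -> \bar R} :=
  [the measure (caratheodory_type mu) R of
    (mu : set (caratheodory_type mu) -> \bar R)].

End caratheodory_measure.

(* [T] with the sigma-algebra of all its subsets: [mu_ext] then ranges over
   covers by arbitrary sets *)
Definition all_sets (T : Type) : Type := T.

Section all_sets.
Variable T : pointedType.
HB.instance Definition _ := Pointed.on (all_sets T).
HB.instance Definition _ := @isMeasurable.Build default_measure_display
  (all_sets T) setT I (fun _ _ => I) (fun _ _ => I).
End all_sets.

Section lebesgue_outer_measure.
Context {R : realType} (n : nat).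

(* restriction to [D] of the n-dimensional Lebesgue outer measure. Being an
   outer measure, it needs no measurability of [D]; its Caratheodory sets are
   the [A] such that [A `&` D] is Lebesgue measurable when [D] is. *)
Definition lebesgue_on (D A : set 'rV[R]_n) : \bar R :=
  ((power_measure (@lebesgue_measure R) n)^*)%mu
    [set t : n.-tuple (measurableTypeR R) | (A `&` D) (\row_i tnth t i)].

Variable D : set 'rV[R]_n.

Let lebesgue_on0 : lebesgue_on D set0 = 0%E.
Proof.
rewrite /lebesgue_on set0I (_ : [set t | _] = set0) ?outer_measure0//.
Qed.

Let lebesgue_on_ge0 A : (0 <= lebesgue_on D A)%E.
Proof. exact: outer_measure_ge0. Qed.

Let le_lebesgue_on : {homo lebesgue_on D : A B / A `<=` B >-> (A <= B)%E}.
Proof.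
by move=> A B AB; apply: le_outer_measure => t [/AB ? ?].
Qed.

Let lebesgue_on_sigma_subadditive : sigma_subadditive (lebesgue_on D).
Proof.
move=> F; rewrite /lebesgue_on.
rewrite (_ : [set t | _] = \bigcup_i
  [set t : n.-tuple (measurableTypeR R) | (F i `&` D) (\row_i tnth t i)]).
  exact: outer_measure_sigma_subadditive.
by apply/seteqP; split=> [t [[i _ Fi] Dt]|t [i _ [Fi Dt]]]; [exists i|split => //; exists i].
Qed.

HB.instance Definition _ := isOuterMeasure.Build R 'rV[R]_n (lebesgue_on D)
  lebesgue_on0 lebesgue_on_ge0 le_lebesgue_on lebesgue_on_sigma_subadditive.

End lebesgue_outer_measure.

Section hausdorff_outer_measure.
Context {R : realType} (n : nat).

Definition enorm (x : 'rV[R]_n) : R := Num.sqrt (\sum_i x ord0 i ^+ 2).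

Definition diameter (A : set 'rV[R]_n) : \bar R :=
  ereal_sup (0%E |` [set (enorm (x - y))%:E | x in A & y in A]).

End hausdorff_outer_measure.

(* Lebesgue measure of the Euclidean ball of diameter 1 in R^k; [enorm] rather
   than the library's norm of ['rV_k], which is the sup norm *)
Definition volume_diam1 (R : realType) k : R :=
  fine (lebesgue_on setT [set x : 'rV[R]_k | enorm x <= 2^-1]).

Section hausdorff_outer_measure.
Context {R : realType} (n k : nat).

(* normalized by the volume of the ball of diameter 1, so that [hausdorff k] is
   Lebesgue measure on R^k and surface area on k-dimensional surfaces *)
Definition hausdorff_gauge (delta : R) (E : set (all_sets 'rV[R]_n)) : \bar R :=
  if E == set0 then 0%E
  else if (diameter E <= delta%:E)%E
  then (volume_diam1 R k * fine (diameter E) ^+ k)%:E else +oo%E.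

Definition hausdorff (A : set 'rV[R]_n) : \bar R :=
  ereal_sup [set mu_ext (hausdorff_gauge delta) A | delta in [set delta | 0 < delta]].

Definition hausdorff_on (D A : set 'rV[R]_n) : \bar R := hausdorff (A `&` D).

Lemma hausdorff_gauge0 delta : hausdorff_gauge delta set0 = 0%E.
Proof. by rewrite /hausdorff_gauge eqxx. Qed.

Lemma diameter_ge0 (A : set 'rV[R]_n) : (0 <= diameter A)%E.
Proof. by apply: ereal_sup_ubound; left. Qed.

Lemma hausdorff_gauge_ge0 delta E : (0 <= hausdorff_gauge delta E)%E.
Proof.
rewrite /hausdorff_gauge; case: ifPn => // _; case: ifPn => // _.
rewrite lee_fin mulr_ge0 ?exprn_ge0 ?fine_ge0 ?diameter_ge0//.
exact: outer_measure_ge0.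
Qed.

Variable D : set 'rV[R]_n.

Let hausdorff_on0 : hausdorff_on D set0 = 0%E.
Proof.
rewrite /hausdorff_on set0I /hausdorff.
rewrite (_ : [set _ | _ in _] = [set 0%E]) ?ereal_sup1//.
apply/seteqP; split=> [_ [e _ <-]|_ ->] /=.
  by rewrite mu_ext0//; [exact: hausdorff_gauge0|exact: hausdorff_gauge_ge0].
exists 1; first exact: ltr01.
by rewrite mu_ext0//; [exact: hausdorff_gauge0|exact: hausdorff_gauge_ge0].
Qed.

Let hausdorff_on_ge0 A : (0 <= hausdorff_on D A)%E.
Proof.
apply: (@le_trans _ _ (mu_ext (hausdorff_gauge 1) (A `&` D))).
  exact/mu_ext_ge0/hausdorff_gauge_ge0.
by apply: ereal_sup_ubound; exists 1 => //; exact: ltr01.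
Qed.

Let le_hausdorff_on : {homo hausdorff_on D : A B / A `<=` B >-> (A <= B)%E}.
Proof.
move=> A B AB; apply: ge_ereal_sup => _ [e e0 <-].
apply: (@le_trans _ _ (mu_ext (hausdorff_gauge e) (B `&` D))).
  by apply: le_mu_ext; exact: setSI.
by apply: ereal_sup_ubound; exists e.
Qed.

Let hausdorff_on_sigma_subadditive : sigma_subadditive (hausdorff_on D).
Proof.
move=> F; apply: ge_ereal_sup => _ [e e0 <-].
rewrite setI_bigcupl.
apply: (le_trans (mu_ext_sigma_subadditive (hausdorff_gauge_ge0 e) _)).
apply: lee_nneseries => i _.
  by move=> _; exact/mu_ext_ge0/hausdorff_gauge_ge0.
by apply: ereal_sup_ubound; exists e.
Qed.

HB.instance Definition _ := isOuterMeasure.Build R 'rV[R]_n (hausdorff_on D)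
  hausdorff_on0 hausdorff_on_ge0 le_hausdorff_on hausdorff_on_sigma_subadditive.

End hausdorff_outer_measure.

Notation L2 mu := (Lp mu (lee1n 2)).
Notation Linfty mu := (Lp mu (leey 1%E)).

Section L2_mean0.
Context d (T : measurableType d) (R : realType).
Variable mu : {measure set T -> \bar R}.

Definition dot_L2 (f g : L2 mu) : R := \int[mu]_x (f x * g x).

(* integrability is automatic when [mu] is finite; it is included so that the
   predicate defines a subspace for every [mu] *)
Definition mean0 : {pred L2 mu} := fun f =>
  `[< mu.-integrable setT (EFin \o f) /\ \int[mu]_x f x = 0 >].

Lemma mean0_submod_closed : submod_closed mean0.
Proof.
have aeq (f : L2 mu) (g : T -> R) : measurable_fun setT g ->
    (\forall x \ae mu, f x = g x) -> mu.-integrable setT (EFin \o g) ->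
    \int[mu]_x g x = 0 -> f \in mean0.
  move=> mg fg ig g0; apply/asboolP.
  have mf : measurable_fun setT f by [].
  have fgE : ae_eq mu setT (EFin \o f) (EFin \o g).
    by apply: filterS fg => x /= -> _.
  have mEf : measurable_fun setT (EFin \o f) by exact/measurable_EFinP.
  have mEg : measurable_fun setT (EFin \o g) by exact/measurable_EFinP.
  split; last by rewrite -g0 /Rintegral; congr fine; exact: ae_eq_integral.
  case/integrableP : ig => _ ig; apply/integrableP; split=> //.
  rewrite (ge0_ae_eq_integral _ _ _ _ _ (ae_eq_abse fgE))//.
  - exact: measurableT_comp.
  - exact: measurableT_comp.
  - by move=> x _; exact: abse_ge0.
  - by move=> x _; exact: abse_ge0.
have mean0_0 : 0 \in mean0.
  apply: (aeq _ (cst 0)) => //.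
  - by apply: filterS (Lp_reprZ 0 (0 : L2 mu)) => x; rewrite scale0r mul0r.
  - exact: integrable0.
  - by rewrite /Rintegral integral0.
split => // a f g /asboolP[inf f0] /asboolP[ing g0].
have iaf : mu.-integrable setT (EFin \o (fun x => a * (f : L2 mu) x)).
  exact: (integrableZl measurableT a inf).
apply: (aeq _ (fun x => a * (f : L2 mu) x + (g : L2 mu) x)).
- by apply: measurable_funD => //; exact: measurable_funM.
- have := Lp_reprD (a *: f) g; have := Lp_reprZ a f.
  by apply: filterS2 => x <- ->.
- exact: (integrableD measurableT iaf ing).
- by rewrite RintegralD// RintegralZl// f0 g0 mulr0 addr0.
Qed.

HB.instance Definition _ := GRing.isSubmodClosed.Build _ _ mean0
  mean0_submod_closed.

Definition L2_mean0 : Type := {f : L2 mu | f \in mean0}.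
HB.instance Definition _ := SubChoice.on L2_mean0.
HB.instance Definition _ := [SubChoice_isSubLmodule of L2_mean0 by <:].

Definition L2_mean0_norm (f : L2_mean0) : R := `|\val f|.

Lemma ler_L2_mean0_normD f g :
  L2_mean0_norm (f + g) <= L2_mean0_norm f + L2_mean0_norm g.
Proof. exact: (ler_normD (\val f)). Qed.

Lemma L2_mean0_normZ a f : L2_mean0_norm (a *: f) = `|a| * L2_mean0_norm f.
Proof. exact: (normrZ a (\val f)). Qed.

Lemma L2_mean0_norm0_eq0 f : L2_mean0_norm f = 0 -> f = 0.
Proof. by move=> /normr0_eq0 f0; exact: val_inj. Qed.

HB.instance Definition _ := Lmodule_isNormed.Build R L2_mean0
  ler_L2_mean0_normD L2_mean0_normZ L2_mean0_norm0_eq0.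

End L2_mean0.

Section neumann_to_dirichlet.
Context {R : realType} (n : nat).
Implicit Types (D : set 'rV[R]_n) (phi : 'rV[R]_n -> R).

Definition boundary D : set 'rV[R]_n := closure D `\` interior D.

Definition volume D :=
  caratheodory_measure [the outer_measure R 'rV[R]_n of lebesgue_on D].

(* surface measure on the boundary: (n-1)-dimensional Hausdorff measure *)
Definition surface D :=
  caratheodory_measure
    [the outer_measure R 'rV[R]_n of hausdorff_on n.-1 (boundary D)].

(* [Q] and [e] form an orthonormal frame, in which [y] has first n - 1
   coordinates [y *m Q] and last coordinate [(y *m e) ord0 ord0]; near [x], [D]
   is the strict epigraph of the Lipschitz function [h] *)
Definition lipschitz_boundary D := forall x, boundary D x ->
  exists (Q : 'M[R]_(n, n.-1)) (e : 'cV[R]_n) (h : 'rV[R]_n.-1 -> R)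
         (U : set 'rV[R]_n),
    [/\ Q^T *m Q = 1%:M, e^T *m e = 1%:M & Q^T *m e = 0] /\
    [/\ exists k, k.-lipschitz h, open U, U x &
      D `&` U = [set y | h (y *m Q) < (y *m e) ord0 ord0] `&` U].

Definition bounded_connected_lipschitz_domain D :=
  [/\ D !=set0, open D, bounded_set D, connected D & lipschitz_boundary D].

Definition partial (i : 'I_n) phi : 'rV[R]_n -> R :=
  fun x => 'D_(delta_mx ord0 i) phi x.

Fixpoint class_C k phi : Prop :=
  if k is k'.+1 then
    forall i, (forall x, derivable phi x (delta_mx ord0 i)) /\
              class_C k' (partial i phi)
  else continuous phi.

Definition smooth phi := forall k, class_C k phi.

Definition test_function D phi := smooth phi /\
  exists K, [/\ compact K, K `<=` D & forall x, ~ K x -> phi x = 0].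

Definition weak_gradient D (u : L2 (volume D)) (G : 'I_n -> L2 (volume D)) :=
  forall i phi, test_function D phi ->
    \int[volume D]_x (u x * partial i phi x) = - \int[volume D]_x (G i x * phi x).

Record H1 D := {
  H1_fun :> L2 (volume D);
  H1_grad : 'I_n -> L2 (volume D);
  H1_gradP : weak_gradient H1_fun H1_grad }.

(* [g] is the trace of [u]: the graph of the trace operator is the closure in
   H1 x L2(boundary) of the restrictions of smooth functions on R^n *)
Definition is_trace D (u : H1 D) (g : L2 (surface D)) :=
  exists phi : nat -> 'rV[R]_n -> R,
  [/\ forall k, smooth (phi k),
      (Lnorm (volume D) 2%:E (fun x => (phi k x - u x)%:E) @[k --> \oo] --> 0)%E,
      forall i, (Lnorm (volume D) 2%:E (fun x => (partial i (phi k) x - H1_grad u i x)%:E)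
        @[k --> \oo] --> 0)%E &
      (Lnorm (surface D) 2%:E (fun x => (phi k x - g x)%:E) @[k --> \oo] --> 0)%E].

Definition Linf D : normedModType R := Linfty (volume D).

Definition L2_diamond D : normedModType R := L2_mean0 (surface D).

Definition boundary_pairing D (f g : L2_diamond D) : R :=
  dot_L2 (\val (f : L2_mean0 (surface D))) (\val (g : L2_mean0 (surface D))).

Definition Linf_pos D : set (Linf D) :=
  [set sigma : Linfty (volume D) | (0 < ess_inf (volume D) (EFin \o sigma))%E].

(* weak form of - div (sigma grad u) = 0 in D, sigma d_nu u = f on the boundary *)
Definition weak_solution D (sigma : Linfty (volume D)) (f : L2 (surface D))
    (u : H1 D) :=
  forall (v : H1 D) (tv : L2 (surface D)), is_trace v tv ->
    \int[volume D]_x (sigma x * \sum_(i < n) H1_grad u i x * H1_grad v i x) =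
    \int[surface D]_x (f x * tv x).

(* [t], the trace of the solution, has mean zero by its type: this is the
   normalization that makes the solution unique. The default value [0] is only
   reached when no solution exists. *)
Definition neumann_to_dirichlet D (sigma : Linf D) (f : L2_diamond D) :
    L2_diamond D :=
  xget 0 [set t : L2_mean0 (surface D) | exists2 u : H1 D,
    weak_solution (sigma : Linfty (volume D))
      (\val (f : L2_mean0 (surface D))) u & is_trace u (\val t)].

End neumann_to_dirichlet.

Arguments Linf {R n} D.
Arguments Linf_pos {R n} D _.
Arguments L2_diamond {R n} D.

Section real_analytic.
Context {R : realType}.
Implicit Types X Y : normedModType R.

Definition multilinear_map Y1 Y2 j (F : ('I_j -> Y1) -> Y2) :=
  forall (i : 'I_j) (v : 'I_j -> Y1) (a : R) (x y : Y1),
    F [eta v with i |-> a *: x + y] =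
    a *: F [eta v with i |-> x] + F [eta v with i |-> y].

Definition symmetric_map Y1 Y2 j (F : ('I_j -> Y1) -> Y2) :=
  forall (s : {perm 'I_j}) (v : 'I_j -> Y1), F (v \o s) = F v.

Definition multilinear_norm Y1 Y2 j (F : ('I_j -> Y1) -> Y2) : \bar R :=
  ereal_sup [set (`|F v|)%:E | v in [set v | forall i, `|v i| <= 1]].

(* [U] is meant to be open: [rho] can be shrunk until the ball of radius [rho]
   around [y] lies in [U], so the values of [G] outside [U] are irrelevant *)
Definition real_analytic Y1 Y2 (U : set Y1) (G : Y1 -> Y2) :=
  forall y, U y -> exists (rho : R) (F : forall j, ('I_j -> Y1) -> Y2),
    [/\ 0 < rho,
        forall j, [/\ multilinear_map (F j), symmetric_map (F j) &
          continuous (F j : prod_topology (fun _ : 'I_j => Y1) -> Y2)],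
        (\sum_(0 <= j <oo) (multilinear_norm (F j) * (rho ^+ j)%:E) < +oo)%E &
        forall h, `|h| < rho ->
          series (fun j => F j (fun=> h)) @ \oo --> G (y + h)].

(* the last clause says that [phi] is an open map onto its image for the
   topology induced on [M]; for [U := V], that [phi @` V] is open in [M] *)
Definition analytic_manifold X (d : nat) (M : set X) :=
  forall a, M a -> exists (V : set 'rV[R]_d) (phi : 'rV[R]_d -> X),
    [/\ open V, real_analytic V phi,
        forall t, V t -> injective ('d phi t) &
        [/\ set_inj V phi, {within V, continuous phi}, (phi @` V) a &
          forall U, open U -> U `<=` V ->
            exists2 W, open W & phi @` U = M `&` W]].

Definition second_countable_set X (M : set X) := @second_countable (set_type M).

End real_analytic.

Section gaussian.
Context {R : realType}.

Definition borel (V : normedModType R) := g_sigma_algebraType (@open V).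

(* [normal_prob m 0] is not the point mass at [m] *)
Definition gaussian_law (m s : R) : set R -> \bar R :=
  if s == 0 then \d_m else normal_prob m s.

Definition gaussian_measure (V : normedModType R)
    (gamma : probability (borel V) R) :=
  forall l : {scalar V}, continuous l ->
    exists m s : R, forall A : set R, measurable A ->
      gamma (l @^-1` A) = gaussian_law m s A.

Variables (n : nat) (D : set 'rV[R]_n).
Variable gamma : probability (borel (L2_diamond D)) R.

Definition covariance_operator (C : L2_diamond D -> L2_diamond D) :=
  forall h k : L2_diamond D, (boundary_pairing (C h) k)%:E =
    covariance gamma (fun x : L2_diamond D => boundary_pairing x h)
                     (fun x : L2_diamond D => boundary_pairing x k).

Definition injective_covariance :=
  exists2 C, covariance_operator C & injective C.

End gaussian.

Section sampling.
Context d (S : measurableType d) (R : realType) (P : probability S R).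
Context d' (T : measurableType d').

Definition mutually_independent N (X : 'I_N -> {RV P >-> T}) :=
  forall (J : {set 'I_N}) (A : 'I_N -> set T), (forall i, measurable (A i)) ->
    P (\bigcap_(i in [set` J]) (X i @^-1` A i)) =
    (\prod_(i in J) P (X i @^-1` A i))%E.

Definition has_law (X : {RV P >-> T}) (nu : set T -> \bar R) :=
  forall A, measurable A -> distribution P X A = nu A.

End sampling.

(* Main.v *)
From HB Require Import structures.
Require Import Defs.
From mathcomp Require Import all_boot all_order all_algebra.
From mathcomp Require Import all_classical all_reals all_analysis.
From mathcomp Require Import measurable_realfun ess_sup_inf.
From mathcomp Require Import ring lra.

Set Implicit Arguments.
Unset Strict Implicit.
Unset Printing Implicit Defensive.

Import Order.TTheory GRing.Theory Num.Theory.
Import numFieldNormedType.Exports.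

Local Open Scope classical_set_scope.
Local Open Scope ring_scope.

(** Write $A=\Lambda_{\sigma_1}-\Lambda_{\sigma_2}$ and let $C$ be the covariance of $\gamma$. The
    proof combines a small ball estimate for the random number $\langle Af,g\rangle$ with a count of
    how many pairs $(\sigma_1,\sigma_2)$ have to be tested.

    Small balls. If $\sigma_1\ne\sigma_2$, then $A\ne0$ by injectivity, and since $C$ is injective
    some $k$ gives $w=ACk$ with $\langle Cw,w\rangle>0$; a lower bound persists for nearby pairs
    ([local_data]). Given $f$, the variable $\langle Af,g\rangle$ is Gaussian with variance $\langle
    CAf,Af\rangle\ge\langle f,w\rangle^2/\langle Ck,k\rangle$, and $\langle f,w\rangle$ is itself a
    nondegenerate Gaussian. Hence $P(|\langle Af,g\rangle|<D\eta^{n+1})\le G\eta^n$ for every $n$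
    and $0<\eta\le1$, with $G$ independent of $\eta$ ([product_small_ball]). The lost power of
    $\eta$ absorbs the logarithmic singularity of a product of two Gaussians.

    Counting. An analytic chart is locally Lipschitz, so near each of its points $\mathcal M$ is a
    countable union of pieces of box dimension at most $d$ ([manifold_net]). Put $n=2d+1$ and
    $\eta=1/q$. A pair of pieces is covered at scale $\eta^{n+1}$ by $q^{2d(n+1)}$ pairs of centres.
    If two conductivities of these pieces produce the same $M\ge n$ measurements, then for some pair
    of centres all $M$ numbers are $O(\eta^{n+1})$, because $\Lambda$ is Lipschitz in $\sigma$. By
    independence this has probability at most $q^{(n-1)(n+1)}(G q^{-n})^n=G^n/q$, which is
    arbitrarily small ([covering_count], [indistinguishable_piece]). Second countability of
    $\mathcal M$ leaves countably many pairs of open sets to treat ([generic_injectivity]).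

    Analysis. The argument needs $\Lambda_\sigma$ to be bounded and symmetric, to have separable
    range (for joint measurability of $\langle Af,g\rangle$) and to be locally Lipschitz in
    $\sigma$. All of this rests on a Poincare inequality that controls a smooth function, up to a
    constant, in $L^2(\Omega)$ and in $L^2(\partial\Omega)$ by its Dirichlet integral
    ([poincare_inequality]). It comes from integrating along segments of a cone at each boundary
    point ([core_estimate]), connectedness for the interior, and compactness. The Neumann problem is
    then solved by a minimizing sequence of smooth functions and completeness of $L^2$
    ([neumann_exists]), which fits the definition of traces as a closed graph. Lipschitz dependence
    is the identity $\langle g,\Lambda_{\sigma_1}f\rangle-\langle
    g,\Lambda_{\sigma_2}f\rangle=\int(\sigma_2-\sigma_1)\nabla u_{\sigma_1,f}\cdot\nabla
    u_{\sigma_2,g}$ ([solves_diff]). *)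

(** * Second countable spaces and measurability in products *)

Section countable_base.

Definition countable_base (T : topologicalType) :=
  exists B : nat -> set T, (forall i, open (B i)) /\
    forall U x, open U -> U x -> exists2 i, B i x & B i `<=` U.

Lemma countable_base_bigcup (T : topologicalType) : countable_base T ->
  exists B : nat -> set T, (forall i, open (B i)) /\
    forall U, open U -> U = \bigcup_(i in [set i | B i `<=` U]) B i.
Proof.
move=> [B [oB BU]]; exists B; split=> // U oU; apply/seteqP; split=> [x Ux|x [i BiU]].
  by have [i Bix BiU] := BU _ _ oU Ux; exists i.
exact: BiU.
Qed.

(** Balls of a [pseudoMetricType] need not be open, so the base is made of interiors of balls. *)
Lemma countable_base_dense (R : realType) (T : pseudoMetricType R)
    (I : countType) (q : I -> T) :
  (forall x e, 0 < e -> exists i, ball x e (q i)) -> countable_base T.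
Proof.
move=> qd; exists (fun k => if unpickle k is Some (i, m) then
  (ball (q i) (m : nat).+1%:R^-1)° else set0); split.
  by move=> k; case: unpickle => [[i m]|]; [exact: open_interior|exact: open0].
move=> U x oU Ux.
have /nbhs_ballP[e /= e0 eU] : nbhs x U by exact: open_nbhs_nbhs.
have [m m0] : exists m : nat, m.+1%:R^-1 < e / 2.
  have [m _ mE] := near_infty_natSinv_lt (PosNum (divr_gt0 e0 (ltr0n _ 2))).
  by exists m; apply: mE => /=.
have [i xi] := qd x (m.+1%:R^-1) (ltac:(by rewrite invr_gt0 ltr0n)).
have [i' xi'] := qd x (m.+1%:R^-1 / 2) (ltac:(by rewrite divr_gt0 ?invr_gt0 ?ltr0n)).
exists (pickle (i', m)); rewrite pickleK.
  apply/nbhs_ballP; exists (m.+1%:R^-1 / 2) => /=; first by rewrite divr_gt0 ?invr_gt0 ?ltr0n.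
  move=> y xy; rewrite [X in ball _ X](splitr _).
  by apply: ball_triangle xy; exact: ball_sym.
move=> y /interior_subset qy; apply: eU.
rewrite [e]splitr; apply: (@ball_triangle _ _ (q i')).
  apply: le_ball xi'; apply: le_trans (ltW m0); rewrite ler_pdivrMr ?ltr0n//.
  by rewrite ler_peMr ?invr_ge0 ?ler0n// ler1n.
by apply: le_ball qy; exact: ltW.
Qed.

Lemma countable_base_prod (T1 T2 : topologicalType) :
  countable_base T1 -> countable_base T2 -> countable_base (T1 * T2)%type.
Proof.
move=> [B1 [oB1 B1U]] [B2 [oB2 B2U]].
exists (fun k => if unpickle k is Some (i, j) then B1 i `*` B2 j else set0); split.
  move=> k; case: unpickle => [[i j]|]; last exact: open0.
  rewrite openE => -[x y] [/= Bx By]; exists (B1 i, B2 j) => //=.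
  by split; apply: open_nbhs_nbhs.
move=> U [x y] oU Uxy.
have [[V1 V2] /= [V1x V2y] VU] : nbhs (x, y) U by exact: open_nbhs_nbhs.
have [i B1x B1V] := B1U _ _ (open_interior V1) V1x.
have [j B2y B2V] := B2U _ _ (open_interior V2) V2y.
exists (pickle (i, j)); rewrite pickleK //.
move=> [a b] [/= /B1V/interior_subset Va /B2V/interior_subset Vb].
exact: VU.
Qed.

Lemma countable_base_R (R : realType) : countable_base R.
Proof.
apply: (@countable_base_dense R R rat (@ratr R)) => x e e0.
have /(_ (ball x e)°) [| |z [/interior_subset xz [q _ qz]]] := dense_rat (R := R).
  by exists x; apply: nbhsx_ballx.
  exact: open_interior.
by exists q; rewrite qz.
Qed.

Lemma countable_base_rV (R : realType) n : countable_base 'rV[R]_n.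
Proof.
apply: (@countable_base_dense R _ 'rV[rat]_n (map_mx (@ratr R))) => x e e0.
have H (j : 'I_n) : exists q : rat, ball (x ord0 j) e (ratr q).
  have /(_ (ball (x ord0 j) e)°) [| |z [/interior_subset xz [q _ qz]]] := dense_rat (R := R).
    by exists (x ord0 j); apply: nbhsx_ballx.
    exact: open_interior.
  by exists q; rewrite qz.
exists (\row_j xchoose (H j)); split=> // i j; rewrite !mxE !ord1.
exact: (xchooseP (H j)).
Qed.

(** Second countability turns [W] into a countable union of open rectangles, so it belongs to the
    product sigma-algebra. The maps [i1] and [i2] identify a measurable type with a topological one
    that has the same points. *)
Lemma open_prod_measurable (T1 T2 : topologicalType) d1 d2 (M1 : measurableType d1)
    (M2 : measurableType d2) (i1 : M1 -> T1) (i2 : M2 -> T2) :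
  countable_base T1 -> countable_base T2 ->
  (forall U, open U -> measurable (i1 @^-1` U)) ->
  (forall U, open U -> measurable (i2 @^-1` U)) ->
  forall W : set (T1 * T2), open W ->
    measurable [set p : M1 * M2 | W (i1 p.1, i2 p.2)].
Proof.
move=> [B1 [oB1 B1U]] [B2 [oB2 B2U]] m1 m2 W oW.
rewrite (_ : [set _ | _] = \bigcup_i \bigcup_j
   (if `[< B1 i `*` B2 j `<=` W >] then (i1 @^-1` B1 i) `*` (i2 @^-1` B2 j) else set0)).
  apply: bigcupT_measurable => i; apply: bigcupT_measurable => j.
  by case: ifPn => // _; apply: measurableX; [exact: m1|exact: m2].
apply/seteqP; split=> [[x y] /= Wxy|[x y] [i _ [j _]]]; last first.
  by case: ifPn => // /asboolP BW [/= ? ?]; apply: BW.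
have [[V1 V2] /= [V1x V2y] VW] : nbhs (i1 x, i2 y) W by exact: open_nbhs_nbhs.
have [i B1x B1V] := B1U _ _ (open_interior V1) V1x.
have [j B2y B2V] := B2U _ _ (open_interior V2) V2y.
exists i => //; exists j => //; case: ifPn => [_ //|/asboolP[]].
by move=> [a b] [/= /B1V/interior_subset Va /B2V/interior_subset Vb]; exact: VW.
Qed.

End countable_base.

(** * Borel sets, and Lebesgue measure on row vectors *)

Section borel_rV.
Context {R : realType}.

Lemma open_borel (V : normedModType R) (U : set V) : open U -> measurable (U : set (borel V)).
Proof. by move=> oU; exact: sub_gen_smallest. Qed.

Lemma closed_borel (V : normedModType R) (U : set V) : closed U -> measurable (U : set (borel V)).
Proof. by move=> cU; rewrite -[U]setCK; apply: measurableC; apply: open_borel; exact: closed_openC. Qed.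

Lemma borel_fun d (T : measurableType d) (V : normedModType R) (f : T -> V) :
  (forall U, open U -> measurable (f @^-1` U)) -> measurable_fun setT (f : T -> borel V).
Proof.
move=> fU; apply: (@measurability _ _ T (borel V) _ _ (@open V)) => //.
by move=> _ [U oU <-]; rewrite setTI; exact: fU.
Qed.

Lemma real_fun_measurable d (T : measurableType d) (f : T -> R) :
  (forall U, open U -> measurable (f @^-1` U)) -> measurable_fun setT f.
Proof.
move=> fU; apply: (measurability _ (RGenOpens.measurableE R)).
move=> _ [_ [a [b ->] <-]]; rewrite setTI; apply: fU; exact: interval_open.
Qed.

End borel_rV.

Definition push_measure d d' (T1 : measurableType d) (T2 : measurableType d') (R : realType)
    (m : {measure set T1 -> \bar R}) (f : T1 -> T2) (mf : measurable_fun setT f) :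
    {measure set T2 -> \bar R} :=
  measure_function_pushforward__canonical__measure_function_Measure m mf.

Section lebesgue_rV.
Context {R : realType}.
Local Notation mu := (@lebesgue_measure R).
Local Notation TR := (measurableTypeR R).

Definition row_of n (t : n.-tuple TR) : 'rV[R]_n := \row_i tnth t i.

(** Balls of the sup norm pull back to boxes, and every open set is a countable union of balls with
    rational centres and radii $1/(m+1)$. *)
Lemma measurable_row_of n : measurable_fun setT (@row_of n : _ -> borel 'rV[R]_n).
Proof.
have [B [oB BU]] := countable_base_bigcup (countable_base_rV R n).
suff mball (x : 'rV[R]_n) e : 0 < e -> measurable (@row_of n @^-1` ball x e).
  apply: borel_fun => U oU.
  have [Q [oQ QU]] : exists Q : nat -> 'rV[R]_n * R, (forall i, 0 < (Q i).2) /\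
      U = \bigcup_(i in [set i | ball (Q i).1 (Q i).2 `<=` U]) ball (Q i).1 (Q i).2.
    have [U0|/set0P[x0 Ux0]] := eqVneq U set0.
      exists (fun=> (0, 1)); split=> [i|]; first exact: ltr01.
      rewrite U0 bigcup0// => i /= b0; apply/seteqP; split=> //.
    pose q (k : nat) : 'rV[R]_n * R := if (unpickle k : option ('rV[rat]_n * nat)) is Some (v, m) then
       (map_mx ratr v, m.+1%:R^-1) else (0, 1).
    exists q; split=> [i|].
      by rewrite /q; case: unpickle => [[v m]|]; rewrite ?ltr01//= invr_gt0 ltr0n.
    apply/seteqP; split=> [x Ux|x [i iU]]; last exact: iU.
    have /nbhs_ballP[e /= e0 eU] : nbhs x U by exact: open_nbhs_nbhs.
    have [m m0] : exists m : nat, m.+1%:R^-1 < e / 2.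
      have [m _ mE] := near_infty_natSinv_lt (PosNum (divr_gt0 e0 (ltr0n _ 2))).
      by exists m; apply: mE => /=.
    have m1 : 0 < m.+1%:R^-1 :> R by rewrite invr_gt0 ltr0n.
    have H (j : 'I_n) : exists r : rat, ball (x ord0 j) m.+1%:R^-1 (ratr r : R).
      have /(_ (ball (x ord0 j) m.+1%:R^-1)°) [| |z [/interior_subset xz [r _ rz]]] := dense_rat (R := R).
      - by exists (x ord0 j); apply: nbhsx_ballx.
      - exact: open_interior.
      - by exists r; rewrite rz.
    have xv : ball x m.+1%:R^-1 (map_mx ratr (\row_j xchoose (H j)) : 'rV[R]_n).
      by split=> // i j; rewrite !mxE !ord1; exact: (xchooseP (H j)).
    exists (pickle (\row_j xchoose (H j), m)).
      rewrite /q/= pickleK/= => y qy; apply: eU; rewrite [e]splitr.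
      apply: ball_triangle (le_ball (ltW m0) qy); apply: le_ball xv; exact: ltW.
    by rewrite /q/= pickleK/=; apply: ball_sym.
  rewrite {1}QU preimage_bigcup; apply: bigcup_measurable => i _.
  exact: mball.
move=> e0; rewrite (_ : _ @^-1` _ = \bigcap_(i in [set: 'I_n]) ((fun t : n.-tuple TR => tnth t i) @^-1` ball (x ord0 i) e)).
  apply: fin_bigcap_measurable => // i _; rewrite -[X in measurable X]setTI.
  by apply: measurable_tnth => //; apply: open_measurable; exact: ball_open.
apply/seteqP; split=> t /=.
  by move=> [_ H] i _ /=; have := H ord0 i; rewrite mxE.
by move=> H; split=> // i j; rewrite ord1 mxE; exact: H.
Qed.

Lemma power_measureE n (A : 'I_n -> set TR) : (forall i, measurable (A i)) ->
  power_measure mu n [set t | forall i, A i (tnth t i)] = (\prod_(i < n) mu (A i))%E.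
Proof.
elim: n A => [|n IH] A mA.
  by rewrite big_ord0 /= diracE mem_set//= => -[].
rewrite big_ord_recl -IH//= /cons_measure /pushforward.
rewrite (_ : _ @^-1` _ = A ord0 `*` [set t | forall i, A (lift ord0 i) (tnth t i)]).
  rewrite product_measure1E//.
  rewrite (_ : [set t | _] = \bigcap_(i in [set: 'I_n]) ((fun t : n.-tuple TR => tnth t i) @^-1` A (lift ord0 i))).
    apply: fin_bigcap_measurable => // i _; rewrite -[X in measurable X]setTI.
    exact: measurable_tnth.
  by apply/seteqP; split=> t /= tA i; [move=> _; exact: tA|exact: (tA i)].
apply/seteqP; split=> [[x t] /= H|[x t] /= [H0 H] i].
  split=> [|i]; first exact: (H ord0).
  by have := H (lift ord0 i); rewrite tnthS.
have [j ->|->] := unliftP ord0 i; last exact: H0.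
by rewrite tnthS.
Qed.

Lemma lam_sigma_finite n : sigma_finite [set: borel 'rV[R]_n]
  (push_measure (power_measure mu n) (@measurable_row_of n)).
Proof.
exists (fun k => ball (0 : 'rV[R]_n) k.+1%:R).
  apply/esym/seteqP; split=> // x _; exists (Num.truncn `|x|) => //.
  by rewrite -ball_normE /= sub0r normrN truncnS_gt.
move=> k; split; first by apply: open_borel; exact: ball_open.
rewrite /push_measure /= /pushforward (_ : _ @^-1` _ = [set t | forall i, (ball (0:R) k.+1%:R) (tnth t i)]).
  have -> := @power_measureE n (fun=> ball (0 : R) k.+1%:R) (fun=> measurable_ball _ _).
  rewrite (eq_bigr (fun=> (k.+1%:R *+ 2)%:E)); last first.
    by move=> i _; rewrite lebesgue_measure_ball.
  by rewrite prodEFin ltry.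
apply/seteqP; split=> t /=.
  by move=> [_ H] i /=; have := H ord0 i; rewrite !mxE.
by move=> H; split=> [|i j]; rewrite ?ltr0n// ord1 !mxE; exact: H.
Qed.

(** Lebesgue measure of $\mathbb R^n$ on the Borel sets, packed as a sigma-finite measure so that
    Fubini's theorem applies to it. *)
Definition lam n : {sigma_finite_measure set (borel 'rV[R]_n) -> \bar R} :=
  HB.pack (Measure.sort (push_measure (power_measure mu n) (@measurable_row_of n)))
    (Measure.class (push_measure (power_measure mu n) (@measurable_row_of n)))
    (Measure_isSigmaFinite.Build _ _ _ _ (@lam_sigma_finite n)).

Lemma preimage_row_of_measurable n (A : set (borel 'rV[R]_n)) : measurable A ->
  measurable (@row_of n @^-1` A).
Proof. by move=> mA; rewrite -[X in measurable X]setTI; exact: measurable_row_of. Qed.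

Lemma lebesgue_onE n (D A : set 'rV[R]_n) : measurable (A `&` D : set (borel 'rV[R]_n)) ->
  lebesgue_on D A = lam n (A `&` D).
Proof.
move=> mAD; rewrite /lebesgue_on measurable_mu_extE//.
exact: preimage_row_of_measurable.
Qed.

Lemma borel_caratheodory_volume n (D : set 'rV[R]_n) (A : set (borel 'rV[R]_n)) :
  measurable A -> (lebesgue_on D).-caratheodory A.
Proof.
move=> mA X.
have mA' := @sub_gen_smallest _ _ _ _ (preimage_row_of_measurable mA).
have /(_ [set t | (X `&` D) (row_of t)]) :=
  @sub_caratheodory _ _ _ (power_measure mu n) (@row_of n @^-1` A) (mA' _).
rewrite /lebesgue_on => ->; congr (_ + _)%E; congr (mu_ext _ _);
  by apply/seteqP; split=> t; rewrite /preimage /setI /setC /=; tauto.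
Qed.

(** Uniqueness of Lebesgue measure: $s$ times the image of [mu] under $x\mapsto v+sx$ gives
    half-open intervals their length. *)
Lemma lebesgue_affine (s v : R) (A : set TR) : 0 < s -> measurable A ->
  mu ((fun x => v + s * x) @^-1` A) = ((s^-1)%:E * mu A)%E.
Proof.
move=> s0 mA.
have mf : measurable_fun setT ((fun x => v + s * x) : TR -> TR).
  by apply: measurable_funD => //; apply: measurable_funM.
pose m : {measure set TR -> \bar R} := mscale (NngNum (ltW s0)) (push_measure mu mf).
have m_mu : forall B, measurable B -> mu B = m B.
  apply: lebesgue_measure_unique => _ [[a b]] _ <-.
  rewrite /m /= /mscale /= /push_measure /= /pushforward.
  rewrite (_ : _ @^-1` _ = `](a - v) / s, (b - v) / s]%classic).
    rewrite !lebesgue_measure_itv /= !lte_fin ltr_pM2r ?invr_gt0// ltrBlDr subrK.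
    case: ifPn => _; last by rewrite mule0.
    by rewrite -!EFinD -EFinM; congr EFin; field; exact: lt0r_neq0.
  apply/seteqP; split=> x; rewrite /= !in_itv/= ltr_pdivrMr// ler_pdivlMr// ltrBlDl lerBrDl mulrC//.
rewrite (m_mu _ mA) /m /= /mscale /= /push_measure /= /pushforward muleA -EFinM mulVf ?mul1e//.
exact: lt0r_neq0.
Qed.

Definition affine_tuple n (v : 'I_n -> R) (s : R) (t : n.-tuple TR) : n.-tuple TR :=
  [tuple (v i + s * tnth t i) | i < n].

Lemma measurable_affine_tuple n (v : 'I_n -> R) (s : R) :
  measurable_fun setT (affine_tuple v s).
Proof.
apply/measurable_fun_tnthP => i; rewrite (_ : _ \o _ = (fun t => v i + s * tnth t i)).
  apply: measurable_funD => //; apply: measurable_funM => //.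
  exact: measurable_tnth.
by apply/funext => t /=; rewrite tnth_mktuple.
Qed.

(** Induction by slicing off the first coordinate: each section of the preimage is the affine
    preimage of a section of [A], and the one-dimensional change of variables handles the outer
    integral. *)
Lemma power_measure_affine n (v : 'I_n -> R) (s : R) (A : set (n.-tuple TR)) :
  0 < s -> measurable A ->
  power_measure mu n (affine_tuple v s @^-1` A) =
  ((s^-1 ^+ n)%:E * power_measure mu n A)%E.
Proof.
move=> s0; elim: n v A => [|n IH] v A mA.
  rewrite expr0 mul1e; congr (dirac _ _); apply/seteqP; split=> t /=; rewrite (tuple0 t);
  by rewrite (tuple0 (affine_tuple _ _ _)).
have s1 : 0 <= s^-1 ^+ n by rewrite exprn_ge0// invr_ge0 ltW.
pose ct : TR * n.-tuple TR -> n.+1.-tuple TR := @Defs.cons_tuple _ _ n.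
have mcons B : measurable B -> measurable (ct @^-1` B).
  by move=> mB; rewrite -[X in measurable X]setTI; exact: measurable_cons_tuple.
rewrite /= /cons_measure /pushforward.
rewrite -/ct; pose B := ct @^-1` A; rewrite -/B.
have mB : measurable B by exact: mcons.
have maff : measurable (affine_tuple v s @^-1` A).
  by rewrite -[X in measurable X]setTI; exact: measurable_affine_tuple.
rewrite /product_measure1 /=.
have E x : xsection (ct @^-1` (affine_tuple v s @^-1` A)) x =
    affine_tuple (v \o lift ord0) s @^-1` (xsection B (v ord0 + s * x)).
  apply/seteqP; split=> t; rewrite /xsection /= !inE /B /=; (suff -> : affine_tuple v s (ct (x, t)) =
     ct (v ord0 + s * x, affine_tuple (v \o lift ord0) s t) by []);
  apply: eq_from_tnth => i; rewrite tnth_mktuple;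
  by have [j ->|->] := unliftP ord0 i; rewrite ?tnthS ?tnth_mktuple.
rewrite (@eq_integral _ TR R mu setT (fun x : TR => (s^-1 ^+ n)%:E * power_measure mu n (xsection B (v ord0 + s * x)%R)))%E; last first.
  by move=> x _; rewrite /= E IH//; exact: measurable_xsection.
have mF : measurable_fun setT ((fun x => v ord0 + s * x) : TR -> TR).
  by apply: measurable_funD => //; exact: measurable_funM.
have mxs := measurable_fun_xsection (power_measure mu n) mB.
rewrite ge0_integralZl//; last exact: (measurableT_comp mxs mF).
have := @ge0_integral_pushforward _ _ TR TR R _ mF mu setT _ measurableT mxs (ltac:(by [])).
rewrite preimage_setT /= => <-.
have S0 : 0 <= s^-1 by rewrite invr_ge0 ltW.
rewrite (@eq_measure_integral _ TR R setT (mscale (NngNum S0) mu)).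
  by rewrite ge0_integral_mscale//= muleA -EFinM -exprSr.
by move=> C mC _; exact: lebesgue_affine.
Qed.

Lemma lam_affine n (v : 'rV[R]_n) (s : R) (A : set (borel 'rV[R]_n)) :
  0 < s -> measurable A ->
  lam n ((fun x : 'rV[R]_n => v + s *: x) @^-1` A) = ((s^-1 ^+ n)%:E * lam n A)%E.
Proof.
move=> s0 mA; rewrite /lam /= /pushforward.
rewrite -(power_measure_affine (fun i => v ord0 i))//; last exact: preimage_row_of_measurable.
congr (power_measure _ _ _); apply/seteqP; split=> t /=;
  (suff -> : row_of (affine_tuple (fun i => v ord0 i) s t) = v + s *: row_of t by []);
  by apply/rowP => i; rewrite !mxE tnth_mktuple.
Qed.

Lemma continuous_affine n (v : 'rV[R]_n) (s : R) : continuous (fun x : 'rV[R]_n => v + s *: x).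
Proof.
move=> x; apply: continuousD; first exact: cst_continuous.
by apply: continuousZl_tmp.
Qed.

Lemma continuous_borel (V W : normedModType R) (f : V -> W) : continuous f ->
  measurable_fun setT (f : borel V -> borel W).
Proof.
move=> cf; apply: borel_fun => U oU; apply: open_borel.
by move/continuousP : cf; apply.
Qed.

Lemma integral_lam_affine n (v : 'rV[R]_n) (s : R) (f : borel 'rV[R]_n -> \bar R) :
  0 < s -> measurable_fun setT f -> (forall x, (0 <= f x)%E) ->
  (\int[lam n]_x f (v + s *: x)%R = (s^-1 ^+ n)%:E * \int[lam n]_x f x)%E.
Proof.
move=> s0 mf f0.
have mF := continuous_borel (@continuous_affine n v s).
have E := @ge0_integral_pushforward _ _ _ _ R _ mF (lam n) setT _ measurableT mf (ltac:(by [])).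
rewrite preimage_setT in E; rewrite -[LHS]E.
have S0 : 0 <= s^-1 ^+ n by rewrite exprn_ge0// invr_ge0 ltW.
rewrite (@eq_measure_integral _ _ R setT (mscale (NngNum S0) (lam n))).
  by rewrite ge0_integral_mscale.
by move=> C mC _; exact: lam_affine.
Qed.

Lemma lam_ball n (x : 'rV[R]_n) (r : R) : 0 < r ->
  lam n (ball x r) = ((r *+ 2) ^+ n)%:E.
Proof.
move=> r0; rewrite /lam /= /pushforward.
rewrite (_ : _ @^-1` _ = [set t | forall i, (ball (x ord0 i) r) (tnth t i)]).
  have -> := @power_measureE n (fun i => ball (x ord0 i) r) (fun=> measurable_ball _ _).
  rewrite (eq_bigr (fun=> (r *+ 2)%:E)); last first.
    by move=> i _; rewrite lebesgue_measure_ball// ltW.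
  by rewrite prodEFin big_const_ord iter_mulr_1.
apply/seteqP; split=> t /=.
  by move=> [_ H] i /=; have := H ord0 i; rewrite !mxE.
by move=> H; split=> // i j; rewrite ord1 !mxE; exact: H.
Qed.

End lebesgue_rV.


#[global] Opaque lam.

(** * Caratheodory's criterion for metric outer measures *)

Section metric_outer_measure.
Context {R : realType} {n : nat}.
Variable mu : {outer_measure set 'rV[R]_n -> \bar R}.

(** Only one inequality is asked for; the other one is subadditivity. *)
Definition separated_additive := forall (A B : set 'rV[R]_n) (e : R), 0 < e ->
  (forall a b, A a -> B b -> e <= `|a - b|) -> (mu A + mu B <= mu (A `|` B))%E.

Hypothesis muS : separated_additive.

Lemma separated_sum (S : nat -> set 'rV[R]_n) (X : set 'rV[R]_n) N :
  (forall j, S j `<=` X) ->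
  (forall j, exists2 e : R, 0 < e & forall a b l, (j < l)%N -> S j a -> S l b -> e <= `|a - b|) ->
  (\sum_(0 <= j < N) mu (S j) <= mu X)%E.
Proof.
move=> SX sep.
have H i k : (\sum_(k <= j < k + i) mu (S j) <= mu (\bigcup_(j in [set j | (k <= j < k + i)%N]) S j))%E.
  elim: i k => [|i IH] k; first by rewrite addn0 big_geq.
  rewrite big_ltn ?addnS ?ltnS ?leq_addr//.
  apply: (@le_trans _ _ (mu (S k) + mu (\bigcup_(j in [set j | (k.+1 <= j < k.+1 + i)%N]) S j))%E).
    by apply: leeD => //; have := IH k.+1; rewrite addSn.
  have [e e0 se] := sep k.
  apply: (le_trans (muS e0 _)); last first.
    apply: le_outer_measure => x [Sx|[j /= /andP[kj ji] Sx]].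
      by exists k => //=; rewrite leqnn ltnS leq_addr.
    by exists j => //=; rewrite ltnW//= -addSn.
  by move=> a b Sa [j /= /andP[kj _] Sb]; exact: se Sa Sb.
apply: (@le_trans _ _ (mu (\bigcup_(j in [set j | (0 <= j < 0 + N)%N]) S j))).
  by have := H N 0%N; rewrite add0n.
by apply: le_outer_measure; exact: bigcup_sub.
Qed.

(** Caratheodory's argument. The part [Xk k] of [X] at distance at least $1/(k+1)$ from [C] is
    separated from [C], and what is missing of [X] outside [C] is a tail of the shells [S j]. The
    measures of the shells have a finite sum, so the tail vanishes in the limit. *)
Lemma closed_caratheodory (C : set 'rV[R]_n) : closed C -> mu.-caratheodory C.
Proof.
move=> cC; apply: le_caratheodory_measurable => X.
have [->|Xoo] := eqVneq (mu X) +oo%E; first by rewrite leey.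
have Xfin : (mu X < +oo)%E by rewrite lt_neqAle leey andbT.
pose Xk k := [set x | X x /\ forall c, C c -> k.+1%:R^-1 <= `|x - c|].
pose S k := Xk k.+1 `\` Xk k.
have inv0 (k : nat) : 0 < k.+1%:R^-1 :> R by rewrite invr_gt0 ltr0n.
have SX k : S k `<=` X by move=> x [[]].
have leinv (k l : nat) : (k <= l)%N -> l.+1%:R^-1 <= k.+1%:R^-1 :> R.
  by move=> kl; rewrite lef_pV2 ?posrE ?ltr0n// ler_nat ltnS.
have XkX k : (mu (X `&` C) + mu (Xk k) <= mu X)%E.
  apply: le_trans (muS (inv0 k) _) _.
    by move=> a b [_ Ca] [_ Hb]; rewrite distrC; exact: Hb.
  by apply: le_outer_measure => x [[]//|[]].
have Xcup k : X `&` ~` C `<=` Xk k `|` \bigcup_(j in ~` `I_k) S j.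
  move=> x [Xx nCx].
  have [m mC] : exists m, Xk m x.
    have /nbhs_ballP[e /= e0 eC] : nbhs x (~` C).
      by apply: open_nbhs_nbhs; split => //; exact: closed_openC.
    have [m _ mE] := near_infty_natSinv_lt (PosNum e0).
    exists m; split=> // c Cc; have := mE m (leqnn _) => /= mlt.
    rewrite leNgt; apply/negP => xc; have := eC c; rewrite -ball_normE /=.
    by move=> /(_ (lt_trans xc mlt)); apply.
  have [|nXk] := pselect (Xk k x); first by left.
  right; have km : (k <= m)%N.
    rewrite leqNgt; apply/negP => mk; apply: nXk; split=> // c Cc.
    by case: mC => _ /(_ _ Cc); apply: le_trans; apply/leinv/ltnW.
  elim: m km mC => [|m IH]; first by rewrite leqn0 => /eqP k0 X0; case: nXk; rewrite k0.
  rewrite leq_eqVlt => /predU1P[km Xm|]; first by case: nXk; rewrite km.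
  rewrite ltnS => km mC; have [/(IH km)//|nm] := pselect (Xk m x).
  by exists m => //=; apply/negP; rewrite -leqNgt.
(* Neighbouring shells may touch, but shells of equal parity are at positive distance, so even and
   odd shells are summed separately. *)
have half (b : nat) N : (\sum_(0 <= j < N) mu (S (j.*2 + b)%N) <= mu X)%E.
  apply: (@separated_sum (fun j => S (j.*2 + b)%N)) => // j.
  set q := (j.*2 + b)%N.
  exists (q.+2%:R^-1 - q.+3%:R^-1).
    by rewrite subr_gt0 ltf_pV2 ?posrE ?ltr0n// ltr_nat.
  move=> x y l jl [[_ Hx] _] [[Xy _]] nXy.
  have [c Cc yc] : exists2 c, C c & `|y - c| < q.+3%:R^-1.
    apply: contrapT => nc; apply: nXy; split=> // c Cc.
    rewrite leNgt; apply/negP => yc; apply: nc; exists c => //.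
    apply: (lt_le_trans yc); apply: leinv.
    by rewrite /q -addn2 addnAC leq_add2r addn2 -doubleS leq_double.
  have := Hx _ Cc; rewrite -(subrKA y) => h.
  have := le_trans h (ler_normD _ _); rewrite lerBlDr => /le_trans; apply.
  by rewrite lerD2l ltW.
have pair N : (\sum_(0 <= j < N.*2) mu (S j) =
    \sum_(0 <= j < N) mu (S (j.*2 + 0)%N) + \sum_(0 <= j < N) mu (S (j.*2 + 1)%N))%E.
  elim: N => [|N IH]; first by rewrite !big_geq// adde0.
  by rewrite doubleS !big_nat_recr//= IH addn0 addn1 -!addeA; congr (_ + _)%E; rewrite addeCA.
have Soo : (\sum_(0 <= j <oo) mu (S j) < +oo)%E.
  apply: (@le_lt_trans _ _ (mu X + mu X)%E); last exact: lte_add_pinfty.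
  apply: lime_le; first by apply: is_cvg_nneseries => *; exact: outer_measure_ge0.
  apply: nearW => N; apply: (@le_trans _ _ (\sum_(0 <= j < N.*2) mu (S j))%E).
    apply: lee_sum_nneg_natr; last by rewrite -addnn leq_addr.
    by move=> *; exact: outer_measure_ge0.
  by rewrite pair; apply: leeD; exact: half.
have tail0 := nneseries_tail_cvg Soo (fun k _ => outer_measure_ge0 mu (S k)).
have Hk k : (mu (X `&` C) + mu (X `&` ~` C) <= mu X + \sum_(k <= j <oo) mu (S j))%E.
  apply: (@le_trans _ _ (mu (X `&` C) + (mu (Xk k) + \sum_(k <= j <oo) mu (S j)))%E); last first.
    by rewrite addeA leeD2r.
  rewrite leeD2l//; apply: (le_trans (le_outer_measure mu _ _ (Xcup k))).
  apply: (le_trans (outer_measureU2 _ _ _)); rewrite leeD2l//.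
  exact: outer_measure_sigma_subadditive_tail.
have XT : (mu X + \sum_(k <= j <oo) mu (S j) @[k --> \oo] --> mu X + 0)%E.
  by apply: cvgeD => //; [rewrite fin_num_adde_defl|exact: cvg_cst].
rewrite adde0 in XT; rewrite -(cvg_lim _ XT)//.
by apply: lime_ge; [apply/cvg_ex; exists (mu X)|exact: nearW].
Qed.

Lemma borel_caratheodory (A : set (borel 'rV[R]_n)) : measurable A -> mu.-caratheodory A.
Proof.
have S : sigma_algebra setT mu.-caratheodory.
  split; first exact: caratheodory_measurable_set0.
  - by move=> B mB; rewrite setTD; exact: caratheodory_measurable_setC.
  - by move=> F mF; exact: caratheodory_measurable_bigcup.
apply: smallest_sub => // U oU; rewrite -[U]setCK.
by apply: caratheodory_measurable_setC; apply: closed_caratheodory; exact: open_closedC.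
Qed.

End metric_outer_measure.

(** * Finite nets and Hausdorff measure *)

(** The cube of side $2r$ is cut into $N^d$ cells, and one point of [T] is chosen in every cell that
    meets [T]. Having the centres inside [T] matters later, because the small ball estimates hold
    only at points of the covered set. *)
Lemma finite_net (R : realType) d (T : set 'rV[R]_d) (z : 'rV[R]_d) (r : R) (N : nat) :
  0 < r -> (0 < N)%N -> T !=set0 -> T `<=` ball z r ->
  exists t : {ffun 'I_d -> 'I_N} -> 'rV[R]_d, (forall c, T (t c)) /\
    forall p, T p -> exists c, `|p - t c| <= r *+ 2 / N%:R.
Proof.
move=> r0 N0 [x0 Tx0] Tz.
have NR : 0 < N%:R :> R by rewrite ltr0n.
pose q (p : 'rV[R]_d) (i : 'I_d) : R := (p ord0 i - z ord0 i + r) * N%:R / (r *+ 2).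
have r2 : 0 < r *+ 2 by rewrite mulrn_wgt0.
have q0 p i : T p -> 0 <= q p i < N%:R.
  move=> /Tz [_ /(_ ord0 i)]; rewrite /ball /= distrC ltr_norml => /andP[h1 h2].
  rewrite /q divr_ge0 ?(ltW r2)//=; last first.
    by rewrite mulr_ge0// addrC -lerBlDl sub0r ltW.
  by rewrite ltr_pdivrMr// mulrC ltr_pM2l// -ltrBrDr mulr2n addrK.
(* A cell that misses [T] receives the default point [x0]. *)
have /choice[tc Htc] (c : {ffun 'I_d -> 'I_N}) : exists x, T x /\ forall p, T p ->
    (forall i, Num.truncn (q p i) = c i) -> forall i, Num.truncn (q x i) = c i.
  have [[p [Tp pc]]|nex] := pselect (exists p, T p /\ forall i, Num.truncn (q p i) = c i).
    by exists p.
  by exists x0; split=> // p Tp pc; exfalso; apply: nex; exists p.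
exists tc; split=> [c|p Tp]; first by have [] := Htc c.
have lt i : (Num.truncn (q p i) < N)%N.
  by have /andP[? ?] := q0 p i Tp; rewrite truncn_lt_nat.
pose c := [ffun i => Ordinal (lt i)]; exists c.
have [Tc /(_ p Tp) Hc] := Htc c.
have {}Hc i : Num.truncn (q (tc c) i) = Num.truncn (q p i).
  by rewrite Hc ?ffunE// => j; rewrite ffunE.
have rN : 0 <= r *+ 2 / N%:R by rewrite divr_ge0 ?ltW.
rewrite [leLHS]/Num.norm /= mx_normrE; apply/bigmax_leP; split=> // -[i j] _ /=.
rewrite ord1 !mxE.
have [/andP[a1 a2] /andP[b1 b2]] := (q0 p j Tp, q0 _ j Tc).
have /andP[u1 u2] := truncn_itv a1; have /andP[v1 v2] := truncn_itv b1.
rewrite Hc in v1 v2.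
have E : p ord0 j - tc c ord0 j = (q p j - q (tc c) j) * (r *+ 2 / N%:R).
  by rewrite /q; field; rewrite !lt0r_neq0// mulr_gt0.
rewrite E normrM (ger0_norm rN) ler_piMl//.
by rewrite ler_norml; move: u2 v2; rewrite -!natr1; lra.
Qed.

Section hausdorff_facts.
Context {R : realType} {n : nat}.

Lemma enorm_ge0 (x : 'rV[R]_n) : 0 <= enorm x.
Proof. exact: sqrtr_ge0. Qed.

Lemma norm_le_enorm (x : 'rV[R]_n) : `|x| <= enorm x.
Proof.
rewrite [leLHS]/Num.norm /= mx_normrE; apply/bigmax_leP; split; first exact: enorm_ge0.
move=> [i j] _ /=; rewrite ord1 -sqrtr_sqr ler_sqrt; last by apply: sumr_ge0 => k _; exact: sqr_ge0.
by rewrite (bigD1 j)//= lerDl sumr_ge0// => k _; exact: sqr_ge0.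
Qed.

Lemma coord_le_norm (x : 'rV[R]_n) i : `|x ord0 i| <= `|x|.
Proof.
rewrite [leRHS]/Num.norm /= mx_normrE.
by apply: (le_bigmax _ (fun ij => `|x ij.1 ij.2|) (ord0, i)).
Qed.

Lemma sqr_enorm (x : 'rV[R]_n) : enorm x ^+ 2 = \sum_i x ord0 i ^+ 2.
Proof. by rewrite sqr_sqrtr// sumr_ge0// => k _; exact: sqr_ge0. Qed.

Lemma enorm_le_norm (x : 'rV[R]_n) : enorm x <= n%:R * `|x|.
Proof.
rewrite -ler_sqr ?nnegrE ?enorm_ge0 ?mulr_ge0// sqr_enorm.
apply: (@le_trans _ _ (n%:R * `|x| ^+ 2)).
  apply: (@le_trans _ _ (\sum_(i < n) `|x| ^+ 2)); last by rewrite sumr_const card_ord mulr_natl.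
  apply: ler_sum => i _; rewrite -real_normK ?num_real// ler_sqr ?nnegrE//.
  exact: coord_le_norm.
rewrite exprMn ler_wpM2r ?sqr_ge0// -natrX ler_nat.
by case: (n) => // j; rewrite expnS leq_pmulr// expn1.
Qed.

Variable k : nat.

Lemma diameter_ub (A : set 'rV[R]_n) (x y : 'rV[R]_n) : A x -> A y ->
  ((enorm (x - y))%:E <= diameter A)%E.
Proof. by move=> Ax Ay; apply: ereal_sup_ubound; right; exists x => //; exists y. Qed.

Lemma le_mu_ext_gauge (e1 e2 : R) (A : set 'rV[R]_n) : e1 <= e2 ->
  (mu_ext (hausdorff_gauge k e2) A <= mu_ext (hausdorff_gauge k e1) A)%E.
Proof.
move=> e12; apply: le_ereal_inf_tmp => _ [F [mF AF] <-].
apply: (@le_trans _ _ (\sum_(0 <= i <oo) hausdorff_gauge k e2 (F i))%E).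
  by apply: ereal_inf_lbound; exists F.
apply: lee_nneseries => [i _ _|i _]; first exact: hausdorff_gauge_ge0.
rewrite /hausdorff_gauge; case: ifPn => // _.
have [d1|_] := boolP (diameter (F i) <= e1%:E)%E; last by rewrite leey.
by rewrite (le_trans d1)// lee_fin.
Qed.

(** A covering set of diameter less than [e] cannot meet both parts, so a fine cover of the union
    splits into covers of the parts. *)
Lemma hausdorff_separated (D : set 'rV[R]_n) :
  @separated_additive R n (hausdorff_on k D).
Proof.
move=> A B e e0 AB; rewrite /= /hausdorff_on setIUl.
set A' := A `&` D; set B' := B `&` D.
have {}AB a b : A' a -> B' b -> e <= `|a - b| by move=> [+ _] [+ _]; exact: AB.
pose m (dl : R) (X : set 'rV[R]_n) := mu_ext (@hausdorff_gauge R n k dl) X.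
have mH dl X : 0 < dl -> (m dl X <= hausdorff k X)%E.
  by move=> dl0; apply: ereal_sup_ubound; exists dl.
have key dl : 0 < dl -> dl < e -> (m dl A' + m dl B' <= m dl (A' `|` B'))%E.
  move=> dl0 dle; apply: le_ereal_inf_tmp => _ [F [mF ABF] <-].
  pose G (X : set 'rV[R]_n) i := if `[< F i `&` X !=set0 >] then F i else set0.
  have GX X : X `<=` A' `|` B' -> (m dl X <= \sum_(0 <= i <oo) hausdorff_gauge k dl (G X i))%E.
    move=> XAB; apply: ereal_inf_lbound; exists (G X) => //; split=> // x Xx.
    have [i _ Fi] := ABF _ (XAB _ Xx); exists i => //.
    by rewrite /G asboolT//; exists x.
  apply: (le_trans (leeD (GX A' (@subsetUl _ _ _)) (GX B' (@subsetUr _ _ _)))).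
  rewrite -nneseriesD; [|by move=> *; exact: hausdorff_gauge_ge0|by move=> *; exact: hausdorff_gauge_ge0].
  apply: lee_nneseries => [i _ _|i _].
    by rewrite adde_ge0//; exact: hausdorff_gauge_ge0.
  rewrite /G; case: asboolP => [[a [Fa Aa]]|_]; last first.
    by rewrite hausdorff_gauge0 add0e; case: asboolP => // _; rewrite hausdorff_gauge0 hausdorff_gauge_ge0.
  case: asboolP => [[b [Fb Bb]]|_]; last by rewrite hausdorff_gauge0 adde0.
  rewrite [leRHS]/hausdorff_gauge; case: ifPn => [/eqP F0|_]; first by rewrite F0 in Fa.
  case: ifPn => [dF|]; last by rewrite leey.
  exfalso; have := le_trans (diameter_ub Fa Fb) dF; rewrite lee_fin leNgt => /negP; apply.
  by apply: (lt_le_trans dle); apply: le_trans (norm_le_enorm _); exact: AB.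
(* Two independent scales, because the suprema that define the two Hausdorff measures are taken one
   after the other. *)
have key2 d1 d2 : 0 < d1 -> 0 < d2 -> (m d1 A' + m d2 B' <= hausdorff k (A' `|` B'))%E.
  move=> d10 d20; pose dl := Num.min (Num.min d1 d2) (e / 2).
  have dl0 : 0 < dl by rewrite !lt_min d10 d20 divr_gt0.
  apply: le_trans (mH dl _ dl0); apply: le_trans (key dl dl0 _); last first.
    by rewrite gt_min (gtr_pMr _ e0) invf_lt1 ?ltr1n ?orbT.
  by apply: leeD; apply: le_mu_ext_gauge; rewrite !ge_min lexx ?orbT.
have [->|Hoo] := eqVneq (hausdorff k (A' `|` B')) +oo%E; first by rewrite leey.
have m0 dl X : (0 <= m dl X)%E by apply: mu_ext_ge0; exact: hausdorff_gauge_ge0.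
have Hfin : hausdorff k (A' `|` B') \is a fin_num.
  rewrite fin_numE Hoo andbT -ltNye (lt_le_trans _ (mH 1 _ ltr01))//.
  by apply: lt_le_trans (m0 _ _); rewrite ltNyr.
have HX X : X `<=` A' `|` B' -> hausdorff k X \is a fin_num.
  move=> XAB; rewrite ge0_fin_numE; last exact: le_trans (m0 1 X) (mH _ _ ltr01).
  apply: (@le_lt_trans _ _ (hausdorff k (A' `|` B'))); last by rewrite ltey.
  apply: ge_ereal_sup => _ [dl dl0 <-]; apply: le_trans (mH dl _ dl0).
  exact: le_mu_ext.
have HB := HX B' (@subsetUr _ _ _); have HA := HX A' (@subsetUl _ _ _).
rewrite -leeBrDr//; apply: ge_ereal_sup => _ [d1 d10 <-].
rewrite leeBrDr// addeC.
have mAfin : m d1 A' \is a fin_num.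
  rewrite ge0_fin_numE//; apply: le_lt_trans (mH _ _ d10) _.
  by rewrite -ge0_fin_numE// (le_trans (m0 1 A') (mH _ _ ltr01)).
rewrite -leeBrDr//; apply: ge_ereal_sup => _ [d2 d20 <-].
by rewrite leeBrDr// addeC; exact: key2.
Qed.

Lemma borel_caratheodory_surface (D : set 'rV[R]_n) (A : set (borel 'rV[R]_n)) :
  measurable A -> [the outer_measure R 'rV[R]_n of hausdorff_on k D].-caratheodory A.
Proof. exact: (borel_caratheodory (@hausdorff_separated D)). Qed.

(** The inverse of [p] on its image is Lipschitz, so the $N^k$ cells of the image pull back to sets
    of diameter at most $4Lr/N$. The sum of their gauges does not depend on $N$. *)
Lemma hausdorff_lipschitz_graph (Y : set 'rV[R]_n) (p : 'rV[R]_n -> 'rV[R]_k)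
    (L r : R) (z : 'rV[R]_k) : 0 < r -> 0 < L ->
  (forall y y', Y y -> Y y' -> enorm (y - y') <= L * `|p y - p y'|) ->
  (forall y, Y y -> ball z r (p y)) ->
  (hausdorff k Y <= (volume_diam1 R k * (4 * L * r) ^+ k)%:E)%E.
Proof.
move=> r0 L0 YL Yz.
have v0 : 0 <= volume_diam1 R k by apply: fine_ge0; exact: outer_measure_ge0.
have [->|/set0P[y0 Yy0]] := eqVneq Y set0.
  apply: ge_ereal_sup => _ [dl dl0 <-]; rewrite mu_ext0.
  - by rewrite lee_fin mulr_ge0// exprn_ge0// !mulr_ge0// ltW.
  - exact: hausdorff_gauge0.
  - exact: hausdorff_gauge_ge0.
apply: ge_ereal_sup => _ [dl /= dl0 <-].
have [N N0 Ndl] : exists2 N : nat, (0 < N)%N & 4 * L * r / N%:R <= dl.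
  exists (Num.truncn (4 * L * r / dl)).+1 => //.
  rewrite ler_pdivrMr ?ltr0n// -ler_pdivrMl// mulrC; apply: ltW; exact: truncnS_gt.
have [||t [Tt tT]] := @finite_net R k (p @` Y) z r N r0 N0 _ _.
- by exists (p y0); exists y0.
- by move=> _ [y Yy <-]; exact: Yz.
pose P (c : {ffun 'I_k -> 'I_N}) := [set y | Y y /\ `|p y - t c| <= r *+ 2 / N%:R].
have dP c : (diameter (P c) <= (4 * L * r / N%:R)%:E)%E.
  apply: ge_ereal_sup => _ [->|[x [Yx px] [y [Yy py] <-]]].
    by rewrite lee_fin divr_ge0// !mulr_ge0// ltW.
  rewrite lee_fin; apply: (le_trans (YL _ _ Yx Yy)).
  rewrite -(subrKA (t c)) (le_trans (ler_wpM2l (ltW L0) (ler_normD _ _)))//.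
  rewrite (distrC (t c)) (le_trans (ler_wpM2l (ltW L0) (lerD px py)))//.
  rewrite le_eqVlt; apply/orP; left; apply/eqP; rewrite -mulr2n -(mulr_natl r).
  by move: (N%:R^-1) => q; rewrite -mulr_natl; ring.
pose cst := volume_diam1 R k * (4 * L * r / N%:R) ^+ k.
have cst0 : 0 <= cst by rewrite mulr_ge0// exprn_ge0// divr_ge0// !mulr_ge0// ltW.
pose s := [seq P c | c <- enum {ffun 'I_k -> 'I_N}].
have sz : size s = (N ^ k)%N by rewrite size_map -cardE card_ffun !card_ord.
have gauge_s X : X \in s -> (hausdorff_gauge k dl X <= cst%:E)%E.
  move=> /mapP[c _ ->]; rewrite /hausdorff_gauge; case: ifPn => _; first by rewrite lee_fin.
  rewrite (le_trans (dP c)) ?lee_fin//.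
  have dfin : diameter (P c) \is a fin_num.
    by rewrite ge0_fin_numE ?diameter_ge0// (le_lt_trans (dP c))// ltry.
  rewrite ler_wpM2l// lerXn2r ?nnegrE ?fine_ge0 ?diameter_ge0//.
    by rewrite divr_ge0// !mulr_ge0// ltW.
  by rewrite -lee_fin fineK.
apply: (@le_trans _ _ (\sum_(0 <= i <oo) hausdorff_gauge k dl (nth set0 s i))%E).
  apply: ereal_inf_lbound; exists (nth set0 s) => //; split=> // y Yy.
  have [c Hc] := tT (p y) (ltac:(by exists y)).
  have cs : P c \in s by rewrite map_f// mem_enum.
  by exists (index (P c) s) => //; rewrite nth_index.
apply: lime_le; first by apply: is_cvg_nneseries => *; exact: hausdorff_gauge_ge0.
apply: nearW => M; apply: (@le_trans _ _ (\sum_(0 <= i < maxn M (size s)) hausdorff_gauge k dl (nth set0 s i))%E).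
  apply: lee_sum_nneg_natr; last exact: leq_maxl.
  by move=> *; exact: hausdorff_gauge_ge0.
rewrite (big_cat_nat _ (leq_maxr M (size s)))//= [X in (_ + X)%E]big_nat_cond [X in (_ + X)%E]big1 ?adde0; last first.
  by move=> i /andP[/andP[si _] _]; rewrite nth_default// hausdorff_gauge0.
apply: (@le_trans _ _ (\sum_(0 <= i < size s) cst%:E)%E).
  rewrite big_nat_cond [leRHS]big_nat_cond; apply: lee_sum => i /andP[/andP[_ si] _].
  by apply: gauge_s; exact: mem_nth.
rewrite sumEFin lee_fin sumr_const_nat subn0 sz -[leLHS]mulr_natr natrX /cst expr_div_n.
by rewrite -[leLHS]mulrA divfK// expf_neq0// pnatr_eq0 -lt0n.
Qed.

End hausdorff_facts.

(** * Calculus of $C^1$ functions of several variables *)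

Lemma cvg_sum_fin (R : realType) (T : Type) (F : set_system T) {FF : Filter F}
    (I : finType) (f : I -> T -> R) (a : I -> R) :
  (forall i, f i x @[x --> F] --> a i) ->
  \sum_i f i x @[x --> F] --> \sum_i a i.
Proof.
move=> fa; elim: (index_enum I) => [|i s IH].
  rewrite big_nil (_ : (fun _ => _) = cst 0); first exact: cvg_cst.
  by apply/funext => x; rewrite big_nil.
rewrite big_cons (_ : (fun _ => _) = (f i \+ fun x => \sum_(j <- s) f j x)).
  by apply: cvgD => //; exact: fa.
by apply/funext => x; rewrite big_cons.
Qed.

Section calculus.
Context {R : realType} {n : nat}.
Implicit Types (phi : 'rV[R]_n -> R) (x y v : 'rV[R]_n).

Local Notation e_ i := (delta_mx ord0 i : 'rV[R]_n).

Lemma is_derive_line phi (z v : 'rV[R]_n) (t : R) : derivable phi (z + t *: v) v ->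
  is_derive t 1 (fun s : R => phi (z + s *: v)) ('D_v phi (z + t *: v)).
Proof.
have E : (fun h : R => h^-1 *: (phi (h *: v + (z + t *: v)) - phi (z + t *: v))) =
    (fun h : R => h^-1 *: (((fun s : R => phi (z + s *: v)) \o shift t) (h *: 1) - phi (z + t *: v))).
  apply/funext => h /=; rewrite scaler1 scalerDl.
  by congr (_ *: (phi _ - _)); rewrite addrCA.
by move=> dphi; apply: DeriveDef; rewrite /derivable /derive -E.
Qed.

Lemma MVT_line (f df : R -> R) (w : R) : (forall t : R, is_derive t (1 : R) f (df t)) ->
  exists2 c, `|c| <= `|w| & f w - f 0 = df c * w.
Proof.
move=> fdf.
have cf : continuous f.
  move=> t; apply: differentiable_continuous; apply/derivable1_diffP.
  by have [] := fdf t.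
have [w0|/ltW w0] := leP 0 w.
  have [|c] := @MVT_segment R f df 0 w w0 (fun t _ => fdf t).
    by apply: continuous_subspaceT => ?; exact: cf.
  rewrite subr0 in_itv/= => /andP[c0 cw] ->; exists c => //.
  by rewrite !ger0_norm.
have [|c] := @MVT_segment R f df w 0 w0 (fun t _ => fdf t).
  by apply: continuous_subspaceT => ?; exact: cf.
rewrite in_itv/= => /andP[c0 cw] E; exists c.
  by rewrite !ler0_norm// lerN2.
by rewrite -opprB E sub0r mulrN opprK.
Qed.

(** The vertices of the path from $0$ to [v] that changes one coordinate at a time. *)
Definition trunc_rV (v : 'rV[R]_n) (j : nat) : 'rV[R]_n :=
  \row_i (if (i < j)%N then v ord0 i else 0).

Lemma trunc_rV0 v : trunc_rV v 0 = 0.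
Proof. by apply/rowP => i; rewrite !mxE. Qed.

Lemma trunc_rVn v : trunc_rV v n = v.
Proof. by apply/rowP => i; rewrite !mxE ltn_ord. Qed.

Lemma trunc_rVS v (i : 'I_n) : trunc_rV v i.+1 = trunc_rV v i + v ord0 i *: e_ i.
Proof.
apply/rowP => j; rewrite !mxE eqxx /= ltnS leq_eqVlt -val_eqE/=.
have [ji|ij|/val_inj ->] := ltngtP j i; rewrite ?eqxx ?mulr0 ?addr0//.
by rewrite mulr1 add0r.
Qed.

Lemma norm_rV_le x (c : R) : 0 <= c -> (forall i, `|x ord0 i| <= c) -> `|x| <= c.
Proof.
move=> c0 xc; rewrite [leLHS]/Num.norm /= mx_normrE; apply/bigmax_leP; split=> //.
by move=> [i j] _ /=; rewrite ord1.
Qed.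

Lemma delta_rV_norm (i : 'I_n) : `|e_ i| <= 1.
Proof.
apply: norm_rV_le => // j; rewrite mxE eqxx/=.
by case: eqP => _; rewrite ?normr1 ?normr0.
Qed.

Lemma trunc_rV_norm v j : `|trunc_rV v j| <= `|v|.
Proof.
apply: norm_rV_le => // i; rewrite mxE; case: ifP => _; last by rewrite normr0.
exact: coord_le_norm.
Qed.

Definition C1 phi := [/\ continuous phi,
  forall i x, derivable phi x (e_ i) & forall i, continuous (partial i phi)].

(** The increment telescopes along the axis-parallel path from $x$ to $x+v$, and the mean value
    theorem applies on each edge. A point of an edge is within $|v|+|v|$ of $x$. *)
Lemma C1_increment phi x v : C1 phi ->
  exists xi : 'I_n -> 'rV[R]_n, (forall i, `|xi i - x| <= `|v| *+ 2) /\
    phi (x + v) - phi x = \sum_i v ord0 i * partial i phi (xi i).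
Proof.
move=> [_ dphi _].
have H (i : 'I_n) : exists xi, `|xi - x| <= `|v| *+ 2 /\
   phi (x + trunc_rV v i.+1) - phi (x + trunc_rV v i) = v ord0 i * partial i phi xi.
  pose f (t : R) := phi (x + trunc_rV v i + t *: e_ i).
  have fdf (t : R) : is_derive t (1 : R) f (partial i phi (x + trunc_rV v i + t *: e_ i)).
    exact: is_derive_line.
  have [c cv E] := MVT_line (v ord0 i) fdf.
  exists (x + trunc_rV v i + c *: e_ i); split.
    rewrite -[x + _ + _]addrA [x + _]addrC addrK (le_trans (ler_normD _ _))// mulr2n lerD ?trunc_rV_norm//.
    rewrite normrZ (le_trans (ler_piMr _ (delta_rV_norm _)))//.
    exact: le_trans cv (coord_le_norm _ _).
  by move: E; rewrite /f scale0r addr0 -addrA -trunc_rVS mulrC.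
have [xi Hxi] := choice H; exists xi; split=> [i|]; first by have [] := Hxi i.
under eq_bigr do rewrite -(proj2 (Hxi _)).
rewrite -(big_mkord xpredT (fun i => phi (x + trunc_rV v i.+1) - phi (x + trunc_rV v i))).
by rewrite telescope_sumr// trunc_rV0 trunc_rVn addr0.
Qed.

Definition dirder phi v x := \sum_i v ord0 i * partial i phi x.

(** [C1] speaks of coordinate directions only; continuity of the partial derivatives recovers
    oblique ones through [C1_increment]. *)
Lemma C1_derive phi x v : C1 phi -> derivable phi x v /\ 'D_v phi x = dirder phi v x.
Proof.
move=> C1phi; have [_ _ cp] := C1phi.
suff H : h^-1 *: (phi (h *: v + x) - phi x) @[h --> 0^'] --> dirder phi v x.
  by split; [apply/cvg_ex; exists (dirder phi v x)|apply: cvg_lim].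
apply/cvgrPdist_le => eps eps0.
pose K := \sum_(i < n) `|v ord0 i| + 1.
have K0 : 0 < K by rewrite ltr_wpDl// sumr_ge0.
have [del del0 Hdel] : exists2 del, 0 < del & forall i xi, `|xi - x| <= del ->
    `|partial i phi x - partial i phi xi| <= eps / K.
  have Hi (i : 'I_n) : exists del : R, 0 < del /\ forall xi, `|xi - x| <= del ->
      `|partial i phi x - partial i phi xi| <= eps / K.
    have := cp i x => /cvgrPdist_le /(_ _ (divr_gt0 eps0 K0)) /nbhs_ballP[d /= d0 dH].
    exists (d / 2); split; first exact: divr_gt0.
    move=> xi xid; apply: dH; rewrite -ball_normE /= distrC.
    by rewrite (le_lt_trans xid)// gtr_pMr// invf_lt1// ltr1n.
  have [del Hd] := choice Hi.
  exists (\big[Num.min/1]_i del i).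
    by apply/bigmin_gtP; split=> // i _; have [] := Hd i.
  move=> i xi xid; apply: (proj2 (Hd i)); apply: le_trans xid _.
  exact: bigmin_le.
near=> h.
have h0 : h != 0 by near: h; exact: nbhs_dnbhs_neq.
have [xi [Hxi E]] := C1_increment x (h *: v) C1phi.
rewrite addrC (addrC (h *: v)) E scaler_sumr /dirder.
have -> : \sum_i h^-1 *: ((h *: v) ord0 i * partial i phi (xi i)) = \sum_i v ord0 i * partial i phi (xi i).
  by apply: eq_bigr => i _; rewrite mxE /GRing.scale/= !mulrA mulVf// mul1r.
rewrite addrC -sumrB (le_trans (ler_norm_sum _ _ _))//.
apply: (@le_trans _ _ (\sum_i `|v ord0 i| * (eps / K))).
  apply: ler_sum => i _; rewrite -mulrBr normrM ler_wpM2l// Hdel//.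
  apply: (le_trans (Hxi i)); rewrite normrZ -mulrnAr.
  have : `|h| <= del / (`|v| *+ 2 + 1).
    near: h; apply: dnbhs0_le; rewrite divr_gt0// ltr_wpDl// mulrn_wge0//.
  rewrite ler_pdivlMr ?ltr_wpDl ?mulrn_wge0// => hd.
  by apply: le_trans hd; rewrite ler_wpM2l// lerDl.
rewrite -mulr_suml mulrCA; apply: ler_piMr; first exact: ltW.
by rewrite ler_pdivrMr// mul1r /K lerDl.
Unshelve. all: by end_near. Qed.

Lemma is_derive_C1_line phi y v (t : R) : C1 phi ->
  is_derive t 1 (fun s => phi (y + s *: v)) (dirder phi v (y + t *: v)).
Proof.
move=> C1phi; have [d E] := C1_derive (y + t *: v) v C1phi.
by rewrite -E; exact: is_derive_line.
Qed.

Lemma is_derive1_chain (f g : R -> R) (x a b : R) :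
  is_derive x (1 : R) f a -> is_derive (f x) (1 : R) g b -> is_derive x (1 : R) (g \o f) (b * a).
Proof.
move=> [df <-] [dg <-]; apply: DeriveDef.
  have /derivable1_diffP df' := df; have /derivable1_diffP dg' := dg.
  exact/derivable1_diffP/(differentiable_comp df' dg').
by rewrite -!derive1E (derive1_comp df dg).
Qed.

Lemma continuous_dirder phi v : C1 phi -> continuous (dirder phi v).
Proof.
move=> [_ _ cp] x; rewrite /dirder.
apply: (cvg_sum_fin (FF := nbhs_filter x)) => i; apply: cvgM; first exact: cvg_cst.
exact: cp.
Qed.

(** Cauchy-Schwarz along the segment from $y$ to $y+v$, run through as $y+r^2v$. With $t=r^2$ the
    squared speed $4r^2=4t$ supplies exactly the factor $t$ that [slice_estimate] consumes; a linear
    parametrization would leave a divergent $\int dt/t$ for surface measure. *)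
Lemma chord phi y v : C1 phi ->
  (((phi (y + v) - phi y) ^+ 2)%:E <=
   \int[lebesgue_measure]_(r in `[0%R, 1%R]) ((2 * r * dirder phi v (y + r ^+ 2 *: v)) ^+ 2)%:E)%E.
Proof.
move=> C1phi; pose m := phi (y + v) - phi y.
pose G (r : R) := phi (y + r ^+ 2 *: v).
pose g (r : R) := 2 * r * dirder phi v (y + r ^+ 2 *: v).
have dG (r : R) : is_derive r (1 : R) G (g r).
  have d1 : is_derive r (1 : R) (fun r : R => r ^+ 2) (2 * r).
    by apply: is_derive_eq; rewrite /GRing.scale/=; ring.
  have := is_derive1_chain d1 (is_derive_C1_line y v (r ^+ 2) C1phi).
  by rewrite /g mulrC.
have cg : continuous g.
  move=> r; apply: cvgM.
    by apply: cvgM; [exact: cvg_cst|exact: cvg_id].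
  apply: continuous_comp; last exact: continuous_dirder.
  apply: cvgD; first exact: cvg_cst.
  by apply: cvgZr_tmp; apply: (@exprn_continuous _ 2).
(* Cauchy-Schwarz in tangent form: $g^2\ge2mg-m^2$ pointwise, and since $\int_0^1g=m$ the right side
   integrates to $m^2$. *)
pose f (r : R) := 2 * m * g r - m ^+ 2.
pose F (r : R) := 2 * m * G r - m ^+ 2 * r.
have cf : continuous f.
  move=> r; apply: cvgB; last exact: cvg_cst.
  by apply: cvgM; [exact: cvg_cst|exact: cg].
have dF (r : R) : is_derive r (1 : R) F (f r).
  apply: is_derive_eq; rewrite /f /GRing.scale/= !mulr1 ?mulr0 ?addr0//.
have dFv (r : R) : derivable F r 1 by have [] := dF r.
have cF : continuous F.
  by move=> r; apply: differentiable_continuous; apply/derivable1_diffP.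
have -> : (((phi (y + v) - phi y) ^+ 2)%:E = \int[lebesgue_measure]_(r in `[0%R, 1%R]) (f r)%:E)%E.
  rewrite (@continuous_FTC2 R f F 0 1) ?ltr01//.
  - rewrite -EFinB /F /G expr1n expr0n/= scale1r scale0r addr0 -/m; congr EFin.
    by rewrite mulr0 subr0 mulr1 addrAC -mulrBr -/m; ring.
  - by apply: continuous_subspaceT => ?; exact: cf.
  - split=> [r _|//|]; [exact: dFv|exact: cvg_at_right_filter (cF 0)|exact: cvg_at_left_filter (cF 1)].
  - by move=> r _; rewrite derive1E; have [] := dF r.
apply: le_integral.
- by [].
- apply: continuous_compact_integrable; first exact: segment_compact.
  by apply: continuous_subspaceT => ?; exact: cf.
- apply: (@continuous_compact_integrable R (fun r => g r ^+ 2)); first exact: segment_compact.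
  by apply: continuous_subspaceT => r; apply: cvgM; exact: cg.
- move=> r _; rewrite lee_fin -/(g r) /f; have := sqr_ge0 (g r - m).
  by rewrite sqrrB; lra.
Qed.

Lemma smooth_C1 phi : smooth phi -> C1 phi.
Proof.
move=> h; split; first exact: h 0%N.
  by move=> i x; have [] := h 1%N i.
by move=> i; have [] := h 1%N i.
Qed.

Lemma partial_lin (i : 'I_n) phi psi (a : R) : (forall x, derivable phi x (e_ i)) ->
  (forall x, derivable psi x (e_ i)) ->
  partial i (fun x => a * phi x + psi x) = (fun x => a * partial i phi x + partial i psi x).
Proof.
move=> dphi dpsi; apply/funext => x.
by rewrite /partial (@deriveD _ _ _ (a \*: phi) psi) ?deriveZ//; exact: derivableZ.
Qed.

Lemma class_C_lin k phi psi (a : R) : class_C k phi -> class_C k psi ->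
  class_C k (fun x => a * phi x + psi x).
Proof.
elim: k phi psi => [|k IH] phi psi /=.
  move=> cphi cpsi x.
  by apply: (cvgD (cvgM (cvg_cst a) (cphi x)) (cpsi x)).
move=> cphi cpsi i; have [dphi pphi] := cphi i; have [dpsi ppsi] := cpsi i; split.
  by move=> x; apply: (@derivableD _ _ _ (a \*: phi) psi) => //; exact: derivableZ.
by rewrite partial_lin//; exact: IH.
Qed.

Lemma smooth_lin phi psi (a : R) : smooth phi -> smooth psi ->
  smooth (fun x => a * phi x + psi x).
Proof. by move=> sphi spsi k; exact: class_C_lin. Qed.

Lemma partial_cst (i : 'I_n) (c : R) : partial i (fun=> c) = fun=> 0.
Proof. by apply/funext => x; rewrite /partial derive_cst. Qed.

Lemma smooth_cst (c : R) : smooth (fun _ : 'rV[R]_n => c).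
Proof.
move=> k; elim: k c => [|k IH] c /=; first exact: cst_continuous.
by move=> i; split=> [x|]; [exact: derivable_cst|rewrite partial_cst].
Qed.

End calculus.

(** * Increments inside a cone are bounded by the Dirichlet integral *)

Section dirichlet.
Context {R : realType} {n : nat}.
Local Notation X := 'rV[R]_n.
Local Notation BX := (borel 'rV[R]_n).
Local Notation TR := (measurableTypeR R).
Local Notation leb := (@lebesgue_measure R).

Definition gradsq (phi : X -> R) (x : X) : R := \sum_i partial i phi x ^+ 2.

Definition dirichlet (Om : set X) (phi : X -> R) : \bar R :=
  (\int[lam n]_(x in Om) (gradsq phi x)%:E)%E.

Lemma gradsq_ge0 phi x : 0 <= gradsq phi x.
Proof. by apply: sumr_ge0 => i _; exact: sqr_ge0. Qed.

Lemma continuous_gradsq phi : C1 phi -> continuous (gradsq phi).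
Proof.
move=> [_ _ cp] x; apply: (cvg_sum_fin (FF := nbhs_filter x)) => i.
by apply: cvgM; exact: cp.
Qed.

Lemma continuous_borel_fun (f : X -> R) : continuous f -> measurable_fun setT (f : BX -> R).
Proof.
move=> cf; apply: real_fun_measurable => U oU; apply: open_borel.
by move/continuousP : cf; apply.
Qed.

Lemma sum_mul_le (a b : 'I_n -> R) :
  (\sum_i a i * b i) ^+ 2 <= (\sum_i a i ^+ 2) * (\sum_i b i ^+ 2).
Proof.
rewrite -subr_ge0.
have -> : (\sum_i a i ^+ 2) * (\sum_i b i ^+ 2) - (\sum_i a i * b i) ^+ 2 =
    2^-1 * \sum_i \sum_j (a i * b j - a j * b i) ^+ 2.
  have E : \sum_i \sum_j (a i * b j - a j * b i) ^+ 2 =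
      \sum_i \sum_j a i ^+ 2 * b j ^+ 2 + \sum_i \sum_j a j ^+ 2 * b i ^+ 2
      - 2 * \sum_i \sum_j (a i * b i) * (a j * b j).
    rewrite mulr_sumr -big_split /= -sumrB; apply: eq_bigr => i _.
    by rewrite mulr_sumr -big_split /= -sumrB; apply: eq_bigr => j _; ring.
  have E1 : \sum_i \sum_j a i ^+ 2 * b j ^+ 2 = (\sum_i a i ^+ 2) * (\sum_i b i ^+ 2).
    by rewrite mulr_suml; apply: eq_bigr => i _; rewrite mulr_sumr.
  rewrite E [X in _ + X - _]exchange_big /= E1.
  have -> : \sum_i \sum_j (a i * b i) * (a j * b j) = (\sum_i a i * b i) ^+ 2.
    by rewrite expr2 mulr_suml; apply: eq_bigr => i _; rewrite mulr_sumr.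
  by field.
by rewrite mulr_ge0 ?invr_ge0// sumr_ge0// => i _; apply: sumr_ge0 => j _; exact: sqr_ge0.
Qed.

Lemma dirder_sqr_le phi (v x : X) : dirder phi v x ^+ 2 <= (\sum_i v ord0 i ^+ 2) * gradsq phi x.
Proof. exact: sum_mul_le. Qed.

Lemma integral_indicE d (T : measurableType d) (mu : {measure set T -> \bar R}) (D : set T)
    (f : T -> R) : (\int[mu]_(x in D) (f x)%:E = \int[mu]_x (f x * \1_D x)%:E)%E.
Proof.
rewrite integral_mkcond; apply: eq_integral => x _; rewrite patchE indicE.
by case: ifPn => _; rewrite ?mulr1 ?mulr0.
Qed.

Lemma open_sq_line_measurable (U : set X) : open U ->
  measurable [set p : (BX * TR) * BX | U (p.1.1 + p.1.2 ^+ 2 *: p.2)].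
Proof.
move=> oU; pose F (p : (X * R) * X) : X := p.1.1 + p.1.2 ^+ 2 *: p.2.
have cF : continuous F.
  move=> p; apply: cvgD; first exact: (cvg_comp _ _ (@cvg_fst _ _ _ _ _) (@cvg_fst _ _ _ _ _)).
  apply: cvgZ; last exact: cvg_snd.
  have c2 : p0.1.2 @[p0 --> p] --> p.1.2.
    exact: (cvg_comp _ _ (@cvg_fst _ _ _ _ _) (@cvg_snd _ _ _ _ _)).
  exact: (cvgM c2 c2).
apply: (@open_prod_measurable (X * R)%type X _ _ (BX * TR)%type BX id id _ _ _ _ (F @^-1` U)).
- exact: countable_base_prod (countable_base_rV R n) (countable_base_R R).
- exact: countable_base_rV.
- move=> W oW; have := @open_prod_measurable X R _ _ BX TR id id (countable_base_rV R n)
    (countable_base_R R) (@open_borel _ _) (@open_measurable R) W oW.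
  by congr measurable; apply/seteqP; split=> -[].
- exact: open_borel.
- by move/continuousP : cF; apply.
Qed.

Lemma open_diff_measurable (t : R) (U : set X) : open U ->
  measurable [set p : BX * BX | U (t *: (p.2 - p.1))].
Proof.
move=> oU; pose F (p : X * X) : X := t *: (p.2 - p.1).
have cF : continuous F.
  by move=> p; apply: cvgZl_tmp; apply: cvgB; [exact: cvg_snd|exact: cvg_fst].
apply: (@open_prod_measurable X X _ _ BX BX id id _ _ _ _ (F @^-1` U)).
- exact: countable_base_rV.
- exact: countable_base_rV.
- exact: open_borel.
- exact: open_borel.
- by move/continuousP : cF; apply.
Qed.

Lemma indic_measurable d (T : measurableType d) d' (T' : measurableType d') (D : set T')
    (f : T -> T') : measurable_fun setT f -> measurable D ->
  measurable_fun setT (fun x => \1_D (f x) : R).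
Proof. by move=> mf mD; apply: (measurableT_comp (measurable_indic mD) mf). Qed.

Lemma continuous2_measurable (F : X * X -> R) : continuous F ->
  measurable_fun setT (F : BX * BX -> R).
Proof.
move=> cF; apply: real_fun_measurable => U oU.
have oFU : open (F @^-1` U) by move/continuousP : cF; apply.
have := @open_prod_measurable X X _ _ BX BX id id (countable_base_rV R n)
  (countable_base_rV R n) (@open_borel _ _) (@open_borel _ _) _ oFU.
by congr measurable; apply/seteqP; split=> -[].
Qed.

Section core.
Variables (mu : {sigma_finite_measure set BX -> \bar R}) (A Om : set X) (c : X) (rho K : R).
Hypotheses (oOm : open Om) (mA : measurable (A : set BX)) (rho0 : 0 < rho) (rho1 : rho <= 1).
Hypothesis n0 : (0 < n)%N.
Hypothesis cone : forall y v s, A y -> ball c rho v -> 0 < s -> s <= 1 -> Om (y + s *: v).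
Hypothesis growth : forall z r, 0 < r -> r <= 1 ->
  (mu (A `&` ball z r) <= (K * r ^+ n.-1)%:E)%E.

Local Notation b := (ball c rho : set BX).

Let mb : measurable b. Proof. by apply: open_borel; exact: ball_open. Qed.
Let mOm : measurable (Om : set BX). Proof. exact: open_borel. Qed.

Let K0 : 0 <= K.
Proof.
have := le_trans (measure_ge0 _ _) (growth c ltr01 (lexx _)).
by rewrite expr1n mulr1 lee_fin.
Qed.

(** Substituting $z=y+tv$ costs $t^{-n}$; for fixed $z$ the admissible $y$ lie in a ball of radius
    $t\rho$, which has [mu]-measure at most $K(t\rho)^{n-1}$. Together with the factor $t$ all
    powers of $t$ cancel. *)
Lemma slice_estimate (g : X -> R) (t : R) : measurable_fun setT (g : BX -> R) ->
  (forall x, 0 <= g x) -> 0 < t -> t <= 1 ->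
  (\int[mu]_y \int[lam n]_v (t * g (y + t *: v)%R * \1_b v * \1_A y)%:E <=
   (K * rho ^+ n.-1)%:E * \int[lam n]_z (g z)%:E)%E.
Proof.
move=> mg g0 t0 t1.
have tn0 : 0 <= t^-1 ^+ n by rewrite exprn_ge0// invr_ge0 ltW.
pose f y z : R := t * g z * \1_b (t^-1 *: (z - y)) * \1_A y.
have f0 y z : 0 <= f y z by rewrite !mulr_ge0// ?g0 ?ltW.
have mf : measurable_fun setT (fun p : BX * BX => (f p.1 p.2)%:E).
  apply/measurable_EFinP; apply: measurable_funM; last exact: (indic_measurable measurable_fst).
  apply: measurable_funM; last first.
    have md : measurable_fun setT ((fun p => t^-1 *: (p.2 - p.1)) : BX * BX -> BX).
      by apply: borel_fun => U oU; exact: open_diff_measurable.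
    exact: (indic_measurable md mb).
  apply: measurable_funM => //; exact: (measurableT_comp mg measurable_snd).
have mfy y : measurable_fun setT (fun z : BX => (f y z)%:E).
  have mp : measurable_fun setT ((fun z => (y, z)) : BX -> BX * BX).
    exact: pair1_measurable.
  exact: (measurableT_comp mf mp).
have E1 y : (\int[lam n]_v (t * g (y + t *: v)%R * \1_b v * \1_A y)%:E =
    (t^-1 ^+ n)%:E * \int[lam n]_z (f y z)%:E)%E.
  rewrite -(integral_lam_affine y t0 (mfy y)); last by move=> z; rewrite lee_fin.
  apply: eq_integral => v _; rewrite /f addrAC subrr add0r scalerA mulVf ?scale1r//.
  exact: lt0r_neq0.
under eq_integral do rewrite E1.
rewrite ge0_integralZl//; last 2 first.
- exact: (@measurable_fun_fubini_tonelli_F _ _ BX BX R (lam n) _ mf (fun p => f0 _ _)).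
- by move=> y _; apply: integral_ge0 => z _; rewrite lee_fin.
rewrite (@fubini_tonelli _ _ BX BX R mu (lam n) _ mf (fun p => f0 _ _)) /=.
have rt0 : 0 < t * rho by rewrite mulr_gt0.
have rt1 : t * rho <= 1 by rewrite mulr_ile1// ltW.
(* For fixed [z], the condition $t^{-1}(z-y)\in B(c,\rho)$ says that $y\in B(z-tc,t\rho)$. *)
have E2 z : (\int[mu]_y (f y z)%:E <= (t * g z)%:E * (K * (t * rho) ^+ n.-1)%:E)%E.
  rewrite (eq_integral (fun y : BX => (t * g z)%:E * (\1_(A `&` ball (z - t *: c) (t * rho)) y)%:E)%E).
    rewrite ge0_integralZl//; last 2 first.
    - by apply/measurable_EFinP; apply: measurable_indic; apply: measurableI => //; apply: open_borel; exact: ball_open.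
    - by rewrite lee_fin mulr_ge0 ?g0// ltW.
    rewrite integral_indic// ?setIT; last first.
      by apply: measurableI => //; apply: open_borel; exact: ball_open.
    by apply: lee_wpmul2l; [rewrite lee_fin mulr_ge0 ?g0// ltW|exact: growth].
  move=> y _; rewrite /f -EFinM -mulrA; congr (_ * _)%:E.
  rewrite indicI /= mulrC; congr (_ * _); rewrite !indicE; congr (_%:R); congr nat_of_bool.
  apply/idP/idP; rewrite !inE -!ball_normE /=.
    move=> h; rewrite (_ : z - t *: c - y = t *: (t^-1 *: (z - y) - c)).
      by rewrite normrZ gtr0_norm// ltr_pM2l// distrC.
    by rewrite scalerBr scalerA divff ?scale1r ?lt0r_neq0// addrAC.
  rewrite (_ : z - t *: c - y = t *: (t^-1 *: (z - y) - c)).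
    by rewrite normrZ gtr0_norm// ltr_pM2l// distrC.
  by rewrite scalerBr scalerA divff ?scale1r ?lt0r_neq0// addrAC.
have mgE : measurable_fun setT (fun z : BX => (g z)%:E) by exact/measurable_EFinP.
apply: (@le_trans _ _ ((t^-1 ^+ n)%:E * \int[lam n]_z ((t * (K * (t * rho) ^+ n.-1))%:E * (g z)%:E))%E).
  apply: lee_wpmul2l; first by rewrite lee_fin.
  apply: ge0_le_integral => //.
  - by move=> z _; apply: integral_ge0 => y _; rewrite lee_fin.
  - exact: (@measurable_fun_fubini_tonelli_G _ _ BX BX R mu _ mf (fun p => f0 _ _)).
  - exact: measurable_funeM.
  - by move=> z _; apply: (le_trans (E2 z)); rewrite -!EFinM lee_fin; lra.
rewrite ge0_integralZl//; last 2 first.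
- by move=> z _; rewrite lee_fin.
- by rewrite lee_fin; apply: mulr_ge0; [exact: ltW|apply: mulr_ge0 => //; apply: exprn_ge0; exact: ltW].
rewrite muleA -EFinM (_ : t^-1 ^+ n * _ = K * rho ^+ n.-1)//.
rewrite -(prednK n0) exprS exprMn exprVn /=; field.
by rewrite expf_neq0 lt0r_neq0.
Qed.

(** [chord] bounds each squared increment by an integral over the parameter $r$; the cone condition
    keeps the segment in [Om] for $r>0$. After exchanging integrals, [slice_estimate] with $t=r^2$
    applies for every $r$, uniformly. *)
Lemma core_estimate : exists2 C : R, 0 <= C & forall phi, C1 phi ->
  (\int[mu]_(y in A) \int[lam n]_(v in b) ((phi (y + v)%R - phi y) ^+ 2)%:E <=
   C%:E * dirichlet Om phi)%E.
Proof.
pose Mv := n%:R * (`|c| + rho) ^+ 2.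
have Mv0 : 0 <= Mv by rewrite mulr_ge0// sqr_ge0.
have vM v : ball c rho v -> \sum_i v ord0 i ^+ 2 <= Mv.
  rewrite -ball_normE /= => cv; apply: (@le_trans _ _ (\sum_(i < n) (`|c| + rho) ^+ 2)); last first.
    by rewrite sumr_const card_ord /Mv mulr_natl.
  apply: ler_sum => i _; rewrite -real_normK ?num_real// ler_sqr ?nnegrE ?addr_ge0 ?(ltW rho0)//.
  apply: (le_trans (coord_le_norm _ _)); rewrite -(subrK c v) addrC (le_trans (ler_normD _ _))//.
  by rewrite lerD2l distrC ltW.
have C0 : 0 <= 4 * Mv * (K * rho ^+ n.-1).
  by apply: mulr_ge0; apply: mulr_ge0 => //; apply: exprn_ge0; exact: ltW.
exists (4 * Mv * (K * rho ^+ n.-1)) => [//|phi C1phi].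
pose g x : R := 4 * Mv * (gradsq phi x * \1_Om x).
have ind0 (D : set X) x : 0 <= \1_D x :> R by rewrite indicE ler0n.
have g0 x : 0 <= g x.
  by apply: mulr_ge0; [exact: mulr_ge0|apply: mulr_ge0; [exact: gradsq_ge0|exact: ind0]].
have mg : measurable_fun setT (g : BX -> R).
  apply: measurable_funM => //; apply: measurable_funM.
    by apply: continuous_borel_fun; exact: continuous_gradsq.
  exact: (measurable_indic mOm).
(* All domains of integration are encoded by indicators, so that Tonelli's theorem can be used on
   whole spaces. *)
pose H (p : (BX * TR) * BX) : \bar R := (p.1.2 ^+ 2 * g (p.1.1 + p.1.2 ^+ 2 *: p.2)%R * \1_b p.2 * \1_A p.1.1 * \1_(`[0%R, 1%R]%classic) p.1.2)%:E.
have H0 p : (0 <= H p)%E by rewrite lee_fin; do 4! apply: mulr_ge0 => //; exact: sqr_ge0.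
have mH : measurable_fun setT H.
  have m11 : measurable_fun setT (fun p : (BX * TR) * BX => p.1.1) by exact: measurableT_comp.
  have m12 : measurable_fun setT (fun p : (BX * TR) * BX => p.1.2) by exact: measurableT_comp.
  apply/measurable_EFinP; apply: measurable_funM; last exact: (indic_measurable m12).
  apply: measurable_funM; last exact: (indic_measurable m11).
  apply: measurable_funM; last exact: (indic_measurable measurable_snd).
  apply: measurable_funM; first exact: measurable_funX.
  have mF : measurable_fun setT ((fun p => p.1.1 + p.1.2 ^+ 2 *: p.2) : (BX * TR) * BX -> BX).
    by apply: borel_fun => U oU; exact: open_sq_line_measurable.
  exact: (measurableT_comp mg mF).
have mpv y v : measurable_fun setT ((fun r => ((y, r), v)) : TR -> (BX * TR) * BX).
  by apply: measurable_fun_pair; [exact: pair1_measurable|exact: measurable_cst].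
have step1 (y v : X) : A y -> ball c rho v ->
    (((phi (y + v) - phi y) ^+ 2)%:E <= \int[leb]_r H (y, r, v))%E.
  move=> Ay bv; apply: (le_trans (chord y v C1phi)); rewrite integral_indicE.
  apply: ge0_le_integral => //.
  - by move=> r _; rewrite lee_fin; apply: mulr_ge0 => //; exact: sqr_ge0.
  - apply/measurable_EFinP; apply: measurable_funM; last exact: measurable_indic.
    apply: measurable_funX; apply: measurable_funM; first exact: measurable_funM.
    have mF : measurable_fun setT ((fun r => y + r ^+ 2 *: v) : TR -> BX).
      apply: borel_fun => U oU; apply: open_measurable.
      have cF : continuous (fun r : R => y + r ^+ 2 *: v).
        by move=> r; apply: cvgD; [exact: cvg_cst|apply: cvgZr_tmp; exact: (@exprn_continuous _ 2)].
      by move/continuousP : cF; apply.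
    apply: (measurableT_comp _ mF); apply: continuous_borel_fun; exact: continuous_dirder.
  - exact: (measurableT_comp mH (mpv y v)).
  move=> r _; rewrite lee_fin /H /=.
  rewrite (_ : \1_b v = 1) ?mulr1; last by rewrite indicE mem_set.
  rewrite (_ : \1_A y = 1) ?mulr1; last by rewrite indicE mem_set.
  rewrite indicE; have [/set_mem /=|_] := boolP (r \in _); last by rewrite !mulr0.
  rewrite in_itv /= => /andP[]; rewrite le_eqVlt => /predU1P[<-|r0] r1.
    by rewrite !(mulr0,mul0r) expr0n/= !mul0r.
  rewrite !mulr1 /g indicE mem_set ?mulr1; last first.
    by apply: cone => //; [rewrite exprn_gt0|rewrite expr_le1// ltW].
  rewrite !exprMn [in leRHS]mulrCA -[in leRHS]mulrA.
  rewrite (_ : 2 ^+ 2 = 4 :> R); last by rewrite -natrX.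
  rewrite -[leLHS]mulrA ler_wpM2l// mulrCA ler_wpM2l ?sqr_ge0//.
  by apply: (le_trans (dirder_sqr_le _ _ _)); rewrite ler_wpM2r ?gradsq_ge0//; exact: vM.
have step2 (y : X) : A y -> (\int[lam n]_(v in b) ((phi (y + v)%R - phi y) ^+ 2)%:E <=
    \int[leb]_r \int[lam n]_v H (y, r, v))%E.
  move=> Ay.
  have mHy : measurable_fun setT (fun q : BX * TR => H (y, q.2, q.1)).
    apply: (measurableT_comp mH).
    have mp : measurable_fun setT ((fun q => ((y, q.2), q.1)) : BX * TR -> (BX * TR) * BX).
      apply: measurable_fun_pair; last exact: measurable_fst.
      by apply: measurable_fun_pair; [exact: measurable_cst|exact: measurable_snd].
    exact: mp.
  have <- := @fubini_tonelli _ _ BX TR R (lam n) leb _ mHy (fun q => H0 _).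
  rewrite integral_mkcond; apply: ge0_le_integral => //.
  - by move=> v _; rewrite patchE; case: ifPn => // _; rewrite lee_fin sqr_ge0.
  - apply/(measurable_restrictT _ mb).
    apply/measurable_EFinP; apply: measurable_funTS; apply: measurable_funX.
    apply: measurable_funB => //.
    have mF : measurable_fun setT ((fun v => y + v) : BX -> BX).
      have cF : continuous (fun v : X => y + v).
        rewrite (_ : (fun v : X => y + v) = (fun v => y + 1 *: v)).
          exact: continuous_affine.
        by apply/funext => v; rewrite scale1r.
      exact: continuous_borel cF.
    have [cphi _ _] := C1phi.
    exact: (measurableT_comp (continuous_borel_fun cphi) mF).
  - exact: (@measurable_fun_fubini_tonelli_F _ _ BX TR R leb _ mHy (fun q => H0 _)).
  - move=> v _; rewrite patchE; case: ifPn => [/set_mem bv|_].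
      exact: step1.
    by apply: integral_ge0 => r _; exact: H0.
have mHF : measurable_fun setT (fun q : BX * TR => \int[lam n]_v H (q, v))%E.
  exact: (@measurable_fun_fubini_tonelli_F _ _ (BX * TR)%type BX R (lam n) _ mH H0).
have HF0 q : (0 <= \int[lam n]_v H (q, v))%E by apply: integral_ge0 => v _; exact: H0.
apply: (@le_trans _ _ (\int[mu]_y \int[leb]_r \int[lam n]_v H (y, r, v))%E).
  rewrite integral_mkcond; apply: ge0_le_integral => //.
  - move=> y _; rewrite patchE; case: ifPn => // _.
    by apply: integral_ge0 => v _; rewrite lee_fin sqr_ge0.
  - apply/(measurable_restrictT _ mA); apply: measurable_funTS.
    pose W (q : BX * BX) : \bar R := ((phi (q.1 + q.2) - phi q.1) ^+ 2 * \1_b q.2)%:E.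
    have W0 q : (0 <= W q)%E by rewrite lee_fin; apply: mulr_ge0 => //; exact: sqr_ge0.
    have mW : measurable_fun setT W.
      apply/measurable_EFinP; apply: measurable_funM; last exact: (indic_measurable measurable_snd).
      apply: measurable_funX; apply: (@continuous2_measurable (fun q => phi (q.1 + q.2) - phi q.1)).
      have [cphi _ _] := C1phi.
      move=> q; apply: cvgB.
        apply: continuous_comp; last exact: cphi.
        exact: (cvgD (@cvg_fst _ _ _ _ _) (@cvg_snd _ _ _ _ _)).
      by apply: continuous_comp; [exact: cvg_fst|exact: cphi].
    have := @measurable_fun_fubini_tonelli_F _ _ BX BX R (lam n) _ mW W0.
    by congr measurable_fun; apply/funext => y; rewrite integral_indicE.
  - exact: (@measurable_fun_fubini_tonelli_F _ _ BX TR R leb _ mHF HF0).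
  - move=> y _; rewrite patchE; case: ifPn => [/set_mem Ay|_]; first exact: step2.
    by apply: integral_ge0 => r _; exact: HF0.
rewrite (@fubini_tonelli _ _ BX TR R mu leb _ mHF HF0).
have DE : (dirichlet Om phi = \int[lam n]_z (gradsq phi z * \1_Om z)%:E)%E by exact: integral_indicE.
have J r : (\int[mu]_y \int[lam n]_v H (y, r, v) <=
    ((4 * Mv * (K * rho ^+ n.-1))%:E * dirichlet Om phi) * (\1_(`[0%R, 1%R]%classic) r)%:E)%E.
  rewrite indicE; have [/set_mem /=|r01] := boolP (r \in _); last first.
    rewrite mule0 (eq_integral (cst 0%E)) ?integral0// => y _.
    by rewrite (eq_integral (cst 0%E)) ?integral0// => v _; rewrite /H /= [X in _ * X]indicE (negbTE r01) mulr0.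
  rewrite in_itv /= => /andP[r0 r1]; rewrite mule1.
  move: r0; rewrite le_eqVlt => /predU1P[<-|r0].
    rewrite (eq_integral (cst 0%E)) ?integral0.
      apply: mule_ge0; first by rewrite lee_fin.
      by apply: integral_ge0 => z _; rewrite lee_fin gradsq_ge0.
    by move=> y _; rewrite (eq_integral (cst 0%E)) ?integral0// => v _; rewrite /H /= expr0n/= !mul0r.
  have rr0 : 0 < r ^+ 2 by rewrite exprn_gt0.
  have rr1 : r ^+ 2 <= 1 by rewrite expr_le1// ltW.
  have := slice_estimate mg g0 rr0 rr1.
  rewrite (_ : \int[lam n]_z (g z)%:E = (4 * Mv)%:E * dirichlet Om phi)%E; last first.
    rewrite DE -ge0_integralZl//.
    - apply/measurable_EFinP; apply: measurable_funM; last exact: (measurable_indic mOm).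
      by apply: continuous_borel_fun; exact: continuous_gradsq.
    - by move=> z _; rewrite lee_fin; apply: mulr_ge0; [exact: gradsq_ge0|exact: ind0].
    - by rewrite lee_fin mulr_ge0.
  rewrite muleA -EFinM mulrC; apply: le_trans.
  rewrite le_eqVlt; apply/orP; left; apply/eqP; apply: eq_integral => y _; apply: eq_integral => v _.
  by rewrite /H /= [X in _ * X]indicE mem_set ?mulr1//= in_itv/= ltW.
apply: (@le_trans _ _ (\int[leb]_r (((4 * Mv * (K * rho ^+ n.-1))%:E * dirichlet Om phi) * (\1_(`[0%R, 1%R]%classic) r)%:E))%E).
  apply: ge0_le_integral => //.
  - by move=> r _; apply: integral_ge0 => y _; exact: HF0.
  - exact: (@measurable_fun_fubini_tonelli_G _ _ BX TR R mu _ mHF HF0).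
  - apply: measurable_funeM; apply/measurable_EFinP; exact: measurable_indic.
rewrite ge0_integralZl//; last 2 first.
- by apply/measurable_EFinP; exact: measurable_indic.
- apply: mule_ge0; first by rewrite lee_fin.
  by apply: integral_ge0 => z _; rewrite lee_fin gradsq_ge0.
have leb01 : (leb `[0%R, 1%R]%classic = 1)%E.
  by rewrite lebesgue_measure_itv/= lte_fin ltr01 oppr0 adde0.
rewrite integral_indic// setIT [X in (_ * X)%E](_ : _ = 1%E) ?mule1//.
Qed.

End core.
End dirichlet.

(** * Propagating mean-square control from one set to another *)

Section oscillation.
Context {R : realType} {n : nat}.
Local Notation X := 'rV[R]_n.
Local Notation BX := (borel 'rV[R]_n).
Variable Om : set X.
Hypothesis oOm : open Om.
Hypothesis n0 : (0 < n)%N.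
Implicit Type mu : {sigma_finite_measure set BX -> \bar R}.

Lemma measurable_shift_sq (phi : X -> R) (c : R) (D : set BX) : C1 phi ->
  measurable_fun D (fun x : BX => ((phi x - c) ^+ 2)%:E).
Proof.
move=> [cphi _ _]; apply/measurable_EFinP; apply: measurable_funTS; apply: measurable_funX.
by apply: measurable_funB => //; exact: continuous_borel_fun.
Qed.

Lemma ball_borel (x : X) (r : R) : measurable (ball x r : set BX).
Proof. by apply: open_borel; exact: ball_open. Qed.

Definition osc_bound mu (A b : set X) := exists2 C : R, 0 <= C & forall phi, C1 phi ->
  (\int[mu]_(y in A) \int[lam n]_(z in b) ((phi z - phi y) ^+ 2)%:E <= C%:E * dirichlet Om phi)%E.

Lemma dirichlet_ge0 phi : (0 <= dirichlet Om phi)%E.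
Proof. by apply: integral_ge0 => x _; rewrite lee_fin gradsq_ge0. Qed.

Lemma measurable_osc (phi : X -> R) (b : set X) (D : set BX) : C1 phi -> measurable (b : set BX) ->
  measurable_fun D (fun y : BX => \int[lam n]_(z in b) ((phi z - phi y) ^+ 2)%:E)%E.
Proof.
move=> [cphi _ _] mb; apply: measurable_funTS.
pose W (q : BX * BX) : \bar R := ((phi q.2 - phi q.1) ^+ 2 * \1_b q.2)%:E.
have W0 q : (0 <= W q)%E by rewrite lee_fin; apply: mulr_ge0 => //; exact: sqr_ge0.
have mW : measurable_fun setT W.
  apply/measurable_EFinP; apply: measurable_funM; last exact: (indic_measurable measurable_snd).
  apply: measurable_funX; apply: measurable_funB.
    exact: (measurableT_comp (continuous_borel_fun cphi) measurable_snd).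
  exact: (measurableT_comp (continuous_borel_fun cphi) measurable_fst).
have := @measurable_fun_fubini_tonelli_F _ _ BX BX R (lam n) _ mW W0.
by congr measurable_fun; apply/funext => y; rewrite integral_indicE.
Qed.

(** For each $y$ within $\rho/2$ of $x$, the fixed ball $B(x+c,\rho/2)$ lies in the moving ball
    $y+B(c,\rho)$ of [core_estimate]. *)
Lemma osc_bound_cone mu (A : set X) (x c : X) (rho K : R) :
  measurable (A : set BX) -> 0 < rho -> rho <= 1 ->
  (forall y v s, A y -> ball c rho v -> 0 < s -> s <= 1 -> Om (y + s *: v)) ->
  (forall z r, 0 < r -> r <= 1 -> (mu (A `&` ball z r) <= (K * r ^+ n.-1)%:E)%E) ->
  A `<=` ball x (rho / 2) -> osc_bound mu A (ball (x + c) (rho / 2)).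
Proof.
move=> mA rho0 rho1 cone growth Ax.
have [C C0 HC] := core_estimate oOm mA rho0 rho1 n0 cone growth.
exists C => // phi C1phi; apply: le_trans (HC phi C1phi).
have [cphi _ _] := C1phi.
apply: ge0_le_integral => //.
- by move=> y _; apply: integral_ge0 => z _; rewrite lee_fin sqr_ge0.
- by apply: measurable_osc => //; exact: ball_borel.
- apply: measurable_funTS.
  pose W (q : BX * BX) : \bar R := ((phi (q.1 + q.2) - phi q.1) ^+ 2 * \1_(ball c rho) q.2)%:E.
  have W0 q : (0 <= W q)%E by rewrite lee_fin; apply: mulr_ge0 => //; exact: sqr_ge0.
  have mW : measurable_fun setT W.
    apply/measurable_EFinP; apply: measurable_funM.
      apply: measurable_funX; apply: (@continuous2_measurable _ _ (fun q => phi (q.1 + q.2) - phi q.1)).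
      move=> q; apply: cvgB.
        apply: continuous_comp; last exact: cphi.
        exact: (cvgD (@cvg_fst _ _ _ _ _) (@cvg_snd _ _ _ _ _)).
      by apply: continuous_comp; [exact: cvg_fst|exact: cphi].
    exact: (indic_measurable measurable_snd (ball_borel c rho)).
  have := @measurable_fun_fubini_tonelli_F _ _ BX BX R (lam n) _ mW W0.
  by congr measurable_fun; apply/funext => y; rewrite integral_indicE.
move=> y Ay; rewrite [leLHS]integral_indicE [leRHS]integral_indicE.
pose f (z : BX) : \bar R := ((phi z - phi y) ^+ 2 * \1_(ball (x + c) (rho / 2)) z)%:E.
have f0 z : (0 <= f z)%E by rewrite lee_fin; apply: mulr_ge0 => //; exact: sqr_ge0.
have mf : measurable_fun setT f.
  apply/measurable_EFinP; apply: measurable_funM; last exact: (measurable_indic (ball_borel _ _)).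
  by apply/measurable_EFinP; exact: measurable_shift_sq.
have := integral_lam_affine y ltr01 mf f0; rewrite invr1 expr1n mul1e => <-.
apply: ge0_le_integral => //.
- apply: (measurableT_comp mf).
  by apply: continuous_borel; exact: continuous_affine.
- apply/measurable_EFinP; apply: measurable_funM; last exact: (measurable_indic (ball_borel _ _)).
  apply: measurable_funX; apply: measurable_funB => //.
  have cF : continuous (fun v : X => y + v).
    rewrite (_ : (fun v : X => y + v) = (fun v => y + 1 *: v)).
      exact: continuous_affine.
    by apply/funext => v; rewrite scale1r.
  exact: (measurableT_comp (continuous_borel_fun cphi) (continuous_borel cF)).
move=> v _; rewrite lee_fin scale1r ler_wpM2l ?sqr_ge0//.
rewrite !indicE ler_nat; case: (boolP (_ \in _)) => [/set_mem yv|_] //=.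
rewrite mem_set//; move: yv (Ax y Ay); rewrite -!ball_normE /= => h1 h2.
rewrite (_ : c - v = (x + c - (y + v)) - (x - y)).
  by rewrite (le_lt_trans (ler_normB _ _))// [ltRHS]splitr ltrD.
by rewrite !opprD !opprK !addrA; apply/rowP => i; rewrite !mxE; ring.
Qed.

Variable b0 : set X.

(** The reference ball [b0] and the number [c] are common to all sets [A], so that the estimates can
    be chained and glued. *)
Definition mean_control mu (A : set X) := exists2 C : R, 0 <= C & forall phi, C1 phi -> forall c : R,
  (\int[mu]_(x in A) ((phi x - c) ^+ 2)%:E <=
   C%:E * (dirichlet Om phi + \int[lam n]_(x in b0) ((phi x - c) ^+ 2)%:E))%E.

Let rhs_ge0 phi (c : R) : (0 <= dirichlet Om phi + \int[lam n]_(x in b0) ((phi x - c) ^+ 2)%:E)%E.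
Proof.
by rewrite adde_ge0 ?dirichlet_ge0//; apply: integral_ge0 => x _; rewrite lee_fin sqr_ge0.
Qed.

Lemma mean_controlS mu (A B : set X) : measurable (A : set BX) -> measurable (B : set BX) ->
  A `<=` B -> mean_control mu B -> mean_control mu A.
Proof.
move=> mA mB AB [C C0 HC]; exists C => // phi C1phi c.
apply: le_trans (HC phi C1phi c); apply: ge0_subset_integral => //.
- exact: measurable_shift_sq.
- by move=> x _; rewrite lee_fin sqr_ge0.
Qed.

Lemma mean_controlU mu (A B : set X) : measurable (A : set BX) -> measurable (B : set BX) ->
  mean_control mu A -> mean_control mu B -> mean_control mu (A `|` B).
Proof.
move=> mA mB [C C0 HC] [C' C'0 HC']; exists (C + C'); first exact: addr_ge0.
move=> phi C1phi c; rewrite EFinD ge0_muleDl ?lee_fin//.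
apply: le_trans (leeD (HC phi C1phi c) (HC' phi C1phi c)).
have mBA : measurable (B `\` A : set BX) by exact: measurableD.
have -> : A `|` B = A `|` (B `\` A) by rewrite setDE setUIr setUCr setIT.
rewrite ge0_integral_setU//; last 3 first.
- exact: measurable_shift_sq.
- by move=> x _; rewrite lee_fin sqr_ge0.
- by apply/disj_set2P; rewrite setDE setIC -setIA setICl setI0.
rewrite leeD2l//; apply: ge0_subset_integral => //.
- exact: measurable_shift_sq.
- by move=> x _; rewrite lee_fin sqr_ge0.
Qed.

(** Average $(\phi(y)-c)^2\le2(\phi(z)-\phi(y))^2+2(\phi(z)-c)^2$ over $z\in b$ and integrate over
    $y\in A$: the oscillation bound handles one term and the control on [b] the other. *)
Lemma mean_control_transfer mu (A b : set X) : measurable (A : set BX) -> measurable (b : set BX) ->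
  osc_bound mu A b -> (0 < lam n b)%E -> (lam n b < +oo)%E -> (mu A < +oo)%E ->
  mean_control (lam n) b -> mean_control mu A.
Proof.
move=> mA mb [C1' C10 HO] b_gt0 b_fin A_fin [C C0 HC].
pose l := fine (lam n b); pose a := fine (mu A).
have lE : lam n b = l%:E by rewrite fineK// ge0_fin_numE.
have aE : mu A = a%:E by rewrite fineK// ge0_fin_numE.
have l0 : 0 < l by rewrite -lte_fin -lE.
have a0 : 0 <= a by rewrite fine_ge0.
exists (l^-1 * (2 * C1' + 2 * a * C)).
  by rewrite mulr_ge0 ?invr_ge0 ?(ltW l0)// addr_ge0// !mulr_ge0.
move=> phi C1phi c; set E := (_ + _)%E.
have sq_ge0 (u : R) : 0 <= u ^+ 2 by exact: sqr_ge0.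
have DE : (dirichlet Om phi <= E)%E.
  by rewrite leeDl//; apply: integral_ge0 => x _; rewrite lee_fin.
have key (y : X) : (l%:E * ((phi y - c) ^+ 2)%:E <= 2%:E * \int[lam n]_(z in b) ((phi z - phi y) ^+ 2)%:E +
    2%:E * \int[lam n]_(z in b) ((phi z - c) ^+ 2)%:E)%E.
  rewrite -!ge0_integralZl//; [|exact: measurable_shift_sq|by move=> z _; rewrite lee_fin|
     exact: measurable_shift_sq|by move=> z _; rewrite lee_fin].
  rewrite -ge0_integralD//; last 4 first.
  - by move=> z _; rewrite lee_fin mulr_ge0.
  - by apply: measurable_funeM; exact: measurable_shift_sq.
  - by move=> z _; rewrite lee_fin mulr_ge0.
  - by apply: measurable_funeM; exact: measurable_shift_sq.
  rewrite -lE muleC -integral_cst//; apply: ge0_le_integral => //.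
  - by move=> z _; rewrite lee_fin.
  - by apply: emeasurable_funD; apply: measurable_funeM; exact: measurable_shift_sq.
  - move=> z _; rewrite /cst -!EFinM -EFinD lee_fin.
    have := sq_ge0 (2 * phi z - phi y - c); lra.
have int_c0 (D : set X) (d0 : R) (nu : {measure set BX -> \bar R}) :
   (0 <= \int[nu]_(z in D) ((phi z - d0) ^+ 2)%:E)%E.
  by apply: integral_ge0 => z _; rewrite lee_fin.
have main : (l%:E * \int[mu]_(x in A) ((phi x - c) ^+ 2)%:E <=
     2%:E * (C1'%:E * E) + 2%:E * a%:E * (C%:E * E))%E.
  rewrite -ge0_integralZl//; last 3 first.
  - exact: measurable_shift_sq.
  - by move=> z _; rewrite lee_fin.
  - by rewrite lee_fin ltW.
  apply: (@le_trans _ _ (\int[mu]_(y in A) (2%:E * \int[lam n]_(z in b) ((phi z - phi y) ^+ 2)%:E +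
    2%:E * \int[lam n]_(z in b) ((phi z - c) ^+ 2)%:E))%E).
    apply: ge0_le_integral => //.
    - by move=> z _; rewrite -EFinM lee_fin mulr_ge0// ltW.
    - by apply: measurable_funeM; exact: measurable_shift_sq.
    - apply: emeasurable_funD; last exact: measurable_cst.
      by apply: measurable_funeM; exact: measurable_osc.
  rewrite ge0_integralD; [|by []|by move=> y _; rewrite mule_ge0|
    by apply: measurable_funeM; exact: measurable_osc|by move=> y _; rewrite mule_ge0|exact: measurable_cst].
  rewrite ge0_integralZl//; last exact: measurable_osc.
  rewrite integral_cst// [X in (_ + _ * X)%E](_ : _ = a%:E); last exact: aE.
  apply: leeD.
    apply: lee_wpmul2l => //; apply: (le_trans (HO phi C1phi)).
    by apply: lee_wpmul2l.
  rewrite [leRHS]muleAC; apply: lee_wpmul2r; first by rewrite lee_fin.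
  by apply: lee_wpmul2l => //; exact: HC.
have -> : ((l^-1 * (2 * C1' + 2 * a * C))%:E * E = l^-1%:E * (2%:E * (C1'%:E * E) + 2%:E * a%:E * (C%:E * E)))%E.
  rewrite !muleA -!EFinM -ge0_muleDl ?lee_fin ?mulr_ge0// -EFinD muleA -EFinM.
  by congr (_%:E * _)%E.
rewrite [leLHS](_ : _ = l^-1%:E * (l%:E * \int[mu]_(x in A) ((phi x - c) ^+ 2)%:E))%E; last first.
  by rewrite muleA -EFinM mulVf ?mul1e// lt0r_neq0.
by apply: lee_wpmul2l; [rewrite lee_fin invr_ge0 ltW|exact: main].
Qed.

End oscillation.

(** * Lipschitz charts at boundary points *)

Section orthonormal_frame.
Context {R : realType}.

Lemma sqr_enormE n (y : 'rV[R]_n) : enorm y ^+ 2 = (y *m y^T) ord0 ord0.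
Proof. by rewrite sqr_enorm mxE; apply: eq_bigr => i _; rewrite mxE expr2. Qed.

(** The square matrix with columns $e$ and $Q$ has its transpose as a left inverse, hence as a right
    inverse, which gives Pythagoras' theorem. *)
Lemma frame_enorm n (Q : 'M[R]_(n, n.-1)) (e : 'cV[R]_n) (y : 'rV[R]_n) : (0 < n)%N ->
  Q^T *m Q = 1%:M -> e^T *m e = 1%:M -> Q^T *m e = 0 ->
  enorm y ^+ 2 = enorm (y *m Q) ^+ 2 + ((y *m e) ord0 ord0) ^+ 2.
Proof.
case: n Q e y => // p Q e y _ /= QQ ee Qe.
have eQ : e^T *m Q = 0 by rewrite -[LHS]trmxK trmx_mul trmxK Qe trmx0.
have MM : col_mx e^T Q^T *m row_mx e Q = 1%:M :> 'M[R]_(1 + p, 1 + p).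
  by rewrite mul_col_row ee QQ Qe eQ -scalar_mx_block.
have := @mulmx1C R p.+1 _ _ MM; rewrite (@mul_row_col R p.+1 1 p p.+1) => E.
have Ey : y *m y^T = (y *m e) *m (y *m e)^T + (y *m Q) *m (y *m Q)^T.
  by rewrite !trmx_mul -{1}[y]mulmx1 -E mulmxDr mulmxDl !mulmxA.
rewrite !sqr_enormE Ey mxE addrC; congr (_ + _).
by rewrite mxE big_ord1 [X in _ * X]mxE expr2.
Qed.

End orthonormal_frame.

Section boundary_chart.
Context {R : realType} {n : nat}.
Local Notation X := 'rV[R]_n.
Variable D : set X.
Hypotheses (oD : open D) (n0 : (0 < n)%N) (lD : lipschitz_boundary D).

Lemma boundaryE x : boundary D x <-> closure D x /\ ~ D x.
Proof. by rewrite /boundary (interior_id D).1. Qed.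

(** The two facts about a Lipschitz boundary that feed [core_estimate]: an interior cone, since
    moving in a direction steeper than the Lipschitz constant of [h] increases the height over the
    graph, and the growth $r^{n-1}$ of surface measure, since the boundary is a Lipschitz graph. *)
Lemma boundary_chart x : boundary D x -> exists (c : X) (rho K : R),
  [/\ 0 < rho, rho <= 1, 0 <= K,
    forall y v s, D y \/ boundary D y -> ball x (rho / 2) y -> ball c rho v ->
      0 < s -> s <= 1 -> D (y + s *: v) &
    forall z r, 0 < r -> (hausdorff n.-1 (boundary D `&` ball x (rho / 2) `&` ball z r) <=
      (K * r ^+ n.-1)%:E)%E].
Proof.
move=> bx; have [Q [e [h [U [[QQ ee Qe] [[k lh] oU Ux DU]]]]]] := lD bx.
have frame := frame_enorm _ n0 QQ ee Qe.
have n1 : 1 <= n%:R :> R by rewrite ler1n.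
have nR : 0 < n%:R :> R by rewrite ltr0n.
pose q (y : X) : R := (y *m e) ord0 ord0.
pose p (y : X) : 'rV[R]_n.-1 := y *m Q.
have qB y y' : q (y - y') = q y - q y' by rewrite /q mulmxBl !mxE.
have pB y y' : p (y - y') = p y - p y' by rewrite /p mulmxBl.
have qle y : `|q y| <= n%:R * `|y|.
  apply: le_trans (enorm_le_norm y); rewrite -ler_sqr ?nnegrE ?enorm_ge0//.
  by rewrite real_normK ?num_real// frame lerDr sqr_ge0.
have ple y : `|p y| <= n%:R * `|y|.
  apply: le_trans (enorm_le_norm y); apply: (le_trans (norm_le_enorm _)).
  by rewrite -ler_sqr ?nnegrE ?enorm_ge0// frame lerDl sqr_ge0.
have hle a b : `|h a - h b| <= `|k| * `|a - b|.
  have := lh (a, b) (ltac:(by [])) => /= /le_trans; apply.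
  by rewrite ler_wpM2r// ler_norm.
pose L := `|k| + 1.
have L0 : 0 < L by rewrite ltr_wpDl.
have L1 : 1 <= L by rewrite lerDr.
(* The height over the graph: near [x], positive exactly on [D], and zero at boundary points. *)
pose G y := q y - h (p y).
have Gle y y' : `|G y - G y'| <= L * n%:R * `|y - y'|.
  rewrite /G (_ : _ - _ = q (y - y') - (h (p y) - h (p y'))); last by rewrite qB; ring.
  rewrite (le_trans (ler_normB _ _))// /L mulrDl mul1r mulrDl addrC lerD//.
  by rewrite (le_trans (hle _ _))// -pB -mulrA ler_wpM2l.
have UD y : U y -> (D y <-> 0 < G y).
  move=> Uy; have : (D `&` U) y <-> ([set y | h (y *m Q) < (y *m e) ord0 ord0] `&` U) y by rewrite DU.
  by rewrite /setI /G /= subr_gt0 /q /p; tauto.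
have UG y : U y -> boundary D y -> G y = 0.
  move=> Uy /boundaryE[cy nDy]; apply/eqP; rewrite eq_le; apply/andP; split.
    by rewrite leNgt; apply/negP => /(UD _ Uy).
  rewrite leNgt; apply/negP => Gy.
  pose eps := - G y / (L * n%:R).
  have eps0 : 0 < eps by rewrite divr_gt0 ?oppr_gt0// mulr_gt0.
  have /cy[y' [Dy' [yy' Uy']]] : nbhs y (ball y eps `&` U).
    by apply: filterI; [exact: nbhsx_ballx|exact: open_nbhs_nbhs].
  have /(UD _ Uy') Gy' := Dy'.
  move: yy'; rewrite -ball_normE /= distrC ltr_pdivlMr ?mulr_gt0// mulrC => hh.
  have := lt_le_trans Gy' (ler_norm _); have := le_lt_trans (Gle y' y) hh.
  by rewrite ltr_norml; lra.
have /nbhs_ballP[del /= del0 delU] : nbhs x U by exact: open_nbhs_nbhs.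
(* Chosen so that $n(|k|+1)\tau\eta=\tau/2$: perturbing $\tau e$ by less than $\tau\eta$ keeps the
   direction steeper than [h]. The factor [n] compares the Euclidean norm with the sup norm. *)
pose eta := (2 * n%:R * L)^-1.
have eta0 : 0 < eta by rewrite invr_gt0 !mulr_gt0.
have eta1 : eta <= 2^-1.
  rewrite lef_pV2 ?posrE ?mulr_gt0// -mulrA ler_pMr//.
  exact: mulr_ege1.
(* Small enough for all points $y+sv$ met below to stay in the chart [U]. *)
pose tau := Num.min 1 (del / 8).
have tau0 : 0 < tau by rewrite lt_min ltr01 divr_gt0.
have tau1 : tau <= 1 by rewrite ge_min lexx.
have taud : tau <= del / 8 by rewrite ge_min lexx orbT.
have rho0 : 0 < tau * eta by rewrite mulr_gt0.
have rho_tau : tau * eta <= tau / 2 by rewrite ler_wpM2l// ltW.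
have eT : enorm e^T = 1.
  by apply/eqP; rewrite -(@eqrXn2 _ 2)// ?enorm_ge0// sqr_enormE trmxK ee mxE eqxx expr1n.
have qeT : q e^T = 1 by rewrite /q ee mxE eqxx.
have peT : p e^T = 0 by rewrite /p -[LHS]trmxK trmx_mul trmxK Qe trmx0.
exists (tau *: e^T), (tau * eta), (volume_diam1 R n.-1 * (4 * (n.-1%:R + `|k| + 1) * n%:R) ^+ n.-1).
have v0 : 0 <= volume_diam1 R n.-1 by apply: fine_ge0; exact: outer_measure_ge0.
have Ln0 : 0 < n.-1%:R + `|k| + 1 :> R by rewrite ltr_wpDl// addr_ge0.
have NU y : ball x (tau * eta / 2) y -> U y.
  move=> xy; apply: delU; apply: le_ball xy; lra.
split=> //.
- by lra.
- by rewrite mulr_ge0// exprn_ge0// !mulr_ge0// ltW.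
- move=> y v s Dy xy; rewrite -ball_normE /= => cv s0 s1.
  have Uy := NU y xy.
  have Gy : 0 <= G y by case: Dy => [/(UD _ Uy)/ltW//|/(UG _ Uy) ->].
  have vE : v = tau *: e^T - (tau *: e^T - v) by rewrite opprB addrC subrK.
  set w := _ - v in cv vE.
  have nw : n%:R * `|w| < n%:R * (tau * eta) by rewrite ltr_pM2l.
  have qv : tau - n%:R * `|w| <= q v.
    rewrite vE qB (_ : q (tau *: e^T) = tau); last by rewrite /q -scalemxAl mxE -/(q e^T) qeT mulr1.
    by rewrite lerD2l lerN2 (le_trans (ler_norm _)).
  have pv : `|p v| <= n%:R * `|w|.
    rewrite vE pB (_ : p (tau *: e^T) = 0) ?sub0r ?normrN//.
    by rewrite /p -scalemxAl -/(p e^T) peT scaler0.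
  have key : `|k| * `|p v| < q v.
    have h1 : `|k| * `|p v| <= `|k| * (n%:R * (tau * eta)).
      by rewrite ler_wpM2l// (le_trans pv)// ltW.
    have h2 : `|k| * (n%:R * (tau * eta)) + n%:R * (tau * eta) = tau / 2.
      by rewrite /eta /L; field; rewrite lt0r_neq0//= lt0r_neq0.
    lra.
  have nv : `|v| <= 2 * tau.
    rewrite vE (le_trans (ler_normB _ _))//.
    have : `|tau *: e^T| <= tau.
      rewrite normrZ gtr0_norm//; apply: ler_piMr; first exact: ltW.
      by rewrite -eT; exact: norm_le_enorm.
    lra.
  have Uyv : U (y + s *: v).
    apply: delU; rewrite -ball_normE /= opprD addrA (le_lt_trans (ler_normB _ _))//.
    move: xy; rewrite -ball_normE /= => xy.
    have : `|s *: v| <= 2 * tau.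
      by rewrite normrZ gtr0_norm// (le_trans _ nv)// ler_piMl.
    lra.
  apply/(UD _ Uyv).
  have : `|h (p (y + s *: v)) - h (p y)| <= s * (`|k| * `|p v|).
    rewrite (le_trans (hle _ _))//.
    have -> : p (y + s *: v) - p y = s *: p v by rewrite /p mulmxDl -scalemxAl addrC addKr.
    by rewrite normrZ (gtr0_norm s0) mulrCA.
  rewrite ler_norml => /andP[_ hh].
  have : s * (`|k| * `|p v|) < s * q v by rewrite ltr_pM2l.
  have -> : G (y + s *: v) = q y + s * q v - h (p (y + s *: v)).
    by rewrite /G /q mulmxDl -scalemxAl !mxE.
  move: Gy; rewrite /G; lra.
- move=> z r r0.
  have nr0 : 0 < n%:R * r by rewrite mulr_gt0.
  rewrite (_ : _ * r ^+ _ = volume_diam1 R n.-1 * (4 * (n.-1%:R + `|k| + 1) * (n%:R * r)) ^+ n.-1); last first.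
    by rewrite -mulrA -exprMn; congr (_ * _ ^+ _); rewrite !mulrA.
  apply: (@hausdorff_lipschitz_graph R n n.-1 _ p (n.-1%:R + `|k| + 1) (n%:R * r) (p z)) => //.
    move=> y y' [[by_ xy] _] [[by'_ xy'] _].
    have Gy := UG _ (NU _ xy) by_; have Gy' := UG _ (NU _ xy') by'_.
    have qw : `|q (y - y')| <= `|k| * `|p (y - y')|.
      rewrite qB pB (_ : q y - q y' = h (p y) - h (p y')); first exact: hle.
      by move: Gy Gy'; rewrite /G; lra.
    rewrite -pB -ler_sqr ?nnegrE ?enorm_ge0 ?mulr_ge0 ?(ltW Ln0)// frame.
    have e1 : enorm (p (y - y')) ^+ 2 <= (n.-1%:R * `|p (y - y')|) ^+ 2.
      by rewrite ler_sqr ?nnegrE ?enorm_ge0 ?mulr_ge0// enorm_le_norm.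
    have e2 : q (y - y') ^+ 2 <= (`|k| * `|p (y - y')|) ^+ 2.
      by rewrite -[leLHS]real_normK ?num_real// ler_sqr ?nnegrE ?mulr_ge0.
    apply: (le_trans (lerD e1 e2)).
    rewrite !exprMn -mulrDl ler_wpM2r ?sqr_ge0//.
    have : 0 <= n.-1%:R * `|k| :> R by rewrite mulr_ge0.
    have : 0 <= `|k| by []. have : 0 <= n.-1%:R :> R by [].
    nra.
  move=> y [_]; rewrite -!ball_normE /= => zy.
  by rewrite -pB (le_lt_trans (ple _))// ltr_pM2l.
Qed.

End boundary_chart.

(** * Surface measure on the Borel sets *)

Section surface_borel.
Context {R : realType} {n : nat}.
Local Notation X := 'rV[R]_n.
Local Notation BX := (borel 'rV[R]_n).
Variable D : set X.

Lemma measurable_id_surface : measurable_fun setT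
  (id : caratheodory_type [the outer_measure R X of hausdorff_on n.-1 (boundary D)] -> BX).
Proof. by move=> _ B mB; rewrite setTI; exact: borel_caratheodory_surface. Qed.

Lemma measurable_id_volume : measurable_fun setT
  (id : caratheodory_type [the outer_measure R X of lebesgue_on D] -> BX).
Proof. by move=> _ B mB; rewrite setTI; exact: borel_caratheodory_volume. Qed.

Hypothesis Dfin : (hausdorff n.-1 (boundary D) < +oo)%E.

Lemma surfB_sigma_finite : sigma_finite [set: BX] (push_measure (surface D) measurable_id_surface).
Proof.
exists (fun=> setT); first by rewrite bigcup_const.
move=> k; split=> //; rewrite /push_measure /= /pushforward /surface /caratheodory_measure /=.
by rewrite /hausdorff_on preimage_setT setTI.
Qed.

(** [surface D] lives on its own Caratheodory sigma-algebra; this copy shares the Borel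
    sigma-algebra with [lam n], so that both enter the same Fubini arguments. *)
Definition surfB : {sigma_finite_measure set BX -> \bar R} :=
  HB.pack (Measure.sort (push_measure (surface D) measurable_id_surface))
    (Measure.class (push_measure (surface D) measurable_id_surface))
    (Measure_isSigmaFinite.Build _ _ _ _ surfB_sigma_finite).

Lemma surfBE (A : set BX) : surfB A = hausdorff n.-1 (A `&` boundary D).
Proof. by []. Qed.

Lemma surfB_fin (A : set BX) : (surfB A < +oo)%E.
Proof.
apply: le_lt_trans Dfin; rewrite surfBE; apply: ge_ereal_sup => _ [e e0 <-].
apply: (@le_trans _ _ (mu_ext (@hausdorff_gauge R n n.-1 e) (boundary D))).
  by apply: le_mu_ext; exact: subIsetr.
by apply: ereal_sup_ubound; exists e.
Qed.

End surface_borel.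

#[global] Opaque surfB.

Lemma le_hausdorff (R : realType) n k (A B : set 'rV[R]_n) : A `<=` B -> (hausdorff k A <= hausdorff k B)%E.
Proof.
move=> AB; apply: ge_ereal_sup => _ [e e0 <-].
apply: (@le_trans _ _ (mu_ext (@hausdorff_gauge R n k e) B)); first exact: le_mu_ext.
by apply: ereal_sup_ubound; exists e.
Qed.

Lemma hausdorffU (R : realType) n k (A B : set 'rV[R]_n) :
  (hausdorff k (A `|` B) <= hausdorff k A + hausdorff k B)%E.
Proof.
have := outer_measureU2 [the outer_measure R _ of @hausdorff_on R n k setT] A B.
by rewrite /= /hausdorff_on !setIT.
Qed.

Lemma hausdorff0 (R : realType) n k : hausdorff k (set0 : set 'rV[R]_n) = 0%E.
Proof.
have := outer_measure0 [the outer_measure R _ of @hausdorff_on R n k setT].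
by rewrite /= /hausdorff_on setIT.
Qed.

(** * The Poincare inequality with boundary term *)

Section compact_ball_cover.
Import mathcomp.finmap.finmap.

(** Induction over a compact set: a property that holds on a small ball around each point and passes
    to unions holds on some set containing [K]. *)
Lemma compact_ball_cover (R : realType) n (K : set 'rV[R]_n) (P : set 'rV[R]_n -> Prop) :
  compact K -> P set0 -> (forall A B, P A -> P B -> P (A `|` B)) ->
  (forall x, K x -> exists2 r, 0 < r & P (ball x r)) -> exists2 A, K `<=` A & P A.
Proof.
rewrite compact_cover => cK P0 PU HP.
have /choice[r Hr] (x : 'rV[R]_n) : exists r : R, 0 < r /\ (K x -> P (ball x r)).
  have [/HP[r r0 Pr]|nKx] := pselect (K x); first by exists r.
  by exists 1; split=> // /nKx.
have [|x Kx|s sK] := cK _ K (fun x => ball x (r x)).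
- by move=> x _; exact: ball_open.
- by exists x => //; apply: ballxx; have [] := Hr x.
rewrite (_ : [set` s] = [set x | x \in [seq y <- finmap.enum_fset s | true]]); last first.
  by apply/seteqP; split=> x /=; rewrite filter_predT.
rewrite filter_predT; set l := finmap.enum_fset s => Ks.
have lK x : x \in l -> K x by move=> xl; have := sK x xl; rewrite ?in_setE.
exists (\big[setU/set0]_(x <- l) ball x (r x)).
  by apply: (subset_trans Ks); rewrite /cover -bigcup_seq.
rewrite big_seq; elim/big_ind : _ => // x xl.
by have [_] := Hr x; apply; exact: lK.
Qed.

End compact_ball_cover.

Section poincare.
Context {R : realType} {n : nat}.
Local Notation X := 'rV[R]_n.
Local Notation BX := (borel 'rV[R]_n).
Variable D : set X.
Hypotheses (n2 : (2 <= n)%N) (bD : bounded_connected_lipschitz_domain D).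

Let n0 : (0 < n)%N. Proof. exact: ltnW. Qed.
Let oD : open D. Proof. by case: bD. Qed.
Let lD : lipschitz_boundary D. Proof. by case: bD. Qed.

Lemma bounded_closure : bounded_set (closure D).
Proof.
have [_ _ [M [Mreal HM]] _ _] := bD; exists M; split=> // M' MM' x cx.
apply/ler_addgt0Pr => e e0.
have [y [Dy xy]] := cx _ (nbhsx_ballx x e e0).
move: xy; rewrite -ball_normE /= => xy.
rewrite -(subrK y x) addrC (le_trans (ler_normD _ _))// lerD ?(ltW xy)//.
exact: HM Dy.
Qed.

Lemma compact_closure : compact (closure D).
Proof. by apply: bounded_closed_compact; [exact: bounded_closure|exact: closed_closure]. Qed.

Lemma compact_boundary : compact (boundary D).
Proof.
apply: bounded_closed_compact.
  by have [M [Mr HM]] := bounded_closure; exists M; split=> // M' MM' x [cx _]; exact: HM cx.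
by apply: closedI; [exact: closed_closure|apply: open_closedC; exact: open_interior].
Qed.

Lemma hausdorff_boundary_fin : (hausdorff n.-1 (boundary D) < +oo)%E.
Proof.
have [||x bx|A KA Pfin] := @compact_ball_cover R n (boundary D)
    (fun A => hausdorff n.-1 (boundary D `&` A) < +oo)%E compact_boundary.
- by rewrite setI0 hausdorff0.
- move=> A B PA PB; rewrite setIUr; apply: (le_lt_trans (hausdorffU _ _ _)).
  exact: lte_add_pinfty.
- have [c [rho [K [rho0 rho1 K0 _ HK]]]] := boundary_chart oD n0 lD bx.
  exists (rho / 2); first exact: divr_gt0.
  apply: le_lt_trans (ltry (K * rho ^+ n.-1)); apply: le_trans (HK x rho rho0).
  apply: le_hausdorff => y [by_ xy]; split=> //; apply: le_ball xy.
  by rewrite ler_pdivrMr// ler_pMr// ler1n.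
by apply: le_lt_trans Pfin; apply: le_hausdorff => y by_; split=> //; exact: KA.
Qed.

Local Notation surf := (surfB hausdorff_boundary_fin).

(** For radii at most $1$ volume also grows at most like $r^{n-1}$, so [core_estimate] serves volume
    and surface measure alike. *)
Lemma lam_growth (A : set BX) (z : X) (r : R) : measurable A -> 0 < r -> r <= 1 ->
  (lam n (A `&` ball z r) <= (2 ^+ n * r ^+ n.-1)%:E)%E.
Proof.
move=> mA r0 r1; apply: (@le_trans _ _ (lam n (ball z r))).
  apply: le_measure; rewrite ?inE; [|exact: ball_borel|exact: subIsetr].
  by apply: measurableI => //; exact: ball_borel.
have E : (r *+ 2) ^+ n = 2 ^+ n * r ^+ n by rewrite -[r *+ 2]mulr_natl exprMn.
rewrite lam_ball// lee_fin E; apply: ler_wpM2l; first exact: exprn_ge0.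
by rewrite -[in leLHS](prednK n0) exprS; apply: ler_piMl => //; apply: exprn_ge0; exact: ltW.
Qed.

Lemma lam_ball_gt0 (x : X) (r : R) : 0 < r -> (0 < lam n (ball x r))%E.
Proof. by move=> r0; rewrite lam_ball// lte_fin exprn_gt0// mulrn_wgt0. Qed.

Lemma lam_ball_fin (x : X) (r : R) : 0 < r -> (lam n (ball x r) < +oo)%E.
Proof. by move=> r0; rewrite lam_ball// ltry. Qed.

Lemma osc_boundS mu (A b b' : set X) : measurable (b : set BX) -> measurable (b' : set BX) ->
  measurable (A : set BX) -> b' `<=` b -> osc_bound D mu A b -> osc_bound D mu A b'.
Proof.
move=> mb mb' mA bb' [C C0 HC]; exists C => // phi C1phi; apply: le_trans (HC phi C1phi).
apply: ge0_le_integral => //.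
- by move=> y _; apply: integral_ge0 => z _; rewrite lee_fin sqr_ge0.
- exact: measurable_osc.
- exact: measurable_osc.
move=> y _; apply: ge0_subset_integral => //.
- exact: measurable_shift_sq.
- by move=> x _; rewrite lee_fin sqr_ge0.
Qed.

(** At an interior point the cone may be a full ball: [osc_bound_cone] is used with axis $c=0$. *)
Lemma interior_osc (x : X) : D x -> exists r : R, [/\ 0 < r, ball x r `<=` D &
  osc_bound D (lam n) (ball x r) (ball x r)].
Proof.
move=> Dx; have /nbhs_ballP[del /= del0 delD] : nbhs x D by exact: open_nbhs_nbhs.
pose rho := Num.min 1 (del / 2).
have rho0 : 0 < rho by rewrite lt_min ltr01 divr_gt0.
have rho1 : rho <= 1 by rewrite ge_min lexx.
have rhod : rho <= del / 2 by rewrite ge_min lexx orbT.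
exists (rho / 2); split; first exact: divr_gt0.
  by apply: subset_trans delD; apply: le_ball; lra.
rewrite -[X in osc_bound _ _ _ (ball X _)]addr0.
apply: (@osc_bound_cone R n D oD n0 (lam n) _ x 0 rho (2 ^+ n)) => //.
- exact: ball_borel.
- move=> y v s; rewrite -!ball_normE /= sub0r normrN => xy v0 s0 s1.
  apply: delD; rewrite -ball_normE /= opprD addrA (le_lt_trans (ler_normB _ _))//.
  have : `|s *: v| <= `|v| by rewrite normrZ gtr0_norm// ler_piMl.
  lra.
- by move=> z r r0 r1; apply: lam_growth => //; exact: ball_borel.
Qed.

Section from_ball.
Variables (x0 : X) (r0 : R).
Hypotheses (r0_gt0 : 0 < r0) (b0D : ball x0 r0 `<=` D).
Local Notation b0 := (ball x0 r0).
Local Notation control := (mean_control D b0).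

Let base_control : control (lam n) b0.
Proof. by exists 1 => // phi _ c; rewrite mul1e leeDr// dirichlet_ge0. Qed.

(** The points with a controlled ball form a nonempty set that is open and relatively closed in the
    connected set [D]. Closedness: a limit point has a ball with an oscillation bound, and that ball
    contains a small controlled one from which control is transferred. *)
Lemma interior_control (x : X) : D x -> exists r : R, [/\ 0 < r, ball x r `<=` D &
  control (lam n) (ball x r)].
Proof.
pose U := [set x | exists r : R, [/\ 0 < r, ball x r `<=` D & control (lam n) (ball x r)]].
suff DU : U = D by move=> Dx; have : U x by rewrite DU.
have UD : U `<=` D by move=> y [r [r_gt0 /(_ y) h _]]; apply: h; exact: ballxx.
have oU : open U.
  rewrite openE => y [r [r_gt0 yrD yc]]; apply/nbhs_ballP; exists (r / 2) => /=; first exact: divr_gt0.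
  move=> z yz; have zy : ball z (r / 2) `<=` ball y r.
    by move=> w zw; rewrite [r]splitr; exact: ball_triangle zw.
  exists (r / 2); split; [exact: divr_gt0|exact: subset_trans yrD|].
  by apply: mean_controlS yc; [exact: ball_borel|exact: ball_borel|].
have [_ _ _ cD _] := bD; apply: cD.
- by exists x0, r0; split.
- by exists U => //; rewrite setIC; apply/esym/setIidPl.
exists (closure U); first exact: closed_closure.
apply/seteqP; split=> [y Uy|y [Dy cy]].
  by split; [exact: UD|exact: subset_closure].
have [rho [rho0 rhoD Hosc]] := interior_osc Dy.
have [z [[r [r_gt0 zrD zc]] yz]] := cy _ (nbhsx_ballx y rho rho0).
move: (yz); rewrite -ball_normE /= => yzlt.
pose e := Num.min r (rho - `|y - z|).
have e0 : 0 < e by rewrite lt_min r_gt0 subr_gt0.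
have zey : ball z e `<=` ball y rho.
  move=> w; rewrite -!ball_normE /= => zw; rewrite -(subrKA z) (le_lt_trans (ler_normD _ _))//.
  by have : e <= rho - `|y - z| by [rewrite ge_min lexx orbT]; lra.
exists rho; split; [exact: rho0|exact: rhoD|].
apply: (@mean_control_transfer R n D b0 (lam n) (ball y rho) (ball z e)).
- exact: ball_borel.
- exact: ball_borel.
- by apply: osc_boundS Hosc => //; exact: ball_borel.
- exact: lam_ball_gt0.
- exact: lam_ball_fin.
- exact: lam_ball_fin.
- apply: mean_controlS zc; [exact: ball_borel|exact: ball_borel|].
  by apply: le_ball; rewrite ge_min lexx.
Qed.

Lemma control_set0 (mu : {sigma_finite_measure set BX -> \bar R}) : control mu set0.
Proof.
exists 0 => // phi C1phi c; rewrite mul0e integral_set0//.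
Qed.

(** Finitely many balls cover the closure. Near a boundary point [x], control passes from a ball
    around the interior point $x+c$ on the cone axis to both the part of [D] and the part of the
    boundary in a ball around [x]. *)
Lemma domain_control : control (lam n) D /\ control surf (boundary D).
Proof.
have mB : measurable (boundary D : set BX).
  by apply: closed_borel; apply: closedI; [exact: closed_closure|apply: open_closedC; exact: open_interior].
have mD : measurable (D : set BX) by exact: open_borel.
have [||x cx|A cA [mA [cl cs]]] := @compact_ball_cover R n (closure D)
    (fun A => measurable (A : set BX) /\ control (lam n) (A `&` D) /\ control surf (A `&` boundary D))
    compact_closure.
- by rewrite !set0I; split=> //; split; exact: control_set0.
- move=> A B [mA [a1 a2]] [mB' [b1 b2]]; split; first exact: measurableU.
  by rewrite !setIUl; split; apply: mean_controlU => //; exact: measurableI.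
- have [Dx|nDx] := pselect (D x).
    have [r [r_gt0 xrD xc]] := interior_control Dx.
    exists r => //; split; first exact: ball_borel.
    split; first by rewrite (setIidl xrD).
    rewrite (_ : _ `&` _ = set0); first exact: control_set0.
    apply/seteqP; split=> // y [/xrD Dy]; rewrite boundaryE//; by case.
  have bx : boundary D x by rewrite boundaryE.
  have [c [rho [K [rho0 rho1 K0 cone HK]]]] := boundary_chart oD n0 lD bx.
  have Dxc : D (x + c).
    rewrite -[c]scale1r; apply: cone => //; first by right.
      by apply: ballxx; exact: divr_gt0.
    exact: ballxx.
  have [r [r_gt0 xrD xc]] := interior_control Dxc.
  pose e := Num.min r (rho / 2).
  have e0 : 0 < e by rewrite lt_min r_gt0 divr_gt0.
  have ec : control (lam n) (ball (x + c) e).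
    apply: mean_controlS xc; [exact: ball_borel|exact: ball_borel|].
    by apply: le_ball; rewrite ge_min lexx.
  have eb : ball (x + c) e `<=` ball (x + c) (rho / 2) by apply: le_ball; rewrite ge_min lexx orbT.
  have mb : measurable (ball x (rho / 2) : set BX) by exact: ball_borel.
  exists (rho / 2); first exact: divr_gt0.
  split=> //; split.
    have mA : measurable (ball x (rho / 2) `&` D : set BX) by exact: measurableI.
    apply: (@mean_control_transfer R n D b0 (lam n) _ (ball (x + c) e)) => //.
    - exact: ball_borel.
    - apply: (@osc_boundS _ _ (ball (x + c) (rho / 2))) => //; [exact: ball_borel|exact: ball_borel|].
      apply: (@osc_bound_cone R n D oD n0 (lam n) _ x c rho (2 ^+ n)) => //.
      + by move=> y v s [xy Dy]; apply: cone => //; left.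
      + by move=> z q q0 q1; exact: lam_growth.
    - exact: lam_ball_gt0.
    - exact: lam_ball_fin.
    - apply: (@le_lt_trans _ _ (lam n (ball x (rho / 2)))); last by apply: lam_ball_fin; exact: divr_gt0.
      by apply: le_measure; rewrite ?inE.
  have mA : measurable (ball x (rho / 2) `&` boundary D : set BX) by exact: measurableI.
  apply: (@mean_control_transfer R n D b0 surf _ (ball (x + c) e)) => //.
  - exact: ball_borel.
  - apply: (@osc_boundS _ _ (ball (x + c) (rho / 2))) => //; [exact: ball_borel|exact: ball_borel|].
    apply: (@osc_bound_cone R n D oD n0 surf _ x c rho K) => //.
    + by move=> y v s [xy Dy]; apply: cone => //; right.
    + move=> z q q0 q1; rewrite surfBE; apply: le_trans (HK z q q0).
      by apply: le_hausdorff => y [[[xy by_] zy] _].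
  - exact: lam_ball_gt0.
  - exact: lam_ball_fin.
  - exact: surfB_fin.
have AD : A `&` D = D.
  by apply/seteqP; split=> [y []//|y Dy]; split=> //; apply: cA; exact: subset_closure.
have AB : A `&` boundary D = boundary D.
  by apply/seteqP; split=> [y []//|y by_]; split=> //; apply: cA; case: by_.
by rewrite AD in cl; rewrite AB in cs.
Qed.

End from_ball.

(** After [domain_control], what remains is to choose [c] with $\int_{b_0}(\phi-c)^2$ small. The
    value of $\phi$ at a suitable point serves as [c], instead of a mean value. *)
Lemma poincare_inequality : exists2 C : R, 0 <= C & forall phi (e : R), C1 phi -> 0 < e ->
  (dirichlet D phi < +oo)%E -> exists c : R,
  (\int[lam n]_(x in D) ((phi x - c) ^+ 2)%:E <= C%:E * (dirichlet D phi + e%:E))%E /\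
  (\int[surf]_(x in boundary D) ((phi x - c) ^+ 2)%:E <= C%:E * (dirichlet D phi + e%:E))%E.
Proof.
have [[x0 Dx0] _ _ _ _] := bD.
have [r [r_gt0 rD [C0 C00 HC0]]] := interior_osc Dx0.
have [[C1' C10 HC1] [C2 C20 HC2]] := domain_control r_gt0 rD.
pose l := fine (lam n (ball x0 r)).
have lE : lam n (ball x0 r) = l%:E by rewrite fineK// ge0_fin_numE//; exact: lam_ball_fin.
have l0 : 0 < l by rewrite -lte_fin -lE lam_ball_gt0.
exists ((C1' + C2) * (2 + C0 / l)).
  by rewrite mulr_ge0 ?addr_ge0// divr_ge0// ltW.
move=> phi e C1phi e0 Dfin.
pose d := fine (dirichlet D phi).
have dE : dirichlet D phi = d%:E by rewrite fineK// ge0_fin_numE// dirichlet_ge0.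
have d0 : 0 <= d by rewrite fine_ge0// dirichlet_ge0.
(* The average over $y$ in the ball is at most $C_0d/l$, so not every $y$ can exceed this by [e]. *)
have [y Hy] : exists y, (\int[lam n]_(z in ball x0 r) ((phi z - phi y) ^+ 2)%:E <= (C0 * d / l + e)%:E)%E.
  apply: contrapT => nex.
  have {}nex y : ((C0 * d / l + e)%:E <= \int[lam n]_(z in ball x0 r) ((phi z - phi y) ^+ 2)%:E)%E.
    by apply: ltW; rewrite ltNge; apply/negP => h; apply: nex; exists y.
  have := HC0 phi C1phi; rewrite dE; apply/negP; rewrite -ltNge.
  apply: (@lt_le_trans _ _ (\int[lam n]_(y in ball x0 r) (C0 * d / l + e)%:E)%E).
    rewrite integral_cst; last exact: ball_borel.
    rewrite [X in (_ < _ * X)%E](_ : _ = l%:E); last exact: lE.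
    rewrite -!EFinM lte_fin mulrDl divfK ?lt0r_neq0// ltrDl mulr_gt0//.
  apply: ge0_le_integral => //.
  - exact: ball_borel.
  - by move=> z _; rewrite lee_fin addr_ge0 ?(ltW e0)// divr_ge0 ?mulr_ge0 ?(ltW l0).
  - by apply: measurable_osc => //; exact: ball_borel.
pose I := fine (\int[lam n]_(z in ball x0 r) ((phi z - phi y) ^+ 2)%:E)%E.
have I0 : (0 <= \int[lam n]_(z in ball x0 r) ((phi z - phi y) ^+ 2)%:E)%E.
  by apply: integral_ge0 => z _; rewrite lee_fin sqr_ge0.
have IE : (\int[lam n]_(z in ball x0 r) ((phi z - phi y) ^+ 2)%:E = I%:E)%E.
  by rewrite fineK// ge0_fin_numE//; apply: le_lt_trans Hy _; rewrite ltry.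
have I00 : 0 <= I by rewrite fine_ge0.
have HI : I <= C0 * d / l + e by rewrite -lee_fin -IE.
have key : d + I <= (2 + C0 / l) * (d + e).
  have h1 : 0 <= C0 / l * e by rewrite mulr_ge0 ?(ltW e0)// divr_ge0 ?(ltW l0).
  have h2 : C0 * d / l = C0 / l * d by rewrite mulrAC.
  by move: HI; rewrite h2; set q := C0 / l in h1 *; move=> HI; nra.
have q0 : 0 <= (2 + C0 / l) * (d + e).
  by rewrite mulr_ge0 ?addr_ge0 ?(ltW e0)// divr_ge0// ltW.
exists (phi y); split.
  apply: (le_trans (HC1 phi C1phi (phi y))); rewrite dE IE -!EFinD -!EFinM lee_fin.
  rewrite -mulrA (le_trans (ler_wpM2l C10 key))// ler_wpM2r// lerDl//.
apply: (le_trans (HC2 phi C1phi (phi y))); rewrite dE IE -!EFinD -!EFinM lee_fin.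
by rewrite -mulrA (le_trans (ler_wpM2l C20 key))// ler_wpM2r// lerDr.
Qed.

End poincare.

(** * Positive semidefinite forms and approximate Riesz representation *)

Section bilinear_form.
Context {R : realType} {E : lmodType R}.
Variable b : E -> E -> R.
Hypotheses (bDl : forall x y z, b (x + y) z = b x z + b y z)
  (bZl : forall a x z, b (a *: x) z = a * b x z)
  (bC : forall x y, b x y = b y x) (b0 : forall x, 0 <= b x x).

Lemma form_Dr x y z : b x (y + z) = b x y + b x z.
Proof. by rewrite bC bDl bC (bC z). Qed.

Lemma form_Zr a x y : b x (a *: y) = a * b x y.
Proof. by rewrite bC bZl bC. Qed.

Lemma form_Nl x y : b (- x) y = - b x y.
Proof. by rewrite -scaleN1r bZl mulN1r. Qed.

Lemma form_Nr x y : b x (- y) = - b x y.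
Proof. by rewrite bC form_Nl bC. Qed.

Lemma psd_cauchy_schwarz x y : b x y ^+ 2 <= b x x * b y y.
Proof.
have H t : 0 <= b x x + 2 * t * b x y + t ^+ 2 * b y y.
  have := b0 (x + t *: y); rewrite bDl !form_Dr !bZl !form_Zr (bC y x).
  by congr (0 <= _); ring.
have := b0 y; rewrite le_eqVlt => /predU1P[y0|y0].
  have bxy : b x y = 0.
    apply/eqP; apply: contrapT => /negP xy0.
    have := H (- (b x x + 1) / (2 * b x y)); rewrite -y0 mulr0 addr0.
    have -> : b x x + 2 * (- (b x x + 1) / (2 * b x y)) * b x y = - 1 by field.
    by rewrite ler0N1.
  by rewrite bxy expr0n/= -y0 mulr0.
have := H (- b x y / b y y).
rewrite (_ : _ + _ = (b x x * b y y - b x y ^+ 2) / b y y).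
  by rewrite pmulr_lge0 ?invr_gt0// subr_ge0.
by field; exact: lt0r_neq0.
Qed.

End bilinear_form.

Section minimizing_sequence.
Context {R : realType} {E : lmodType R}.
Variables (b : E -> E -> R) (l : E -> R) (K : R).
Hypotheses (bDl : forall x y z, b (x + y) z = b x z + b y z)
  (bZl : forall a x z, b (a *: x) z = a * b x z)
  (bC : forall x y, b x y = b y x) (b0 : forall x, 0 <= b x x)
  (lD : forall x y, l (x + y) = l x + l y) (lZ : forall a x, l (a *: x) = a * l x)
  (lK : forall x, l x ^+ 2 <= K * b x x).

Hypothesis K0 : 0 <= K.

(* The witness almost minimizes the energy [b x x - 2 l x]; the first variation
   of the energy then bounds [b x y - l y]. *)
Lemma riesz_approx (e : R) : 0 < e -> exists x, forall y, (b x y - l y) ^+ 2 <= e * b y y.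
Proof.
move=> e0; pose J x := b x x - 2 * l x.
have Jlb x : - K <= J x.
  have := lK x; have := b0 x => bx lx; rewrite /J.
  have [h|h] := leP (2 * l x) (K + b x x); first by lra.
  have : (K + b x x) ^+ 2 < (2 * l x) ^+ 2.
    by rewrite ltr_sqr ?nnegrE ?addr_ge0// (le_trans _ (ltW h))// addr_ge0.
  have := sqr_ge0 (K - b x x); nra.
have infJ : has_inf (range J).
  by split; [exists (J 0), 0|exists (- K) => _ [x _ <-]].
have [_ [x _ <-] xJ] := inf_adherent e0 infJ.
exists x => y; set d := b x y - l y; set B := b y y.
have key t : 0 <= e + 2 * t * d + t ^+ 2 * B.
  have : inf (range J) <= J (x + t *: y) by apply: ge_inf; [by case: infJ|exists (x + t *: y)].
  rewrite /J bDl !(form_Dr bDl bC) !bZl !(form_Zr bZl bC) lD lZ (bC y x) -/B.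
  by move: xJ; rewrite /J /d; lra.
have := b0 y; rewrite -/B le_eqVlt => /predU1P[B0|B0].
  rewrite -B0 mulr0; have [->|d0] := eqVneq d 0; first by rewrite expr0n.
  have := key (- (e + 1) / (2 * d)); rewrite -B0 mulr0 addr0.
  have -> : e + 2 * (- (e + 1) / (2 * d)) * d = - 1 by field.
  by rewrite ler0N1.
have := key (- d / B); rewrite (_ : _ + _ = (e * B - d ^+ 2) / B).
  by rewrite pmulr_lge0 ?invr_gt0// subr_ge0.
by field; exact: lt0r_neq0.
Qed.

End minimizing_sequence.

(** * Weighted forms on $L^2$ and completeness *)

Section L2_tools.
Context d (T : measurableType d) (R : realType).
Variable mu : {measure set T -> \bar R}.
Implicit Types f g h : L2 mu.

Lemma ae_eq_Rintegral (f g : T -> R) : measurable_fun setT f -> measurable_fun setT g ->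
  (\forall x \ae mu, f x = g x) -> \int[mu]_x f x = \int[mu]_x g x.
Proof.
move=> mf mg fg; rewrite /Rintegral; congr fine; apply: ae_eq_integral => //.
- exact/measurable_EFinP.
- exact/measurable_EFinP.
- by apply: filterS fg => x /= -> _.
Qed.

Lemma measurable_L2 f : measurable_fun setT (f : T -> R).
Proof. by []. Qed.

Lemma L2_Lfun f : (f : T -> R) \in Lfun mu 2%:E.
Proof. exact: LfunP. Qed.

Lemma Lp_norm_EFin f : ('N[mu]_2%:E[EFin \o f] = (`|f|)%:E)%E.
Proof. by rewrite [in RHS]/Num.norm /= /Lp_norm finite_norm_fine. Qed.

Lemma integral_sqr_L2 f : (\int[mu]_x ((f x) ^+ 2)%:E = (`|f| ^+ 2)%:E)%E.
Proof.
have := @poweR_Lnorm _ T R mu (EFin \o f) 2 (ltac:(by [])).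
rewrite Lp_norm_EFin => H; have {}H : ((`|f| `^ 2)%:E = \int[mu]_x `|(EFin \o f) x| `^ 2)%E := H.
rewrite powR_mulrn// in H; rewrite H; apply: eq_integral => x _ /=.
by rewrite -[RHS]/((`|f x| `^ 2)%:E) powR_mulrn// real_normK// num_real.
Qed.

Lemma integrable_L2M f g : mu.-integrable setT (EFin \o (fun x => f x * g x)).
Proof. exact/Lfun1_integrable/Lfun2_mul_Lfun1/L2_Lfun/L2_Lfun. Qed.

Lemma integral_abs_L2M f g : (\int[mu]_x (`|f x * g x|)%:E <= (`|f| * `|g|)%:E)%E.
Proof.
have := @hoelder _ T R mu f g 2 2 (measurable_L2 f) (measurable_L2 g) (ltac:(by [])) (ltac:(by [])) (ltac:(lra)).
rewrite Lnorm1 !Lp_norm_EFin -EFinM; apply: le_trans.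
by rewrite le_eqVlt; apply/orP; left; apply/eqP; apply: eq_integral.
Qed.

Section weighted_form.
Variables (s : T -> R) (M : R).
Hypotheses (ms : measurable_fun setT s) (sM : \forall x \ae mu, `|s x| <= M) (M0 : 0 <= M).

Definition wform f g : R := \int[mu]_x (s x * (f x * g x)).

Lemma measurable_wform f g : measurable_fun setT (fun x => s x * (f x * g x)).
Proof. by apply: measurable_funM => //; exact: measurable_funM. Qed.

Lemma wform_abs f g : (\int[mu]_x (`|s x * (f x * g x)|)%:E <= (M * (`|f| * `|g|))%:E)%E.
Proof.
apply: (@le_trans _ _ (\int[mu]_x (M%:E * (`|f x * g x|)%:E))%E).
  apply: ae_ge0_le_integral => //.
  - by apply/measurable_EFinP; apply: measurableT_comp => //; exact: measurable_wform.
  - by move=> x _; rewrite mule_ge0 ?lee_fin.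
  - apply: measurable_funeM; apply/measurable_EFinP; apply: measurableT_comp => //.
    exact: measurable_funM.
  - by apply: filterS sM => x sx _; rewrite normrM EFinM lee_wpmul2r ?lee_fin.
rewrite ge0_integralZl//; last first.
  by apply/measurable_EFinP; apply: measurableT_comp => //; exact: measurable_funM.
by rewrite EFinM lee_wpmul2l ?lee_fin ?integral_abs_L2M.
Qed.

Lemma integrable_wform f g : mu.-integrable setT (EFin \o (fun x => s x * (f x * g x))).
Proof.
apply/integrableP; split; first by apply/measurable_EFinP; exact: measurable_wform.
by apply: le_lt_trans (ltry _); exact: wform_abs.
Qed.

Lemma wformC f g : wform f g = wform g f.
Proof. by apply: eq_Rintegral => x _; rewrite (mulrC (f x)). Qed.

Lemma wformDl f g h : wform (f + g) h = wform f h + wform g h.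
Proof.
rewrite /wform -RintegralD//; [|exact: integrable_wform|exact: integrable_wform].
apply: ae_eq_Rintegral; first exact: measurable_wform.
  by apply: measurable_funD; exact: measurable_wform.
by apply: filterS (Lp_reprD f g) => x ->; rewrite mulrDl mulrDr.
Qed.

Lemma wformZl a f h : wform (a *: f) h = a * wform f h.
Proof.
rewrite /wform -RintegralZl//; last exact: integrable_wform.
apply: ae_eq_Rintegral; first exact: measurable_wform.
  by apply: measurable_funM => //; exact: measurable_wform.
by apply: filterS (Lp_reprZ a f) => x ->; rewrite -mulrA mulrCA.
Qed.

Lemma wform_bound f g : `|wform f g| <= M * (`|f| * `|g|).
Proof.
apply: (le_trans (le_normr_Rintegral _ (integrable_wform f g))) => //.
rewrite -lee_fin /Rintegral fineK.
  by have := wform_abs f g.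
apply: integrable_fin_num => //; have := integrable_norm (integrable_wform f g).
by [].
Qed.

End weighted_form.

Lemma dotE f g : dot_L2 f g = wform (cst 1) f g.
Proof. by apply: eq_Rintegral => x _; rewrite mul1r. Qed.

Let m1 : measurable_fun setT (cst 1 : T -> R). Proof. exact: measurable_cst. Qed.
Let b1 : \forall x \ae mu, `|(cst 1 : T -> R) x| <= 1.
Proof. by apply: aeW => x; rewrite normr1. Qed.

Lemma dotC f g : dot_L2 f g = dot_L2 g f.
Proof. by rewrite !dotE wformC. Qed.

Lemma dotDl f g h : dot_L2 (f + g) h = dot_L2 f h + dot_L2 g h.
Proof. by rewrite !dotE; exact: (wformDl m1 b1 ler01). Qed.

Lemma dotZl a f h : dot_L2 (a *: f) h = a * dot_L2 f h.
Proof. by rewrite !dotE; exact: (wformZl m1 b1 ler01). Qed.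

Lemma dot_bound f g : `|dot_L2 f g| <= `|f| * `|g|.
Proof. by rewrite dotE (le_trans (wform_bound m1 b1 ler01 _ _))// mul1r. Qed.

Lemma dot_norm f : dot_L2 f f = `|f| ^+ 2.
Proof.
by rewrite /dot_L2 /Rintegral -[RHS]/(fine (`|f| ^+ 2)%:E) -integral_sqr_L2.
Qed.

End L2_tools.

Section L2_complete.
Context d (T : measurableType d) (R : realType).
Variable mu : {measure set T -> \bar R}.

Lemma Lfun2P (f : T -> R) : measurable_fun setT f ->
  (\int[mu]_x ((f x) ^+ 2)%:E < +oo)%E -> f \in Lfun mu 2%:E.
Proof.
move=> mf foo; apply/andP; split; rewrite inE//= /finite_norm.
rewrite unlock; apply: poweR_lty; apply: le_lt_trans foo.
rewrite le_eqVlt; apply/orP; left; apply/eqP; apply: eq_integral => x _.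
by rewrite -[LHS]/((`|f x| `^ 2)%:E) powR_mulrn// real_normK// num_real.
Qed.

Definition L2_class (f : T -> R) (Hf : f \in Lfun mu 2%:E) : L2 mu := Lp_class (Lfun_Sub (lee1n 2) Hf).

Lemma L2_classE (f : T -> R) (Hf : f \in Lfun mu 2%:E) :
  \forall x \ae mu, (L2_class Hf) x = f x.
Proof. exact: Lp_classK. Qed.

Lemma L2_dist (u : L2 mu) (f : T -> R) (Hf : f \in Lfun mu 2%:E) :
  (\int[mu]_x ((u x - f x) ^+ 2)%:E = (`|u - L2_class Hf| ^+ 2)%:E)%E.
Proof.
rewrite -integral_sqr_L2; have mf : measurable_fun setT f.
  by have := sub_Lfun_mfun Hf; rewrite inE.
apply: ae_eq_integral => //.
- apply/measurable_EFinP; apply: measurable_funX; exact: measurable_funB.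
- by apply/measurable_EFinP; apply: measurable_funX.
apply: filterS3 (Lp_reprD u (- L2_class Hf)) (Lp_reprZ (- 1) (L2_class Hf)) (L2_classE Hf).
by move=> x h1 h2 h3 _; rewrite h1; rewrite scaleN1r in h2; rewrite h2 h3 mulN1r.
Qed.

Lemma L2_distE (u v : L2 mu) :
  (\int[mu]_x ((u x - v x) ^+ 2)%:E = (`|u - v| ^+ 2)%:E)%E.
Proof.
rewrite (L2_dist u (L2_Lfun v)); congr (`|_ - _| ^+ 2)%:E.
by rewrite -[RHS]Lp_reprK; apply/eq_Lp_class/aeW.
Qed.

(** Cauchy-Schwarz with the weights $2^{j}$ and $2^{-j}$, and $\sum_{j\ge k}2^{-j}=2\cdot2^{-k}$. *)
Lemma geometric_increments (a : nat -> R) (k m : nat) :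
  (a (k + m)%N - a k) ^+ 2 <=
  2 * 2^-1 ^+ k * \sum_(k <= j < k + m) 2 ^+ j * (a j.+1 - a j) ^+ 2.
Proof.
elim: m k => [|m IH] k.
  by rewrite addn0 subrr expr0n/= big_geq// mulr0.
rewrite big_ltn ?addnS ?ltnS ?leq_addr// -addSn.
have := IH k.+1; set S := \sum_(_ <= _ < _) _ => HS.
have -> : a (k.+1 + m)%N - a k = (a (k.+1 + m)%N - a k.+1) + (a k.+1 - a k) by ring.
have h2 : (2 : R) != 0 by [].
have E : 2 * 2^-1 ^+ k * (2 ^+ k * (a k.+1 - a k) ^+ 2 + S) =
    2 * (a k.+1 - a k) ^+ 2 + 2 * (2 * 2^-1 ^+ k.+1 * S).
  rewrite [2^-1 ^+ k.+1]exprS !exprVn; have := expf_neq0 k h2.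
  by move: (2 ^+ k) => q q0; field.
rewrite E; move: HS; set A := _ - a k.+1; set B := a k.+1 - a k.
have := sqr_ge0 (A - B); set W := 2 * _ * S; nra.
Qed.

(** Riesz-Fischer for rapidly Cauchy sequences, with a rate. The function
    $G=\sum_j2^j(u_{j+1}-u_j)^2$ is integrable since $2^j4^{-j}=2^{-j}$; where it is finite the
    sequence converges, and $2\cdot2^{-k}G$ dominates $(u_k-f)^2$. *)
Lemma L2_complete (u : nat -> L2 mu) (C : R) :
  (forall k, `|u k.+1 - u k| ^+ 2 <= C * 4^-1 ^+ k) ->
  exists l, forall k, `|u k - l| ^+ 2 <= 4 * C * 2^-1 ^+ k.
Proof.
move=> uC.
have C0 : 0 <= C by have := uC 0%N; rewrite expr0 mulr1; apply: le_trans; exact: sqr_ge0.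
pose g (j : nat) (x : T) : R := 2 ^+ j * (u j.+1 x - u j x) ^+ 2.
have g0 j x : 0 <= g j x by rewrite mulr_ge0 ?sqr_ge0 ?exprn_ge0.
have mg j : measurable_fun setT (g j).
  by apply: measurable_funM => //; apply: measurable_funX; exact: measurable_funB.
pose G (x : T) : \bar R := (\sum_(j <oo) (g j x)%:E)%E.
have G0 x : (0 <= G x)%E by apply: nneseries_ge0 => j _ _; rewrite lee_fin.
have mG : measurable_fun setT G.
  by apply: ge0_emeasurable_sum => // j; [move=> x _ _; rewrite lee_fin|move=> _; exact/measurable_EFinP].
have intg j : (\int[mu]_x (g j x)%:E <= (C * 2^-1 ^+ j)%:E)%E.
  under eq_integral do rewrite EFinM.
  rewrite ge0_integralZl; [|exact: measurableT|..]; last 3 first.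
  - by apply/measurable_EFinP; apply: measurable_funX; exact: measurable_funB.
  - by move=> x _; rewrite lee_fin sqr_ge0.
  - by rewrite lee_fin exprn_ge0.
  rewrite L2_distE -EFinM lee_fin (le_trans (ler_wpM2l _ (uC j))) ?exprn_ge0//.
  rewrite mulrCA ler_wpM2l// -exprMn (_ : 2 * 4^-1 = 2^-1 :> R)//; by field.
have GC : (\int[mu]_x G x <= (2 * C)%:E)%E.
  rewrite integral_nneseries//; [|by move=> j; exact/measurable_EFinP|by move=> j x _; rewrite lee_fin].
  apply: lime_le.
    by apply: is_cvg_nneseries => j _ _; apply: integral_ge0 => x _; rewrite lee_fin.
  apply: nearW => m; apply: (le_trans (lee_sum _ (fun j _ => intg j))).
  rewrite sumEFin lee_fin -mulr_sumr mulrC ler_wpM2r//.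
  rewrite big_mkord; have : forall m, \sum_(i < m) 2^-1 ^+ i = 2 - 2 * 2^-1 ^+ m :> R.
    elim=> [|j IH]; first by rewrite big_ord0 expr0; ring.
    by rewrite big_ord_recr /= IH exprS; field.
  by move=> ->; rewrite gerBl mulr_ge0// exprn_ge0.
have Gfin : \forall x \ae mu, (G x < +oo)%E.
  have iG : mu.-integrable setT G.
    apply/integrableP; split => //; under eq_integral do rewrite gee0_abs//.
    by apply: le_lt_trans GC _; rewrite ltry.
  by apply: filterS (integrable_ae measurableT iG) => x /(_ I); rewrite ge0_fin_numE.
have bound x k m : (((u (k + m)%N x - u k x) ^+ 2)%:E <= (2 * 2^-1 ^+ k)%:E * G x)%E.
  apply: (@le_trans _ _ ((2 * 2^-1 ^+ k)%:E * (\sum_(k <= j < k + m) g j x)%:E)%E).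
    by rewrite -EFinM lee_fin; exact: (geometric_increments (fun j => u j x)).
  apply: lee_wpmul2l; first by rewrite lee_fin mulr_ge0// exprn_ge0.
  rewrite -sumEFin; apply: (@le_trans _ _ (\sum_(0 <= j < k + m) (g j x)%:E)%E).
    rewrite [leRHS](big_cat_nat (leq0n k) (leq_addr _ _))/= leeDr//.
    by apply: sume_ge0 => j _; rewrite lee_fin.
  by apply: nneseries_lim_ge => j _ _; rewrite lee_fin.
pose A := [set x | (G x < +oo)%E].
have mA : measurable A.
  by rewrite -[A]setTI; apply: emeasurable_fun_infty_o.
(* Cutting off where $G=\infty$ makes the sequence converge at every point, which gives
   measurability of the limit. *)
pose v k x := u k x * \1_A x.
have mv k : measurable_fun setT (v k) by apply: measurable_funM => //; exact: measurable_indic.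
have cvgv x : cvg (v k x @[k --> \oo]).
  have [Ax|nAx] := pselect (A x); last first.
    rewrite (_ : (fun k => v k x) = cst 0); first exact: is_cvg_cst.
    by apply/funext => k; rewrite /v indicE memNset// mulr0.
  pose gx := fine (G x).
  have GE : G x = gx%:E by rewrite fineK// ge0_fin_numE.
  have gx0 : 0 <= gx by rewrite fine_ge0.
  apply/cauchy_cvgP/cauchy_exP => e e0.
  have [k Hk] : exists k, 2 * 2^-1 ^+ k * gx < e ^+ 2.
    have h : (2 * gx * 2^-1 ^+ k @[k --> \oo] --> 2 * gx * 0).
      by apply: cvgM; [exact: cvg_cst|apply: cvg_expr; rewrite gtr0_norm// invf_lt1// ltr1n].
    rewrite mulr0 in h; move/cvgrPdist_lt : h => /(_ _ (exprn_gt0 2 e0)) [k _ hk].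
    exists k; have := hk k (leqnn _); rewrite /= sub0r normrN => /(le_lt_trans (ler_norm _)).
    by congr (_ < _); ring.
  exists (v k x); exists k => // m /= km.
  rewrite -ball_normE /= distrC -ltr_sqr ?nnegrE ?(ltW e0)// real_normK ?num_real//.
  apply: le_lt_trans Hk; rewrite /v indicE mem_set// !mulr1.
  by have := bound x k (m - k)%N; rewrite subnKC// GE -EFinM lee_fin.
pose f x := limn (fun k => v k x).
have fcvg x : v k x @[k --> \oo] --> f x by exact: cvgv.
have mf : measurable_fun setT f.
  exact: (measurable_fun_cvg mv (fun x _ => fcvg x)).
have fbound k : (\int[mu]_x ((u k x - f x) ^+ 2)%:E <= (4 * C * 2^-1 ^+ k)%:E)%E.
  have c0 : 0 <= 2 * 2^-1 ^+ k :> R by rewrite mulr_ge0// exprn_ge0.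
  apply: (@le_trans _ _ (\int[mu]_x ((2 * 2^-1 ^+ k)%:E * G x))%E); last first.
    rewrite ge0_integralZl// (le_trans (lee_wpmul2l _ GC)) ?lee_fin//.
    by rewrite le_eqVlt; apply/orP; left; apply/eqP; ring.
  apply: ae_ge0_le_integral => //.
  - by move=> x _; rewrite lee_fin sqr_ge0.
  - by apply/measurable_EFinP; apply: measurable_funX; exact: measurable_funB.
  - by move=> x _; rewrite mule_ge0.
  - exact: measurable_funeM.
  apply: filterS Gfin => x Gx _.
  have GE : G x = (fine (G x))%:E by rewrite fineK// ge0_fin_numE.
  rewrite GE -EFinM lee_fin.
  have h : (u k x - v m x) ^+ 2 @[m --> \oo] --> (u k x - f x) ^+ 2.
    by apply: (cvgM (cvgB (cvg_cst _) (fcvg x)) (cvgB (cvg_cst _) (fcvg x))).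
  apply: (ler_cvg_to h (cvg_cst _)); exists k => // m /= km.
  rewrite /v indicE mem_set// mulr1 -sqrrN opprB.
  by have := bound x k (m - k)%N; rewrite subnKC// GE -EFinM lee_fin.
have Hf : f \in Lfun mu 2%:E.
  apply: Lfun2P => //.
  apply: (@le_lt_trans _ _ (\int[mu]_x (2%:E * ((u 0%N x - f x) ^+ 2)%:E + 2%:E * ((u 0%N x) ^+ 2)%:E))%E).
    apply: ge0_le_integral => //.
    - by move=> x _; rewrite lee_fin sqr_ge0.
    - by apply/measurable_EFinP; apply: measurable_funX.
    - by apply: emeasurable_funD; apply: measurable_funeM; apply/measurable_EFinP; apply: measurable_funX => //; exact: measurable_funB.
    - move=> x _; rewrite -!EFinM -EFinD lee_fin.
      have := sqr_ge0 (2 * u 0%N x - f x); lra.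
  have sq0 (a : R) : (0 <= (a ^+ 2)%:E)%E by rewrite lee_fin sqr_ge0.
  have mm1 : measurable_fun setT (fun x => ((u 0%N x - f x) ^+ 2)%:E).
    by apply/measurable_EFinP; apply: measurable_funX; exact: measurable_funB.
  have mm2 : measurable_fun setT (fun x => ((u 0%N x) ^+ 2)%:E).
    by apply/measurable_EFinP; apply: measurable_funX.
  rewrite ge0_integralD//; last 4 first.
  - by move=> x _; rewrite mule_ge0.
  - exact: measurable_funeM.
  - by move=> x _; rewrite mule_ge0.
  - exact: measurable_funeM.
  rewrite !ge0_integralZl//= integral_sqr_L2; apply: lte_add_pinfty; last by rewrite -EFinM ltry.
  by apply: lte_mul_pinfty => //; apply: le_lt_trans (fbound 0%N) _; rewrite ltry.
exists (L2_class Hf) => k.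
by rewrite -lee_fin -L2_dist.
Qed.

End L2_complete.

(** * Integrals over the domain and integration by parts *)

Section transfer.
Context {R : realType} {n : nat}.
Local Notation X := 'rV[R]_n.
Local Notation BX := (borel 'rV[R]_n).
Implicit Types (D K : set X) (phi psi chi : X -> R).

Lemma ge0_integral_push_on d (T : measurableType d) (m : {measure set T -> \bar R})
    (j : T -> BX) (mj : measurable_fun setT j) (m' : {measure set BX -> \bar R})
    (D : set BX) (f : BX -> \bar R) :
  measurable D -> m (j @^-1` (~` D)) = 0%E ->
  (forall A, measurable A -> A `<=` D -> m (j @^-1` A) = m' A) ->
  measurable_fun setT f -> (forall x, (0 <= f x)%E) ->
  (\int[m]_x f (j x) = \int[m']_(x in D) f x)%E.
Proof.
move=> mD mD0 mm' mf f0.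
rewrite -[LHS](ge0_integral_pushforward mj m measurableT mf); last by move=> y _; exact: f0.
rewrite -/(push_measure m mj).
rewrite (@ge0_negligible_integral _ _ _ (push_measure m mj) setT (~` D)) //; last first.
  exact: measurableC.
by rewrite setDE setTI setCK; exact: eq_measure_integral.
Qed.

Lemma ge0_integral_volume D (f : BX -> \bar R) : open D -> measurable_fun setT f ->
  (forall x, (0 <= f x)%E) -> (\int[volume D]_x f x = \int[lam n]_(x in D) f x)%E.
Proof.
move=> oD mf f0; have mD := open_borel oD.
apply: (@ge0_integral_push_on _ _ (volume D) _ (@measurable_id_volume _ _ D) (lam n) D f) => //.
  rewrite -[LHS]/(lebesgue_on D (~` D)) lebesgue_onE setICl ?measure0//.
move=> A mA AD; have AE : A `&` D = A by apply/seteqP; split=> [x []//|x Ax]; split=> //; exact: AD.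
by rewrite -[LHS]/(lebesgue_on D A) lebesgue_onE AE.
Qed.

Lemma integral_volume D (f : BX -> \bar R) : open D -> measurable_fun setT f ->
  (\int[volume D]_x f x = \int[lam n]_(x in D) f x)%E.
Proof.
move=> oD mf; rewrite integralE [RHS]integralE !ge0_integral_volume//.
- exact: measurable_funeneg.
- exact: measurable_funepos.
Qed.

Lemma measurable_boundary D : measurable (boundary D : set BX).
Proof.
apply: closed_borel; apply: closedI; first exact: closed_closure.
by apply: open_closedC; exact: open_interior.
Qed.

Lemma ge0_integral_surface D (Dfin : (hausdorff n.-1 (boundary D) < +oo)%E) (f : BX -> \bar R) :
  measurable_fun setT f -> (forall x, (0 <= f x)%E) ->
  (\int[surface D]_x f x = \int[surfB Dfin]_(x in boundary D) f x)%E.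
Proof.
move=> mf f0; have mD := measurable_boundary D.
apply: (@ge0_integral_push_on _ _ (surface D) _ (@measurable_id_surface _ _ D) (surfB Dfin) _ f) => //.
by rewrite -[LHS]/(hausdorff n.-1 (~` boundary D `&` boundary D)) setICl hausdorff0.
Qed.

Lemma compact_continuous_bound K (f : X -> R) : compact K -> continuous f ->
  exists2 M : R, 0 <= M & forall x, K x -> `|f x| <= M.
Proof.
move=> cK cf.
have /compact_bounded[M [Mr HM]] : compact (f @` K).
  by apply: continuous_compact => //; exact: continuous_subspaceT.
exists (`|M| + 1); first by rewrite addr_ge0.
move=> x Kx; apply: (HM (`|M| + 1)); last by exists x.
by rewrite (le_lt_trans (ler_norm _))// ltrDl.
Qed.

Lemma continuous_volume_measurable D (f : X -> R) : continuous f ->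
  measurable_fun setT (f : caratheodory_type [the outer_measure R X of lebesgue_on D] -> R).
Proof.
by move=> cf; apply: (measurableT_comp (continuous_borel_fun cf)); exact: (@measurable_id_volume _ _ D).
Qed.

Lemma continuous_surface_measurable D (f : X -> R) : continuous f ->
  measurable_fun setT (f : caratheodory_type [the outer_measure R X of hausdorff_on n.-1 (boundary D)] -> R).
Proof.
by move=> cf; apply: (measurableT_comp (continuous_borel_fun cf)); exact: (@measurable_id_surface _ _ D).
Qed.

Lemma lam_bounded D : open D -> bounded_set D -> (lam n D < +oo)%E.
Proof.
move=> oD [M [Mr HM]]; have r0 : 0 < `|M| + 2 by rewrite ltr_wpDl.
apply: (@le_lt_trans _ _ (lam n (ball (0%R : X) (`|M| + 2)))); last by rewrite lam_ball// ltry.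
apply: le_measure; rewrite ?inE; [exact: open_borel|apply: open_borel; exact: ball_open|].
move=> x Dx; rewrite -ball_normE /= sub0r normrN.
apply: (@le_lt_trans _ _ (`|M| + 1)); last by rewrite ltrD2l ltr1n.
by apply: HM => //; rewrite (le_lt_trans (ler_norm _))// ltrDl.
Qed.

Lemma volume_L2 D (f : X -> R) : open D -> compact (closure D) -> (lam n D < +oo)%E ->
  continuous f -> (f : caratheodory_type _ -> R) \in Lfun (volume D) 2%:E.
Proof.
move=> oD cD Doo cf; have mf := continuous_borel_fun cf.
have [M M0 HM] := compact_continuous_bound cD cf.
apply: Lfun2P; first exact: continuous_volume_measurable.
have mf2 : measurable_fun setT (fun x : BX => ((f x) ^+ 2)%:E).
  by apply/measurable_EFinP; exact: measurable_funX.
rewrite (ge0_integral_volume oD mf2); last by move=> x; rewrite lee_fin sqr_ge0.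
apply: (@le_lt_trans _ _ (\int[lam n]_(x in D) (M ^+ 2)%:E)%E).
  apply: ge0_le_integral => //.
  - exact: open_borel.
  - by move=> x _; rewrite lee_fin sqr_ge0.
  - exact: measurable_funTS.
  - move=> x Dx; rewrite lee_fin -(real_normK (num_real (f x))) lerXn2r ?nnegrE//.
    by apply: HM; exact: subset_closure.
rewrite integral_cst; last exact: open_borel.
by apply: lte_mul_pinfty; rewrite ?lee_fin ?sqr_ge0.
Qed.

Lemma surface_L2 D (f : X -> R) : (hausdorff n.-1 (boundary D) < +oo)%E -> compact (boundary D) ->
  continuous f -> (f : caratheodory_type _ -> R) \in Lfun (surface D) 2%:E.
Proof.
move=> Dfin cD cf; have mf := continuous_borel_fun cf.
have [M M0 HM] := compact_continuous_bound cD cf.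
apply: Lfun2P; first exact: continuous_surface_measurable.
have mf2 : measurable_fun setT (fun x : BX => ((f x) ^+ 2)%:E).
  by apply/measurable_EFinP; exact: measurable_funX.
rewrite (ge0_integral_surface Dfin mf2); last by move=> x; rewrite lee_fin sqr_ge0.
apply: (@le_lt_trans _ _ (\int[surfB Dfin]_(x in boundary D) (M ^+ 2)%:E)%E).
  apply: ge0_le_integral => //.
  - exact: measurable_boundary.
  - by move=> x _; rewrite lee_fin sqr_ge0.
  - exact: measurable_funTS.
  - move=> x Dx; rewrite lee_fin -(real_normK (num_real (f x))) lerXn2r ?nnegrE//.
    exact: HM.
rewrite integral_cst; last exact: measurable_boundary.
by apply: lte_mul_pinfty; [rewrite lee_fin sqr_ge0| |exact: surfB_fin].
Qed.

Lemma partial_mul (i : 'I_n) phi psi x : C1 phi -> C1 psi ->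
  derivable (phi * psi) x (delta_mx ord0 i) /\
  partial i (phi * psi) x = partial i phi x * psi x + phi x * partial i psi x.
Proof.
move=> [_ dphi _] [_ dpsi _]; split; first exact: derivableM.
by rewrite /partial deriveM// addrC; congr (_ + _); exact: mulrC.
Qed.

Lemma C1_mul phi psi : C1 phi -> C1 psi -> C1 (phi * psi).
Proof.
move=> C1phi C1psi; split.
- have [c1 _ _] := C1phi; have [c2 _ _] := C1psi => x.
  exact: (cvgM (c1 x) (c2 x)).
- by move=> i x; have [] := partial_mul i x C1phi C1psi.
move=> i; rewrite (_ : partial i _ = fun x => partial i phi x * psi x + phi x * partial i psi x).
  have [c1 _ p1] := C1phi; have [c2 _ p2] := C1psi.
  by move=> x; exact: (cvgD (cvgM (p1 i x) (c2 x)) (cvgM (c1 x) (p2 i x))).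
by apply/funext => x; have [] := partial_mul i x C1phi C1psi.
Qed.

Lemma partial_support (i : 'I_n) K phi x : closed K -> (forall x, ~ K x -> phi x = 0) -> ~ K x ->
  partial i phi x = 0.
Proof.
move=> cK phi0 Kx; rewrite /partial (@near_eq_derive _ _ _ phi (cst 0) x); first exact: derive_cst.
have : open (~` K) by exact: closed_openC.
by rewrite openE => /(_ _ Kx); apply: filterS => y; exact: phi0.
Qed.

(** Difference quotients of [chi] integrate to zero by translation invariance, and they converge
    dominatedly to the partial derivative. *)
Lemma integral_partial_eq0 (i : 'I_n) K chi : compact K -> C1 chi ->
  (forall x, ~ K x -> chi x = 0) -> (\int[lam n]_x (partial i chi x)%:E = 0)%E.
Proof.
move=> cK C1chi chi0; have [cchi dchi cpchi] := C1chi; set e := delta_mx ord0 i : X.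
have clK : closed K by apply: compact_closed => //; exact: norm_hausdorff.
have pchi0 := partial_support i clK chi0.
have [M0 M00 HM0] := compact_continuous_bound cK cchi.
have [M M_ge0 HM] := compact_continuous_bound cK (cpchi i).
have {}HM0 x : `|chi x| <= M0 by case: (pselect (K x)) => [/HM0//|/chi0 ->]; rewrite normr0.
have {}HM x : `|partial i chi x| <= M.
  by case: (pselect (K x)) => [/HM//|/pchi0 ->]; rewrite normr0.
have [r r0 Kr] : exists2 r : R, 0 < r & K `<=` ball (0%R : X) r.
  have [B [Br HB]] := compact_bounded cK; exists (`|B| + 2); first by rewrite ltr_wpDl.
  move=> x Kx; rewrite -ball_normE /= sub0r normrN.
  apply: (@le_lt_trans _ _ (`|B| + 1)); last by rewrite ltrD2l ltr1n.
  by apply: HB => //; rewrite (le_lt_trans (ler_norm _))// ltrDl.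
have bfin (s : R) : 0 < s -> (lam n (ball (0%R : X) s) < +oo)%E by move=> s0; rewrite lam_ball// ltry.
have mb (s : R) : measurable (ball (0%R : X) s : set BX) by apply: open_borel; exact: ball_open.
have icst (N s : R) : 0 <= N -> 0 < s -> (lam n).-integrable setT (fun x : BX => (N * \1_(ball (0%R : X) s) x)%:E).
  move=> N0 s0; apply/integrableP; split.
    by apply/measurable_EFinP; apply: measurable_funM => //; exact: measurable_indic.
  under eq_integral => x _ do rewrite gee0_abs ?lee_fin ?mulr_ge0// EFinM.
  rewrite ge0_integralZl//; last by apply/measurable_EFinP; exact: measurable_indic.
  by rewrite integral_indic// setIT; apply: lte_mul_pinfty; rewrite ?lee_fin//; exact: bfin.
have mchi := continuous_borel_fun cchi.
have ichi : (lam n).-integrable setT (EFin \o chi : BX -> \bar R).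
  apply: le_integrable (icst M0 r M00 r0) => //; first exact/measurable_EFinP.
  move=> x _ /=; rewrite lee_fin [leRHS]ger0_norm ?mulr_ge0// indicE.
  case: (pselect (ball (0%R : X) r x)) => [bx|nbx]; first by rewrite mem_set// mulr1.
  by rewrite memNset// mulr0 chi0 ?normr0// => /Kr.
have shiftE (v : X) : (\int[lam n]_x (chi (v + x))%:E = \int[lam n]_x (chi x)%:E)%E /\
    (lam n).-integrable setT (fun x : BX => (chi (v + x))%:E).
  have H (f : BX -> \bar R) : measurable_fun setT f -> (forall x, (0 <= f x)%E) ->
      (\int[lam n]_x f (v + x)%R = \int[lam n]_x f x)%E.
    move=> mf f0; have := integral_lam_affine v ltr01 mf f0.
    rewrite invr1 expr1n mul1e => <-; apply: eq_integral => x _; by rewrite scale1r.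
  have mE : measurable_fun setT (EFin \o chi : BX -> \bar R) by exact/measurable_EFinP.
  split.
    rewrite integralE [RHS]integralE; congr (_ - _)%E.
      by refine (etrans _ (H _ (measurable_funepos mE) (fun x => funepos_ge0 _ x))); apply: eq_integral => x _; rewrite !funeposE.
    by refine (etrans _ (H _ (measurable_funeneg mE) (fun x => funeneg_ge0 _ x))); apply: eq_integral => x _; rewrite !funenegE.
  have mv : measurable_fun setT (fun x : BX => (chi (v + x))%:E).
    apply/measurable_EFinP; apply: (@continuous_borel_fun R n (fun x : X => chi (v + x))) => x.
    apply: (@continuous_comp X X R (fun x : X => v + x) chi x); last exact: cchi.
    exact: (cvgD (cvg_cst _) cvg_id).
  apply/integrableP; split => //.
  rewrite (H (fun x => `|(chi x)%:E|%E)) //; last exact: measurableT_comp.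
  by case/integrableP : ichi.
pose h k : R := k.+1%:R^-1.
have h0 k : 0 < h k by rewrite invr_gt0.
pose F k (x : BX) : \bar R := ((h k)^-1 * (chi (h k *: e + x) - chi x))%:E.
have F0 k : (\int[lam n]_x F k x = 0)%E.
  rewrite /F; under eq_integral do rewrite EFinM EFinB.
  have [E Ei] := shiftE (h k *: e).
  rewrite integralZl//; last exact: integrableB.
  by rewrite integralB// E subee ?mule0//; exact: integrable_fin_num.
have mF k : measurable_fun setT (F k).
  have [_ /integrableP[/measurable_EFinP m1 _]] := shiftE (h k *: e).
  by apply/measurable_EFinP; apply: measurable_funM => //; exact: measurable_funB.
have h1 k : h k <= 1 by rewrite invf_le1// ler1n.
(* The radius $r+1$ of the dominating indicator leaves room for steps of length at most $1$ out of
   the support, which lies in a ball of radius $r$. *)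
have [] := @dominated_convergence _ _ _ (lam n) setT measurableT F (fun x : BX => (partial i chi x)%:E)
    (fun x : BX => (M * \1_(ball (0%R : X) (r + 1)) x)%:E) mF.
- by apply/measurable_EFinP; exact: (continuous_borel_fun (cpchi i)).
- apply: aeW => x _; apply: cvg_EFin; first by apply: nearW.
  have /cvgr_dnbhsP dx := dchi i x.
  by apply: (dx h); split; [move=> k; rewrite gt_eqF|exact: cvg_harmonic].
- by apply: icst => //; rewrite addr_gt0.
- apply: aeW => x k _; rewrite lee_fin.
  have [c cw] := @MVT_line R (fun t => chi (x + t *: e)) (fun t => partial i chi (x + t *: e)) (h k)
    (fun t => is_derive_line (dchi i _)).
  rewrite scale0r addr0 (addrC x) => ->.
  rewrite (mulrC (partial _ _ _)) mulKf ?gt_eqF// indicE.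
  case: (pselect (ball (0%R : X) (r + 1) x)) => [bx|nbx]; first by rewrite mem_set// mulr1.
  rewrite memNset// mulr0 pchi0 ?normr0// => /Kr; rewrite -ball_normE /= sub0r normrN => xr.
  apply: nbx; rewrite -ball_normE /= sub0r normrN.
  rewrite -[x](addrK (c *: e)) (le_lt_trans (ler_normB _ _))// ltr_leD//.
  rewrite normrZ (le_trans (ler_pM _ _ cw (delta_rV_norm i)))// mulr1 gtr0_norm//.
move=> _ _; under eq_cvg do rewrite /= F0.
by move=> /(cvg_lim (@ereal_hausdorff R)) <-; rewrite lim_cst.
Qed.

End transfer.

(** * The Neumann problem in abstract form *)

Lemma dotDr d (T : measurableType d) (R : realType) (mu : {measure set T -> \bar R}) (f g h : L2 mu) :
  dot_L2 f (g + h) = dot_L2 f g + dot_L2 f h.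
Proof. by rewrite dotC dotDl !(dotC f). Qed.

Lemma dotZr d (T : measurableType d) (R : realType) (mu : {measure set T -> \bar R}) a (f g : L2 mu) :
  dot_L2 f (a *: g) = a * dot_L2 f g.
Proof. by rewrite dotC dotZl dotC. Qed.

Lemma dotNl d (T : measurableType d) (R : realType) (mu : {measure set T -> \bar R}) (f g : L2 mu) :
  dot_L2 (- f) g = - dot_L2 f g.
Proof. by rewrite -[- f]scaleN1r dotZl mulN1r. Qed.

(** Two approximate solutions, tested against their difference, differ in energy [B] by at most
    their common accuracy: $B^2\le4qB$. *)
Lemma energy_gap (R : realFieldType) (b1 b0 l B q : R) : 0 <= q -> 0 <= B -> B = b1 - b0 ->
  (b1 - l) ^+ 2 <= q * B -> (b0 - l) ^+ 2 <= q * B -> B <= 4 * q.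
Proof.
move=> q0 B0 BE h1 h2; have hB : B ^+ 2 <= 4 * q * B.
  by rewrite {1}BE; have := sqr_ge0 ((b1 - l) + (b0 - l)); nra.
move: B0; rewrite le_eqVlt => /predU1P[<-|B0]; first exact: mulr_ge0.
by rewrite -(ler_pM2r B0) -expr2.
Qed.

Lemma cvgR_unique (R : realType) (u : nat -> R) (x y : R) :
  u k @[k --> \oo] --> x -> u k @[k --> \oo] --> y -> x = y.
Proof. by move=> h1 h2; rewrite -(cvg_lim (@Rhausdorff R) h1) (cvg_lim (@Rhausdorff R) h2). Qed.

Section abstract_neumann.
Context {R : realType} d (T : measurableType d) (mu : {measure set T -> \bar R}).
Context d' (T' : measurableType d') (nu : {measure set T' -> \bar R}) {E : lmodType R} {n : nat}.
Variables (V : E -> L2 mu) (G : 'I_n -> E -> L2 mu) (B : E -> L2 nu) (one : E).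
Hypotheses (V_lin : forall a x y, V (a *: x + y) = a *: V x + V y)
  (G_lin : forall i a x y, G i (a *: x + y) = a *: G i x + G i y)
  (B_lin : forall a x y, B (a *: x + y) = a *: B x + B y)
  (G_one : forall i, G i one = 0) (B_one : 0 < dot_L2 (B one) (B one)).

Definition gsq (x : E) : R := \sum_i `|G i x| ^+ 2.

Hypothesis poincare : exists2 C : R, 0 <= C & forall x (e : R), 0 < e -> exists c,
  `|V (x - c *: one)| ^+ 2 <= C * (gsq x + e) /\ `|B (x - c *: one)| ^+ 2 <= C * (gsq x + e).

Definition norm1 (F : 'I_n -> L2 mu) : R := \sum_i `|F i|.

Lemma norm1_ge0 F : 0 <= norm1 F.
Proof. exact: sumr_ge0. Qed.

Lemma sum_sqr_le_norm1 (F : 'I_n -> L2 mu) : \sum_i `|F i| ^+ 2 <= norm1 F ^+ 2.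
Proof.
rewrite expr2 {1}/norm1 mulr_suml; apply: ler_sum => i _; rewrite expr2.
by apply: ler_wpM2l => //; rewrite /norm1 (bigD1 i)//= lerDl sumr_ge0.
Qed.

Lemma norm1_sqr_le (F : 'I_n -> L2 mu) : norm1 F ^+ 2 <= n%:R * \sum_i `|F i| ^+ 2.
Proof.
have H : forall i j, `|F i| * `|F j| <= 2^-1 * (`|F i| ^+ 2 + `|F j| ^+ 2).
  by move=> i j; have := sqr_ge0 (`|F i| - `|F j|); lra.
rewrite expr2 /norm1 mulr_suml.
apply: (@le_trans _ _ (\sum_i \sum_j 2^-1 * (`|F i| ^+ 2 + `|F j| ^+ 2))).
  by apply: ler_sum => i _; rewrite mulr_sumr; apply: ler_sum => j _; exact: H.
under eq_bigr => i _ do rewrite -mulr_sumr big_split /= sumr_const card_ord.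
rewrite -mulr_sumr big_split /= sumr_const card_ord sumrMnl; move: (\sum_i _) => q.
by rewrite mulr_natl; move: (q *+ n) => z; lra.
Qed.

Lemma lim_eps (A K g : R) : 0 <= K -> (forall e, 0 < e -> A <= K * (g + e)) -> A <= K * g.
Proof.
move=> K0 H; apply/ler_addgt0Pr => e e0; have K1 : 0 < K + 1 by rewrite ltr_wpDl.
apply: (le_trans (H (e / (K + 1)) (divr_gt0 e0 K1))); rewrite mulrDr lerD2l mulrCA.
by rewrite ger_pMr// ler_pdivrMr// mul1r lerDl.
Qed.

Let dG i x y : G i (x - y) = G i x - G i y.
Proof. by rewrite addrC -scaleN1r G_lin scaleN1r addrC. Qed.
Let dB x y : B (x - y) = B x - B y.
Proof. by rewrite addrC -scaleN1r B_lin scaleN1r addrC. Qed.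
Let dV x y : V (x - y) = V x - V y.
Proof. by rewrite addrC -scaleN1r V_lin scaleN1r addrC. Qed.
Let G0 i : G i 0 = 0. Proof. by have := dG i 0 0; rewrite !subrr. Qed.
Let B0 : B 0 = 0. Proof. by have := dB 0 0; rewrite !subrr. Qed.
Let V0 : V 0 = 0. Proof. by have := dV 0 0; rewrite !subrr. Qed.
Let GZ i a x : G i (a *: x) = a *: G i x.
Proof. by rewrite -[a *: x]addr0 G_lin G0 addr0. Qed.
Let BZ a x : B (a *: x) = a *: B x.
Proof. by rewrite -[a *: x]addr0 B_lin B0 addr0. Qed.
Let VZ a x : V (a *: x) = a *: V x.
Proof. by rewrite -[a *: x]addr0 V_lin V0 addr0. Qed.

Lemma gsq_ge0 x : 0 <= gsq x.
Proof. by apply: sumr_ge0 => i _; exact: sqr_ge0. Qed.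

Lemma gsq_shift x c : gsq (x - c *: one) = gsq x.
Proof. by apply: eq_bigr => i _; rewrite dG GZ G_one scaler0 subr0. Qed.

Lemma sqr_normD_le (W : normedModType R) (u v : W) :
  `|u + v| ^+ 2 <= 2 * (`|u| ^+ 2 + `|v| ^+ 2).
Proof.
apply: (@le_trans _ _ ((`|u| + `|v|) ^+ 2)).
  by rewrite lerXn2r ?nnegrE ?addr_ge0// ler_normD.
by have := sqr_ge0 (`|u| - `|v|); lra.
Qed.

(** If the trace is orthogonal to constants, then $|B(x-c\cdot1)|^2=|Bx|^2+c^2S$ with $S=|B1|^2$, so
    [poincare] bounds the shift $c$ as well. The slack $e$ disappears in the limit. *)
Lemma poincare_mean0 : exists2 C : R, 0 <= C & forall x, dot_L2 (B x) (B one) = 0 ->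
  `|V x| ^+ 2 <= C * gsq x /\ `|B x| ^+ 2 <= C * gsq x.
Proof.
have [C C0 HC] := poincare; pose S := dot_L2 (B one) (B one).
have S0 : 0 < S by [].
have SE : `|B one| ^+ 2 = S by rewrite -dot_norm.
pose C1 := 2 * (C + C / S * `|V one| ^+ 2) + C.
have CS : 0 <= C / S by rewrite divr_ge0 ?(ltW S0).
have C10 : 0 <= C1 by rewrite addr_ge0// mulr_ge0// addr_ge0// mulr_ge0 ?sqr_ge0.
exists C1 => // x x0.
suff H e : 0 < e -> `|V x| ^+ 2 <= C1 * (gsq x + e) /\ `|B x| ^+ 2 <= C1 * (gsq x + e).
  by split; apply: lim_eps => // e /H[].
move=> e0; have [c [HV HB]] := HC x e e0.
have g0 : 0 <= gsq x + e by rewrite addr_ge0 ?gsq_ge0 ?(ltW e0).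
have BE : `|B (x - c *: one)| ^+ 2 = `|B x| ^+ 2 + c ^+ 2 * S.
  rewrite -!dot_norm dB BZ -scaleNr !(dotDl, dotDr, dotZl, dotZr) (dotC (B one) (B x)) x0 -/S.
  by ring.
rewrite BE in HB; have c2 : c ^+ 2 <= C / S * (gsq x + e).
  rewrite mulrAC ler_pdivlMr//; apply: le_trans HB; rewrite lerDr; exact: sqr_ge0.
have Bx0 : 0 <= c ^+ 2 * S by rewrite mulr_ge0 ?sqr_ge0 ?(ltW S0).
split.
  have -> : V x = V (x - c *: one) + c *: V one by rewrite dV VZ subrK.
  apply: (le_trans (sqr_normD_le _ _)); rewrite normrZ exprMn real_normK ?num_real//.
  have h := ler_wpM2r (sqr_ge0 `|V one|) c2.
  apply: (@le_trans _ _ (2 * (C * (gsq x + e) + C / S * (gsq x + e) * `|V one| ^+ 2))).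
    by rewrite ler_wpM2l// lerD.
  rewrite (_ : C1 * _ = 2 * (C * (gsq x + e) + C / S * (gsq x + e) * `|V one| ^+ 2) + C * (gsq x + e)); last first.
    by rewrite /C1; ring.
  by rewrite lerDl mulr_ge0.
apply: (@le_trans _ _ (C * (gsq x + e))).
  by apply: le_trans HB; rewrite lerDl.
rewrite ler_wpM2r// /C1 lerDr mulr_ge0// addr_ge0// mulr_ge0 ?sqr_ge0//.
Qed.

(** The closure of the pairs (gradient, trace) of smooth functions. The function itself is left out,
    since the energy and the boundary pairing do not see it. *)
Definition in_graph (F : 'I_n -> L2 mu) (t : L2 nu) := exists x : nat -> E,
  (forall i, G i (x k) @[k --> \oo] --> F i) /\ B (x k) @[k --> \oo] --> t.

Lemma dot_cvg dd (TT : measurableType dd) (m : {measure set TT -> \bar R}) (f t : L2 m) (u : nat -> L2 m) :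
  u k @[k --> \oo] --> t -> dot_L2 f (u k) @[k --> \oo] --> dot_L2 f t.
Proof.
move=> ut; apply/cvgrPdist_le => e e0.
have f1 : 0 < `|f| + 1 by rewrite ltr_wpDl.
move/cvgrPdist_le : ut => /(_ _ (divr_gt0 e0 f1)); apply: filterS => k Hk.
have -> : dot_L2 f t - dot_L2 f (u k) = dot_L2 (t - u k) f.
  by rewrite dotDl dotNl !(dotC _ f).
apply: (le_trans (dot_bound _ _)); apply: (le_trans (ler_wpM2r (normr_ge0 _) Hk)).
by rewrite mulrAC ler_pdivrMr// ler_wpM2l ?(ltW e0)// lerDl.
Qed.

Definition gform (s : T -> R) (F H : 'I_n -> L2 mu) : R := \sum_i wform s (F i) (H i).

Lemma in_graph_sub F t F' t' : in_graph F t -> in_graph F' t' ->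
  in_graph (fun i => F i - F' i) (t - t').
Proof.
move=> [x [xF xt]] [y [yF yt]]; exists (fun k => x k - y k); split=> [i|].
  by under eq_cvg do rewrite dG; apply: cvgB.
by under eq_cvg do rewrite dB; apply: cvgB.
Qed.

Lemma graph_bound : exists2 C : R, 0 <= C & forall F t, in_graph F t ->
  dot_L2 t (B one) = 0 -> `|t| ^+ 2 <= C * \sum_i `|F i| ^+ 2.
Proof.
have [C C0 HC] := poincare_mean0; exists C => // F t [x [xF xt]] t0.
pose S := dot_L2 (B one) (B one); have S0 : S != 0 by exact: lt0r_neq0.
(* Subtracting the boundary mean does not change the gradients, and the means tend to zero because
   [t] has mean zero. *)
pose y k := x k - (dot_L2 (B one) (B (x k)) / S) *: one.
have yt : B (y k) @[k --> \oo] --> t.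
  rewrite -[X in _ --> X]subr0 -(scale0r (B one)) -(mul0r S^-1) -t0 (dotC t).
  under eq_cvg do rewrite /y dB BZ.
  by apply: cvgB => //; apply: cvgZr_tmp; apply: cvgMr_tmp; exact: dot_cvg.
have y0 k : dot_L2 (B (y k)) (B one) = 0.
  by rewrite /y dB BZ -scaleNr dotDl dotZl -/S mulNr divfK// dotC subrr.
have h1 : `|B (y k)| ^+ 2 @[k --> \oo] --> `|t| ^+ 2.
  by rewrite expr2; under eq_cvg do rewrite expr2; apply: cvgM; exact: cvg_norm.
have h2 : C * gsq (x k) @[k --> \oo] --> C * \sum_i `|F i| ^+ 2.
  apply: cvgMl_tmp; apply: (cvg_sum_fin (FF := eventually_filter) (f := fun i k => `|G i (x k)| ^+ 2)) => i.
  by rewrite expr2; under eq_cvg do rewrite expr2; apply: cvgM; apply: cvg_norm; exact: xF.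
apply: (ler_cvg_to h1 h2); apply: nearW => k; rewrite -(gsq_shift (x k) (dot_L2 (B one) (B (x k)) / S)).
exact: (HC _ (y0 k)).2.
Qed.

Section bounded_weight.
Variables (s : T -> R) (M : R).
Hypotheses (ms : measurable_fun setT s) (sM : \forall x \ae mu, `|s x| <= M) (M0 : 0 <= M).

Lemma gformC F H : gform s F H = gform s H F.
Proof. by apply: eq_bigr => i _; exact: wformC. Qed.

Lemma gformDl F1 F2 H : gform s (fun i => F1 i + F2 i) H = gform s F1 H + gform s F2 H.
Proof. by rewrite -big_split; apply: eq_bigr => i _; exact: (wformDl ms sM M0). Qed.

Lemma gformZl a F H : gform s (fun i => a *: F i) H = a * gform s F H.
Proof. by rewrite mulr_sumr; apply: eq_bigr => i _; exact: (wformZl ms sM M0). Qed.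

Lemma gformBl F1 F2 H : gform s (fun i => F1 i - F2 i) H = gform s F1 H - gform s F2 H.
Proof.
rewrite (_ : (fun i => F1 i - F2 i) = fun i => F1 i + (-1) *: F2 i).
  by rewrite gformDl gformZl mulN1r.
by apply/funext => i; rewrite scaleN1r.
Qed.

Lemma gform_bound F H : `|gform s F H| <= M * (norm1 F * norm1 H).
Proof.
apply: (le_trans (ler_norm_sum _ _ _)); rewrite {1}/norm1 mulr_suml mulr_sumr.
apply: ler_sum => i _; apply: (le_trans (wform_bound ms sM M0 _ _)).
by do 2 apply: ler_wpM2l => //; rewrite /norm1 (bigD1 i)//= lerDl sumr_ge0.
Qed.

Lemma gform_cvg F H (u : nat -> 'I_n -> L2 mu) : (forall i, u k i @[k --> \oo] --> H i) ->
  gform s F (u k) @[k --> \oo] --> gform s F H.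
Proof.
move=> uH; have nu0 : norm1 (fun i => H i - u k i) @[k --> \oo] --> (0 : R).
  rewrite (_ : 0 = \sum_(i < n) (0 : R)); last by rewrite big1.
  apply: (cvg_sum_fin (FF := eventually_filter) (f := fun i k => `|H i - u k i|)) => i.
  by rewrite -[X in _ --> X](normr0 (L2 mu)) -(subrr (H i)); apply: cvg_norm; apply: cvgB => //; exact: cvg_cst.
apply/cvgrPdist_le => e e0; have K0 : 0 < M * norm1 F + 1 by rewrite ltr_wpDl ?mulr_ge0 ?norm1_ge0.
move/cvgrPdist_le : nu0 => /(_ _ (divr_gt0 e0 K0)); apply: filterS => k.
rewrite sub0r normrN ger0_norm ?norm1_ge0// => Hk.
rewrite !(gformC F) -gformBl gformC; apply: (le_trans (gform_bound _ _)).
rewrite mulrA (le_trans (ler_wpM2l _ Hk))// ?mulr_ge0 ?norm1_ge0//.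
by rewrite mulrCA ger_pMr// ler_pdivrMr// mul1r lerDl.
Qed.

Variable a : R.
Hypotheses (a0 : 0 < a) (sa : forall f : L2 mu, a * `|f| ^+ 2 <= wform s f f).

Lemma gform_coercive F : a * \sum_i `|F i| ^+ 2 <= gform s F F.
Proof. by rewrite mulr_sumr; apply: ler_sum => i _. Qed.

(** The weak equation is tested against smooth functions only; [solves_pair] extends it to the
    closure. *)
Definition solves (f : L2 nu) (F : 'I_n -> L2 mu) (t : L2 nu) :=
  [/\ in_graph F t, dot_L2 t (B one) = 0 & forall y, gform s F (G^~ y) = dot_L2 f (B y)].

Let b x y := gform s (G^~ x) (G^~ y).
Let bDl x y z : b (x + y) z = b x z + b y z.
Proof.
rewrite /b (_ : G^~ (x + y) = fun i => G i x + G i y) ?gformDl//.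
by apply/funext => i; rewrite -[x in LHS]scale1r G_lin scale1r.
Qed.
Let bZl c x z : b (c *: x) z = c * b x z.
Proof.
by rewrite /b (_ : G^~ (c *: x) = fun i => c *: G i x) ?gformZl//; apply/funext => i; rewrite GZ.
Qed.
Let bC x y : b x y = b y x. Proof. exact: gformC. Qed.
Let b_coer x : a * gsq x <= b x x. Proof. exact: gform_coercive. Qed.
Let b0 x : 0 <= b x x.
Proof. by apply: le_trans (b_coer x); rewrite mulr_ge0 ?gsq_ge0 ?(ltW a0). Qed.

Lemma functional_bound (f : L2 nu) : dot_L2 f (B one) = 0 ->
  exists2 K : R, 0 <= K & forall x, dot_L2 f (B x) ^+ 2 <= K * b x x.
Proof.
move=> f0; have [C C0 HC] := poincare.
have K0 : 0 <= `|f| ^+ 2 * C by rewrite mulr_ge0 ?sqr_ge0.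
exists (`|f| ^+ 2 * C / a); first by rewrite divr_ge0 ?(ltW a0).
move=> x; apply: (@le_trans _ _ (`|f| ^+ 2 * C * gsq x)); last first.
  by rewrite -(mulrA _ a^-1) ler_wpM2l// mulrC ler_pdivlMr// mulrC.
apply: lim_eps => // e e0; have [c [_ HB]] := HC x e e0.
have -> : dot_L2 f (B x) = dot_L2 f (B (x - c *: one)).
  by rewrite dB BZ -scaleNr dotDr dotZr f0 mulr0 addr0.
rewrite -(real_normK (num_real _)).
apply: (@le_trans _ _ ((`|f| * `|B (x - c *: one)|) ^+ 2)).
  by rewrite lerXn2r ?nnegrE ?mulr_ge0// dot_bound.
by rewrite exprMn -[leRHS]mulrA ler_wpM2l ?sqr_ge0.
Qed.

Lemma geometric_cvg (W : normedModType R) (u : nat -> W) (l : W) (C : R) :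
  (forall k, `|u k - l| ^+ 2 <= C * 2^-1 ^+ k) -> u k @[k --> \oo] --> l.
Proof.
move=> H; apply/cvgrPdist_le => e e0.
have h : (C * 2^-1 ^+ k @[k --> \oo] --> C * 0).
  by apply: cvgM; [exact: cvg_cst|apply: cvg_expr; rewrite gtr0_norm// invf_lt1// ltr1n].
rewrite mulr0 in h; move/cvgrPdist_le : h => /(_ _ (exprn_gt0 2 e0)); apply: filterS => k.
rewrite sub0r normrN => /(le_trans (ler_norm _)) /(le_trans (H k)).
by rewrite ler_sqr ?nnegrE ?(ltW e0)// distrC.
Qed.

(** [riesz_approx] provides approximate solutions among smooth functions with error $4^{-k}$. By
    [energy_gap] and coercivity their increments decay geometrically, after normalization by
    [poincare_mean0] also in value and trace, so [L2_complete] yields limits. *)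
Lemma neumann_exists (f : L2 nu) : dot_L2 f (B one) = 0 ->
  exists (u : L2 mu) (F : 'I_n -> L2 mu) (t : L2 nu) (x : nat -> E),
  [/\ V (x k) @[k --> \oo] --> u, forall i, G i (x k) @[k --> \oo] --> F i,
      B (x k) @[k --> \oo] --> t & solves f F t].
Proof.
move=> f0; have [K K0 HK] := functional_bound f0.
have e0 k : 0 < 4^-1 ^+ k :> R by rewrite exprn_gt0.
have lD x y : dot_L2 f (B (x + y)) = dot_L2 f (B x) + dot_L2 f (B y).
  by rewrite -[x in LHS]scale1r B_lin scale1r dotDr.
have lZ c x : dot_L2 f (B (c *: x)) = c * dot_L2 f (B x) by rewrite BZ dotZr.
pose P k x := forall y, (b x y - dot_L2 f (B y)) ^+ 2 <= 4^-1 ^+ k * b y y.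
have ex k : exists x, P k x := riesz_approx bDl bZl bC b0 lD lZ HK K0 (e0 k).
pose x0 k := projT1 (cid (ex k)); have Hx0 k : P k (x0 k) := projT2 (cid (ex k)).
pose S := dot_L2 (B one) (B one).
(* Normalizing the boundary mean leaves the gradient, hence the property [P k], unchanged. *)
pose x k := x0 k - (dot_L2 (B (x0 k)) (B one) / S) *: one.
have Hx k : P k (x k).
  move=> y; rewrite (_ : b (x k) y = b (x0 k) y); first exact: Hx0.
  by apply: eq_bigr => i _; rewrite /x dG GZ G_one scaler0 subr0.
have mx k : dot_L2 (B (x k)) (B one) = 0.
  rewrite /x dB BZ -scaleNr dotDl dotZl -/S mulNr divfK ?subrr//; exact: lt0r_neq0.
have mdx k : dot_L2 (B (x k.+1 - x k)) (B one) = 0.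
  by rewrite dB dotDl dotNl !mx subr0.
have bBl u v z : b (u - v) z = b u z - b v z by rewrite bDl (form_Nl bZl).
have bd k : b (x k.+1 - x k) (x k.+1 - x k) <= 4 * 4^-1 ^+ k.
  have h1 := Hx k.+1 (x k.+1 - x k); have h2 := Hx k (x k.+1 - x k).
  apply: (energy_gap _ (b0 _) (bBl _ _ _) _ h2); first exact: ltW.
  apply: (le_trans h1); apply: ler_wpM2r; first exact: b0.
  by rewrite exprS ger_pMl ?e0// invf_le1// ler1n.
have gd k : gsq (x k.+1 - x k) <= 4 / a * 4^-1 ^+ k.
  by rewrite mulrAC ler_pdivlMr// mulrC (le_trans (b_coer _)).
have [C C0 HC] := poincare_mean0.
have Vd k : `|V (x k.+1) - V (x k)| ^+ 2 <= C * (4 / a) * 4^-1 ^+ k.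
  by rewrite -dV -mulrA (le_trans (proj1 (HC _ (mdx k))))// ler_wpM2l.
have Bd k : `|B (x k.+1) - B (x k)| ^+ 2 <= C * (4 / a) * 4^-1 ^+ k.
  by rewrite -dB -mulrA (le_trans (proj2 (HC _ (mdx k))))// ler_wpM2l.
have Gd i k : `|G i (x k.+1) - G i (x k)| ^+ 2 <= 4 / a * 4^-1 ^+ k.
  rewrite -dG (le_trans _ (gd k))// /gsq (bigD1 i)//= lerDl sumr_ge0// => j _; exact: sqr_ge0.
have [u Hu] := L2_complete Vd; have [t Ht] := L2_complete Bd.
have HF i := L2_complete (Gd i).
pose F i := projT1 (cid (HF i)); have HF' i := projT2 (cid (HF i)).
have cF i : G i (x k) @[k --> \oo] --> F i := geometric_cvg (HF' i).
have ct : B (x k) @[k --> \oo] --> t := geometric_cvg Ht.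
exists u, F, t, x; split=> //; first exact: geometric_cvg Hu.
split; first by exists x.
- rewrite dotC; apply: (cvgR_unique (dot_cvg (f := B one) ct)).
  by rewrite (_ : (fun k => _) = fun=> 0); [exact: cvg_cst|apply/funext => k; rewrite dotC mx].
move=> y; have := gform_cvg (F := G^~ y) cF; rewrite (gformC _ F) => c1.
have c2 : gform s (G^~ y) (G^~ (x k)) @[k --> \oo] --> dot_L2 f (B y).
  apply: (@geometric_cvg R^o _ _ (b y y)) => k; rewrite gformC -/(b _ _).
  rewrite real_normK ?num_real// (le_trans (Hx k y))// mulrC ler_wpM2l//.
  by rewrite lerXn2r ?nnegrE// lef_pV2 ?posrE// ler_nat.
exact: (cvgR_unique c1 c2).
Qed.

Lemma solves_pair f F t F' t' : solves f F t -> in_graph F' t' -> gform s F F' = dot_L2 f t'.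
Proof.
move=> [_ _ H] [x [xF xt]]; apply: (cvgR_unique (gform_cvg (F := F) xF)).
by under eq_cvg do rewrite H; exact: dot_cvg.
Qed.

(** Each solution is an admissible test for the other, and the form is symmetric. *)
Lemma solves_sym f F t g H r : solves f F t -> solves g H r -> dot_L2 g t = dot_L2 f r.
Proof.
move=> fF gH; have [Ft _ _] := fF; have [Hr _ _] := gH.
by rewrite -(solves_pair gH Ft) gformC (solves_pair fF Hr).
Qed.

(** The difference has zero energy, hence zero gradient by coercivity and zero trace by
    [graph_bound]. *)
Lemma solves_unique f F t F' t' : solves f F t -> solves f F' t' -> t = t'.
Proof.
move=> h h'; have [Ft t0 _] := h; have [Ft' t'0 _] := h'.
have [C C0 HC] := graph_bound.
have e : gform s (fun i => F i - F' i) (fun i => F i - F' i) = 0.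
  rewrite gformBl !(gformC _ (fun i => F i - F' i)) !gformBl (gformC F' F).
  by rewrite (solves_pair h Ft) (solves_pair h Ft') (solves_pair h' Ft') (solves_sym h h') !subrr.
have := gform_coercive (fun i => F i - F' i); rewrite e pmulr_rle0// => e'.
have mm : dot_L2 (t - t') (B one) = 0 by rewrite dotDl dotNl t0 t'0 subr0.
have := HC _ _ (in_graph_sub Ft Ft') mm => /le_trans/(_ (ler_wpM2l C0 e')).
rewrite mulr0 => h0; apply/eqP; rewrite -subr_eq0 -normr_eq0 -sqrf_eq0 eq_le h0/=.
exact: sqr_ge0.
Qed.

End bounded_weight.

(** $a\sum|F_i|^2\le\langle f,t\rangle\le|f||t|$, and [graph_bound] bounds $|t|$ by the gradient.
    The constant depends on the Poincare constant and on $n$, not on the weight, which gives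
    uniformity in the conductivity. *)
Lemma solves_bound : exists2 K : R, 0 <= K & forall (s : T -> R) (M a : R), measurable_fun setT s ->
  (\forall x \ae mu, `|s x| <= M) -> 0 <= M -> 0 < a ->
  (forall f : L2 mu, a * `|f| ^+ 2 <= wform s f f) ->
  forall f F t, solves s f F t -> norm1 F <= K * `|f| / a.
Proof.
have [C C0 HC] := graph_bound; have K0 : 0 <= n%:R * C by rewrite mulr_ge0.
exists (n%:R * C + 1); first by rewrite addr_ge0.
move=> s M a ms sM M0 a0 sa f F t fF; have [Ft t0 _] := fF.
rewrite ler_pdivlMr// -ler_sqr ?nnegrE ?mulr_ge0 ?norm1_ge0 ?addr_ge0 ?(ltW a0)//.
pose q := \sum_i `|F i| ^+ 2; have q0 : 0 <= q by apply: sumr_ge0 => i _; exact: sqr_ge0.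
have h1 : a * q <= `|f| * `|t|.
  apply: (le_trans (gform_coercive sa F)); rewrite (solves_pair ms sM M0 fF Ft).
  exact: (le_trans (ler_norm _) (dot_bound _ _)).
have h2 : `|t| ^+ 2 <= C * q := HC _ _ Ft t0.
have h3 : (a * q) ^+ 2 <= `|f| ^+ 2 * (C * q).
  apply: (@le_trans _ _ ((`|f| * `|t|) ^+ 2)).
    by rewrite ler_sqr ?nnegrE ?mulr_ge0 ?(ltW a0).
  by rewrite exprMn ler_wpM2l ?sqr_ge0.
have h4 : a ^+ 2 * q <= `|f| ^+ 2 * C.
  move: q0; rewrite le_eqVlt => /predU1P[<-|q0]; first by rewrite mulr0 mulr_ge0 ?sqr_ge0.
  by rewrite -(ler_pM2r q0); move: h3; rewrite exprMn (expr2 q) !mulrA.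
rewrite !exprMn; apply: (@le_trans _ _ (n%:R * C * `|f| ^+ 2)).
  apply: (le_trans (ler_wpM2r (sqr_ge0 _) (norm1_sqr_le F))).
  rewrite -/q -mulrA -(mulrA n%:R) ler_wpM2l// mulrC (le_trans h4)// mulrC//.
rewrite ler_wpM2r ?sqr_ge0//; move: K0; set k := n%:R * C => k0; nra.
Qed.

Lemma wformBs (s1 s2 : T -> R) (M1 M2 : R) (f g : L2 mu) : measurable_fun setT s1 -> measurable_fun setT s2 ->
  (\forall x \ae mu, `|s1 x| <= M1) -> (\forall x \ae mu, `|s2 x| <= M2) -> 0 <= M1 -> 0 <= M2 ->
  wform (fun x => s2 x - s1 x) f g = wform s2 f g - wform s1 f g.
Proof.
move=> m1 m2 b1 b2 M10 M20; rewrite /wform -RintegralB//.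
- by apply: eq_Rintegral => x _; rewrite mulrBl.
- exact: (integrable_wform m2 b2).
- exact: (integrable_wform m1 b1).
Qed.

(** Both pairings are rewritten as energies of $F_1$ against the solution $H$ for $s_2$ with datum
    $g$; their difference is $\int(s_2-s_1)F_1\cdot H$ up to sign. *)
Lemma solves_diff (s1 s2 : T -> R) (M1 M2 e : R) f F1 t1 F2 t2 g H r :
  measurable_fun setT s1 -> measurable_fun setT s2 ->
  (\forall x \ae mu, `|s1 x| <= M1) -> (\forall x \ae mu, `|s2 x| <= M2) -> 0 <= M1 -> 0 <= M2 ->
  (\forall x \ae mu, `|s2 x - s1 x| <= e) -> 0 <= e ->
  solves s1 f F1 t1 -> solves s2 f F2 t2 -> solves s2 g H r ->
  `|dot_L2 g t1 - dot_L2 g t2| <= e * (norm1 F1 * norm1 H).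
Proof.
move=> m1 m2 b1 b2 M10 M20 be e0 h1 h2 hg; have [G1 _ _] := h1; have [Gg _ _] := hg.
rewrite -(solves_pair m2 b2 M20 hg G1) (solves_sym m2 b2 M20 h2 hg).
rewrite -(solves_pair m1 b1 M10 h1 Gg) (gformC s2).
rewrite (_ : _ - _ = gform (fun x => s2 x - s1 x) F1 H); last first.
  by rewrite -sumrB; apply: eq_bigr => i _; rewrite (wformBs _ _ m1 m2 b1 b2).
by apply: (gform_bound _ be e0); exact: measurable_funB.
Qed.

End abstract_neumann.

(** * Conductivities as weights, and $L^2$ classes of functions *)

Section Linfty_weights.
Context d (T : measurableType d) (R : realType).
Variable mu : {measure set T -> \bar R}.
Implicit Types s t : Linfty mu.

Lemma Linfty_ae s : \forall x \ae mu, `|s x| <= `|s|.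
Proof.
have E : ('N[mu]_+oo[EFin \o s] = (`|s|)%:E)%E.
  by rewrite [in RHS]/Num.norm /= /Lp_norm finite_norm_fine.
(* The $L^\infty$ norm is an essential supremum only when the measure is nonzero; for the zero
   measure every bound holds almost everywhere. *)
rewrite unlock /= in E; case: ifPn E => [mu0 E|mu0 _]; last first.
  exists setT; split=> //; apply/eqP; rewrite eq_le measure_ge0 andbT.
  by rewrite leNgt.
have /ess_supP : (ess_sup mu (abse \o (EFin \o s)) <= (`|s|)%:E)%E by rewrite E.
by apply: filterS => x /=; rewrite lee_fin.
Qed.

Lemma Lp_reprB p (p1 : (1 <= p)%E) (s t : Lp mu p1) :
  \forall x \ae mu, Lp_repr (s - t) x = Lp_repr s x - Lp_repr t x.
Proof.
apply: filterS2 (Lp_reprD s (- t)) (Lp_reprZ (- 1) t) => x -> h.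
by rewrite scaleN1r in h; rewrite h mulN1r.
Qed.

Lemma Linfty_dist s t : \forall x \ae mu, `|s x - t x| <= `|s - t|.
Proof. by apply: filterS2 (Linfty_ae (s - t)) (Lp_reprB s t) => x h <-. Qed.

Lemma Linfty_coercive s (a : R) : (a%:E <= ess_inf mu (EFin \o s))%E ->
  0 <= a -> forall f : L2 mu, a * `|f| ^+ 2 <= wform s f f.
Proof.
move=> /ess_infP sa a0 f.
have ca : \forall x \ae mu, `|(cst a : T -> R) x| <= a by apply: aeW => x; rewrite ger0_norm.
have mc : measurable_fun setT (cst a : T -> R) by exact: measurable_cst.
have ms : measurable_fun setT (s : T -> R) by [].
have -> : a * `|f| ^+ 2 = wform (cst a) f f.
  rewrite -dot_norm dotE /wform -RintegralZl//.
    by apply: eq_Rintegral => x _; rewrite mul1r.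
  apply: (@integrable_wform _ _ _ mu (cst 1) 1) => //; apply: aeW => x; by rewrite normr1.
rewrite -subr_ge0 -(wformBs _ _ mc ms ca (Linfty_ae s) a0 (normr_ge0 _)) /wform.
have mg : measurable_fun setT (fun x => (s x - cst a x) * (f x * f x)).
  by apply: measurable_funM; [exact: measurable_funB|exact: measurable_funM].
rewrite (@ae_eq_Rintegral _ _ _ mu _ (fun x => `|(s x - cst a x) * (f x * f x)|))//.
- by apply: Rintegral_ge0 => x _.
- exact: measurableT_comp.
apply: filterS sa => x /=; rewrite lee_fin => ax.
by rewrite ger0_norm// mulr_ge0 ?subr_ge0// -expr2 sqr_ge0.
Qed.

Lemma ess_inf_near s t (a : R) : (a%:E <= ess_inf mu (EFin \o s))%E -> `|t - s| <= a / 2 ->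
  ((a / 2)%:E <= ess_inf mu (EFin \o t))%E.
Proof.
move=> /ess_infP sa ts; apply/ess_infP; apply: filterS2 sa (Linfty_dist t s) => x /=.
rewrite !lee_fin => ax /le_trans/(_ ts); rewrite ler_norml => /andP[h _].
by rewrite -lerBlDr in h *; lra.
Qed.

Lemma ess_inf_pos_bound s : (0 < ess_inf mu (EFin \o s))%E ->
  exists2 a : R, 0 < a & (a%:E <= ess_inf mu (EFin \o s))%E.
Proof.
case E : (ess_inf mu (EFin \o s)) => [r| |] //; first by rewrite lte_fin => r0; exists r.
(* The case of an infinite essential infimum, where any positive number serves. *)
by move=> _; exists 1; rewrite ?ltr01// leey.
Qed.

End Linfty_weights.

Section L2_classes.
Context d (T : measurableType d) (R : realType).
Variable mu : {measure set T -> \bar R}.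

Lemma L2_class_lin (a : R) (f g h : T -> R) (Hf : f \in Lfun mu 2%:E) (Hg : g \in Lfun mu 2%:E)
    (Hh : h \in Lfun mu 2%:E) : (forall x, h x = a * f x + g x) ->
  L2_class Hh = a *: L2_class Hf + L2_class Hg.
Proof.
move=> E; rewrite -[LHS]Lp_reprK -[RHS]Lp_reprK; apply/eq_Lp_class.
apply: filterS3 (filterI (L2_classE Hf) (L2_classE Hg)) (L2_classE Hh) (filterI
  (Lp_reprD (a *: L2_class Hf) (L2_class Hg)) (Lp_reprZ a (L2_class Hf))).
by move=> x [h1 h2] h3 [h4 h5]; rewrite h4 h5 h1 h2 h3.
Qed.

Lemma L2_class_norm (f : T -> R) (Hf : f \in Lfun mu 2%:E) :
  (\int[mu]_x ((f x) ^+ 2)%:E = (`|L2_class Hf| ^+ 2)%:E)%E.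
Proof.
rewrite -integral_sqr_L2; have mf : measurable_fun setT f.
  by have := sub_Lfun_mfun Hf; rewrite inE.
apply: ae_eq_integral => //.
- by apply/measurable_EFinP; exact: measurable_funX.
- by apply/measurable_EFinP; apply: measurable_funX.
by apply: filterS (L2_classE Hf) => x -> _.
Qed.

Lemma Lnorm_dist (f : T -> R) (Hf : f \in Lfun mu 2%:E) (u : L2 mu) :
  (Lnorm mu 2%:E (fun x => (f x - u x)%:E) = (`|L2_class Hf - u|)%:E)%E.
Proof.
rewrite -Lp_norm_EFin; symmetry.
apply: (@ae_eq_Lnorm _ _ _ mu _ (lee1n 2) (Lp_repr (L2_class Hf - u)) (Lfun_Sub (lee1n 2) Hf - Lp_repr u)).
by apply: filterS2 (Lp_reprB (L2_class Hf) u) (L2_classE Hf) => x -> ->.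
Qed.

Lemma dot_class (u : L2 mu) (f : T -> R) (Hf : f \in Lfun mu 2%:E) :
  \int[mu]_x (u x * f x) = dot_L2 u (L2_class Hf).
Proof.
have mf : measurable_fun setT f by have := sub_Lfun_mfun Hf; rewrite inE.
apply: ae_eq_Rintegral; [exact: measurable_funM|exact: measurable_funM|].
by apply: filterS (L2_classE Hf) => x ->.
Qed.

Lemma cvg_Lnorm (f : nat -> T -> R) (Hf : forall k, f k \in Lfun mu 2%:E) (u : L2 mu) :
  (Lnorm mu 2%:E (fun x => (f k x - u x)%:E) @[k --> \oo] --> 0)%E <->
  L2_class (Hf k) @[k --> \oo] --> u.
Proof.
under eq_cvg do rewrite (Lnorm_dist (Hf _)).
split=> [/fine_cvgP[_ h]|h].
  apply/cvgrPdist_le => e e0; move/cvgrPdist_le : h => /(_ e e0); apply: filterS => k /=.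
  by rewrite sub0r normrN normr_id distrC.
apply: cvg_EFin; first exact: nearW.
apply/cvgrPdist_le => e e0; move/cvgrPdist_le : h => /(_ e e0); apply: filterS => k /=.
by rewrite sub0r normrN normr_id distrC.
Qed.

Lemma mean0_dot (one t : L2 mu) : (\forall y \ae mu, one y = 1) ->
  (t \in @mean0 _ _ _ mu) <-> dot_L2 t one = 0.
Proof.
move=> h1; have mt : measurable_fun setT (fun y => t y * one y) by exact: measurable_funM.
have tE : \forall y \ae mu, t y * one y = t y.
  by apply: filterS h1 => y ->; rewrite mulr1.
have E : dot_L2 t one = \int[mu]_y t y by exact: ae_eq_Rintegral.
rewrite E; split=> [/asboolP[]//|t0]; apply/asboolP; split=> //.
have /integrableP[m1 i1] := integrable_L2M t one.
have mEt : measurable_fun setT (EFin \o (t : _ -> R)) by exact/measurable_EFinP.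
apply/integrableP; split=> //; apply: le_lt_trans i1.
rewrite le_eqVlt; apply/orP; left; apply/eqP; apply: ae_eq_integral => //.
- exact: measurableT_comp.
- exact: measurableT_comp.
- by apply: filterS tE => y /= -> _.
Qed.

End L2_classes.

Lemma Rintegral_sum dd (T : measurableType dd) (R : realType) (m : {measure set T -> \bar R}) k (g : 'I_k -> T -> R) :
  (forall i, m.-integrable setT (EFin \o g i)) ->
  \int[m]_x (\sum_i g i x) = \sum_i \int[m]_x g i x.
Proof.
move=> ig; suff [] : m.-integrable setT (fun x => (\sum_i g i x)%:E) /\
    \int[m]_x (\sum_i g i x) = \sum_i \int[m]_x g i x by [].
elim: k g ig => [|k IH] g ig.
  split; first by under eq_fun do rewrite big_ord0; exact: integrable0.
  by rewrite big_ord0; under eq_Rintegral do rewrite big_ord0; rewrite /Rintegral integral0.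
have [i1 E1] := IH (fun i => g (widen_ord (leqnSn k) i)) (fun i => ig _).
split.
  under eq_fun do rewrite big_ord_recr/= EFinD.
  exact: (integrableD measurableT i1 (ig ord_max)).
rewrite big_ord_recr/= -E1 -(RintegralD measurableT i1 (ig ord_max)).
by apply: eq_Rintegral => x _; rewrite big_ord_recr.
Qed.

(** * The Neumann-to-Dirichlet map of a Lipschitz domain *)

Section smooth_fun.
Context {R : realType} {n : nat}.

Definition smooth_pred : {pred ('rV[R]_n -> R)} := fun phi => `[< smooth phi >].

Lemma smooth_submod_closed : submod_closed smooth_pred.
Proof.
split; first by apply/asboolP; exact: (smooth_cst 0).
by move=> a f g /asboolP sf /asboolP sg; apply/asboolP; exact: smooth_lin.
Qed.

HB.instance Definition _ := GRing.isSubmodClosed.Build _ _ smooth_pred smooth_submod_closed.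

(** Smooth functions as a vector space: the space [E] of the abstract Neumann problem. *)
Definition smooth_fun : Type := {f : 'rV[R]_n -> R | f \in smooth_pred}.
HB.instance Definition _ := SubChoice.on smooth_fun.
HB.instance Definition _ := [SubChoice_isSubLmodule of smooth_fun by <:].

Lemma smooth_funP (x : smooth_fun) : smooth (val x).
Proof. by case: x => f /= /asboolP. Qed.

Lemma smooth_fun_C1 (x : smooth_fun) : C1 (val x).
Proof. exact/smooth_C1/smooth_funP. Qed.

Definition to_smooth (f : 'rV[R]_n -> R) (sf : smooth f) : smooth_fun := exist _ f (asboolT sf).

Definition smooth_one : smooth_fun := to_smooth (smooth_cst 1).

Lemma smooth_funE a (x y : smooth_fun) : val (a *: x + y) = fun z => a * val x z + val y z.
Proof. by []. Qed.

Lemma smooth_fun_partial a i (x y : smooth_fun) :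
  partial i (val (a *: x + y)) = fun z => a * partial i (val x) z + partial i (val y) z.
Proof.
rewrite smooth_funE; apply: partial_lin => z.
  by have [_ + _] := smooth_fun_C1 x; exact.
by have [_ + _] := smooth_fun_C1 y; exact.
Qed.

Lemma smooth_fun_shift (x : smooth_fun) c z : val (x - c *: smooth_one) z = val x z - c.
Proof. by rewrite addrC -scaleNr smooth_funE/= mulr1 addrC. Qed.

End smooth_fun.

Section domain.
Context {R : realType} {n : nat}.
Local Notation X := 'rV[R]_n.
Local Notation BX := (borel 'rV[R]_n).
Variable D : set X.
Hypotheses (n2 : (2 <= n)%N) (bD : bounded_connected_lipschitz_domain D).
Local Notation mu := (volume D).
Local Notation nu := (surface D).

Let oD : open D. Proof. by case: bD. Qed.
Let Dbd : bounded_set D. Proof. by case: bD. Qed.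
Let Dfin : (hausdorff n.-1 (boundary D) < +oo)%E := hausdorff_boundary_fin n2 bD.

Definition vol_class (f : X -> R) (cf : continuous f) : L2 mu :=
  L2_class (volume_L2 oD (compact_closure bD) (lam_bounded oD Dbd) cf).
Definition surf_class (f : X -> R) (cf : continuous f) : L2 nu :=
  L2_class (surface_L2 Dfin (compact_boundary bD) cf).

Lemma C1_continuous (f : X -> R) : C1 f -> continuous f.
Proof. by case. Qed.
Lemma C1_partial (f : X -> R) i : C1 f -> continuous (partial i f).
Proof. by case. Qed.

Definition fval (x : @smooth_fun R n) : L2 mu := vol_class (C1_continuous (smooth_fun_C1 x)).
Definition fgrad i (x : @smooth_fun R n) : L2 mu := vol_class (C1_partial (i := i) (smooth_fun_C1 x)).
Definition ftrace (x : @smooth_fun R n) : L2 nu := surf_class (C1_continuous (smooth_fun_C1 x)).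

Lemma fval_lin a x y : fval (a *: x + y) = a *: fval x + fval y.
Proof. by apply: L2_class_lin => z; rewrite smooth_funE. Qed.

Lemma fgrad_lin i a x y : fgrad i (a *: x + y) = a *: fgrad i x + fgrad i y.
Proof. by apply: L2_class_lin => z; rewrite smooth_fun_partial. Qed.

Lemma ftrace_lin a x y : ftrace (a *: x + y) = a *: ftrace x + ftrace y.
Proof. by apply: L2_class_lin => z; rewrite smooth_funE. Qed.

Lemma fgrad_one i : fgrad i smooth_one = 0.
Proof.
apply/eqP; rewrite -normr_eq0 -sqrf_eq0; apply/eqP; apply: EFin_inj; rewrite -L2_class_norm.
by apply: integral0_eq => x _; rewrite partial_cst expr0n.
Qed.

Lemma gsq_dirichlet x : (gsq fgrad x)%:E = dirichlet D (val x).
Proof.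
have mp i : measurable_fun setT (fun y : BX => ((partial i (val x) y) ^+ 2)%:E).
  apply/measurable_EFinP; apply: measurable_funX.
  exact: (continuous_borel_fun (C1_partial (i := i) (smooth_fun_C1 x))).
rewrite /dirichlet; under eq_integral do rewrite /gradsq -sumEFin.
rewrite ge0_integral_sum//; last 3 first.
- exact: open_borel.
- by move=> i; exact: measurable_funTS.
- by move=> i y _; rewrite lee_fin sqr_ge0.
rewrite -sumEFin; apply: eq_bigr => i _; rewrite -L2_class_norm.
by rewrite (ge0_integral_volume oD (mp i))// => y; rewrite lee_fin sqr_ge0.
Qed.

Lemma fpoincare : exists2 C : R, 0 <= C & forall x (e : R), 0 < e -> exists c,
  `|fval (x - c *: smooth_one)| ^+ 2 <= C * (gsq fgrad x + e) /\
  `|ftrace (x - c *: smooth_one)| ^+ 2 <= C * (gsq fgrad x + e).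
Proof.
have [C C0 HC] := poincare_inequality n2 bD; exists C => // x e e0.
have xfin : (dirichlet D (val x) < +oo)%E by rewrite -gsq_dirichlet ltry.
have [c [H1 H2]] := HC _ e (smooth_fun_C1 x) e0 xfin; exists c.
have msq : measurable_fun setT (fun y : BX => ((val x y - c) ^+ 2)%:E).
  apply/measurable_EFinP; apply: measurable_funX; apply: measurable_funB => //.
  exact: (continuous_borel_fun (C1_continuous (smooth_fun_C1 x))).
have sq0 (y : BX) : (0 <= ((val x y - c) ^+ 2)%:E)%E by rewrite lee_fin sqr_ge0.
rewrite -gsq_dirichlet -EFinD -EFinM in H1 H2; split.
  rewrite -lee_fin -L2_class_norm (le_trans _ H1)//.
  rewrite -(ge0_integral_volume oD msq sq0) le_eqVlt; apply/orP; left; apply/eqP.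
  by apply: eq_integral => y _; rewrite smooth_fun_shift.
rewrite -lee_fin -L2_class_norm (le_trans _ H2)//.
rewrite -(ge0_integral_surface _ msq sq0) le_eqVlt; apply/orP; left; apply/eqP.
by apply: eq_integral => y _; rewrite smooth_fun_shift.
Qed.

Lemma test_smooth (phi : X -> R) : test_function D phi -> smooth phi.
Proof. by case. Qed.

(** The product of the two functions has compact support in [D], so its partial derivative
    integrates to zero. *)
Lemma by_parts (x : smooth_fun) i (psi : smooth_fun) : test_function D (val psi) ->
  dot_L2 (fval x) (fgrad i psi) = - dot_L2 (fgrad i x) (fval psi).
Proof.
move=> [_ [K [cK KD psi0]]]; apply/eqP; rewrite -addr_eq0; apply/eqP.
have clK : closed K by apply: compact_closed => //; exact: norm_hausdorff.
pose C1x := smooth_fun_C1 x; pose C1psi := smooth_fun_C1 psi.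
have C1p := C1_mul C1x C1psi; pose chi := val x * val psi.
have chi0 z : ~ K z -> chi z = 0 by move=> /psi0 h; rewrite /chi /GRing.mul /= h mulr0.
have mpc : measurable_fun setT (fun y : BX => (partial i chi y)%:E).
  by apply/measurable_EFinP; exact: (continuous_borel_fun (C1_partial (i := i) C1p)).
have E0 : (\int[mu]_y (partial i chi y)%:E = 0)%E.
  rewrite (integral_volume oD mpc) integral_mkcond.
  rewrite -[RHS](integral_partial_eq0 i cK C1p chi0).
  apply: eq_integral => y _; rewrite patchE; case: ifPn => // yD.
  rewrite (partial_support i clK chi0)// => /KD yK.
  by rewrite mem_set in yD.
rewrite /dot_L2 -RintegralD//; [|exact: integrable_L2M|exact: integrable_L2M].
rewrite -[RHS]/(fine 0%E) -E0; apply: ae_eq_Rintegral.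
- by apply: measurable_funD; exact: measurable_funM.
- by apply: continuous_volume_measurable; exact: C1_partial.
have L f (cf : continuous f) : \forall y \ae mu, vol_class cf y = f y by exact: L2_classE.
apply: filterS2 (filterI (L _ (C1_continuous C1x)) (L _ (C1_partial (i := i) C1x)))
  (filterI (L _ (C1_continuous C1psi)) (L _ (C1_partial (i := i) C1psi))).
move=> y [h1 h2] [h3 h4]; rewrite /fval /fgrad h1 h2 h3 h4.
by have [_ ->] := partial_mul i y C1x C1psi; rewrite addrC.
Qed.

Lemma weak_gradient_lim (u : L2 mu) (F : 'I_n -> L2 mu) (x : nat -> smooth_fun) :
  fval (x k) @[k --> \oo] --> u -> (forall i, fgrad i (x k) @[k --> \oo] --> F i) ->
  weak_gradient u F.
Proof.
move=> xu xF i phi tphi; pose psi := to_smooth (test_smooth tphi).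
have -> : \int[mu]_y (u y * partial i phi y) = dot_L2 u (fgrad i psi).
  exact: (dot_class u (volume_L2 oD (compact_closure bD) (lam_bounded oD Dbd) (C1_partial (i := i) (smooth_fun_C1 psi)))).
have -> : \int[mu]_y (F i y * phi y) = dot_L2 (F i) (fval psi).
  exact: (dot_class (F i) (volume_L2 oD (compact_closure bD) (lam_bounded oD Dbd) (C1_continuous (smooth_fun_C1 psi)))).
rewrite dotC (dotC (F i)); have h1 := dot_cvg (f := fgrad i psi) xu.
have h2 := cvgN (dot_cvg (f := fval psi) (xF i)).
have E : (fun k => dot_L2 (fgrad i psi) (fval (x k))) = (fun k => - dot_L2 (fval psi) (fgrad i (x k))).
  by apply/funext => k; rewrite dotC by_parts// dotC.
by rewrite E in h1; exact: (cvgR_unique h1 (h2 _)).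
Qed.

Lemma is_traceP (u : H1 D) (g : L2 nu) : is_trace u g <-> exists x : nat -> smooth_fun,
  [/\ fval (x k) @[k --> \oo] --> (u : L2 mu),
    forall i, fgrad i (x k) @[k --> \oo] --> H1_grad u i & ftrace (x k) @[k --> \oo] --> g].
Proof.
pose cD := compact_closure bD; pose lD := lam_bounded oD Dbd; pose cB := compact_boundary bD.
split=> [[phi [sphi h1 h2 h3]]|[x [h1 h2 h3]]].
  pose x k := to_smooth (sphi k); exists x; split.
  - exact: (cvg_Lnorm (fun k => volume_L2 oD cD lD (C1_continuous (smooth_fun_C1 (x k)))) u).1 h1.
  - move=> i; have := (cvg_Lnorm (fun k => volume_L2 oD cD lD (C1_partial (i := i) (smooth_fun_C1 (x k)))) (H1_grad u i)).1.
    by apply; exact: h2.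
  - exact: (cvg_Lnorm (fun k => surface_L2 Dfin cB (C1_continuous (smooth_fun_C1 (x k)))) g).1 h3.
exists (fun k => val (x k)); split.
- by move=> k; exact: smooth_funP.
- exact: (cvg_Lnorm (fun k => volume_L2 oD cD lD (C1_continuous (smooth_fun_C1 (x k)))) u).2 h1.
- move=> i; have := (cvg_Lnorm (fun k => volume_L2 oD cD lD (C1_partial (i := i) (smooth_fun_C1 (x k)))) (H1_grad u i)).2.
  by apply; exact: h2.
- exact: (cvg_Lnorm (fun k => surface_L2 Dfin cB (C1_continuous (smooth_fun_C1 (x k)))) g).2 h3.
Qed.

Hypothesis S0 : 0 < dot_L2 (ftrace smooth_one) (ftrace smooth_one).

Lemma mean0P (t : L2 nu) : (t \in @mean0 _ _ _ nu) <-> dot_L2 t (ftrace smooth_one) = 0.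
Proof. by apply: mean0_dot; exact: L2_classE. Qed.

Section conductivity.
Variable sigma : Linf D.
Hypothesis sigma_pos : Linf_pos D sigma.
Let s : Linfty mu := sigma.

Lemma gform_weak (F H : 'I_n -> L2 mu) :
  \int[mu]_x (s x * \sum_(i < n) F i x * H i x) = gform s F H.
Proof.
have ms : measurable_fun setT (s : _ -> R) by [].
rewrite /gform -Rintegral_sum => [|i]; last exact: (integrable_wform ms (Linfty_ae s)).
by apply: eq_Rintegral => x _; rewrite mulr_sumr.
Qed.

(** Shows that the choice in [neumann_to_dirichlet] never falls back on its default value: the limit
    from [neumann_exists] has a weak gradient, so it is an element of [H1], and its trace is
    approximated by the same sequence. *)
Lemma ntdP (f : L2_diamond D) : exists F : 'I_n -> L2 mu,
  solves fgrad ftrace smooth_one s (\val (f : L2_mean0 nu)) F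
    (\val (neumann_to_dirichlet sigma f : L2_mean0 nu)).
Proof.
have [a a0 sa] := ess_inf_pos_bound sigma_pos.
have ms : measurable_fun setT (s : _ -> R) by [].
have sM := Linfty_ae s; have M0 := normr_ge0 s.
have s_coer := Linfty_coercive sa (ltW a0).
have f0 : dot_L2 (\val (f : L2_mean0 nu)) (ftrace smooth_one) = 0 by apply/mean0P; exact: valP.
have ex : [set t : L2_mean0 nu | exists2 u : H1 D,
    weak_solution s (\val (f : L2_mean0 nu)) u & is_trace u (\val t)] !=set0.
  have [u [F [t [x [xu xF xt ht]]]]] := neumann_exists fval_lin fgrad_lin ftrace_lin fgrad_one S0
    fpoincare ms sM M0 a0 s_coer f0.
  have [Ft t0 _] := ht.
  have /mean0P tm := t0.
  exists (exist _ t tm : L2_mean0 nu), (Build_H1 (weak_gradient_lim xu xF)).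
    move=> v tv /is_traceP[y [_ yF yt]]; rewrite gform_weak.
    by apply: (solves_pair ms sM M0 ht); exists y.
  by apply/is_traceP; exists x.
have [u wu /is_traceP[x [xu xF xt]]] := xgetPex (0 : L2_mean0 nu) ex.
exists (H1_grad u); split; first by exists x.
  by apply/mean0P; exact: valP.
move=> y; pose yF i := fgrad i y.
have cst_cvg (W : topologicalType) (w : W) : (fun=> w) k @[k --> \oo] --> w by exact: cvg_cst.
pose v := Build_H1 (weak_gradient_lim (cst_cvg _ (fval y)) (fun i => cst_cvg _ (fgrad i y))).
have := wu v (ftrace y); rewrite gform_weak; apply.
by apply/is_traceP; exists (fun=> y); split=> [|i|]; exact: cvg_cst.
Qed.

End conductivity.

Lemma ntd_sym (sigma : Linf D) (f g : L2_diamond D) : Linf_pos D sigma ->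
  boundary_pairing (neumann_to_dirichlet sigma f) g =
  boundary_pairing (neumann_to_dirichlet sigma g) f.
Proof.
move=> sp; have [F hF] := ntdP sp f; have [H hH] := ntdP sp g.
have ms : measurable_fun setT ((sigma : Linfty mu) : _ -> R) by [].
rewrite /boundary_pairing dotC.
by rewrite (solves_sym ms (Linfty_ae _) (normr_ge0 _) hF hH) dotC.
Qed.

(** [solves_diff], with both gradients bounded by [solves_bound] in terms of the common lower bound
    [a]. *)
Lemma ntd_lipschitz : exists2 K : R, 0 <= K & forall (sigma1 sigma2 : Linf D) (a : R), 0 < a ->
  (a%:E <= ess_inf mu (EFin \o ((sigma1 : Linfty mu) : _ -> R)))%E ->
  (a%:E <= ess_inf mu (EFin \o ((sigma2 : Linfty mu) : _ -> R)))%E ->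
  forall f g : L2_diamond D,
  `|boundary_pairing (neumann_to_dirichlet sigma1 f) g -
    boundary_pairing (neumann_to_dirichlet sigma2 f) g| <=
  `|sigma1 - sigma2| * (K * `|f| / a * (K * `|g| / a)).
Proof.
have [K K0 HK] := solves_bound fval_lin fgrad_lin ftrace_lin fgrad_one S0 fpoincare.
exists K => // sigma1 sigma2 a a0 h1 h2 f g.
have p1 : Linf_pos D sigma1 by apply: lt_le_trans h1; rewrite lte_fin.
have p2 : Linf_pos D sigma2 by apply: lt_le_trans h2; rewrite lte_fin.
have [F1 hF1] := ntdP p1 f; have [F2 hF2] := ntdP p2 f; have [H hH] := ntdP p2 g.
have ms (s : Linfty mu) : measurable_fun setT (s : _ -> R) by [].
have b1 := HK _ _ _ (ms sigma1) (Linfty_ae _) (normr_ge0 _) a0 (Linfty_coercive h1 (ltW a0)) _ _ _ hF1.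
have b2 := HK _ _ _ (ms sigma2) (Linfty_ae _) (normr_ge0 _) a0 (Linfty_coercive h2 (ltW a0)) _ _ _ hH.
rewrite /boundary_pairing !(dotC _ (\val (g : L2_mean0 nu))).
apply: (le_trans (solves_diff (ms sigma1) (ms sigma2) (Linfty_ae _) (Linfty_ae _)
  (normr_ge0 _) (normr_ge0 _) (Linfty_dist _ _) (normr_ge0 _) hF1 hF2 hH)).
rewrite [X in X * _ <= _](distrC (sigma2 : Linfty mu)); apply: ler_wpM2l => //.
by apply: ler_pM => //; exact: norm1_ge0.
Qed.

(** Solve again with datum $t=\Lambda_\sigma f$: then $|t|^2$ is the energy pairing of the two
    solutions, bounded by a multiple of $|t||f|$. *)
Lemma ntd_bounded (sigma : Linf D) : Linf_pos D sigma ->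
  exists2 C : R, 0 <= C & forall f : L2_diamond D, `|neumann_to_dirichlet sigma f| <= C * `|f|.
Proof.
move=> sigma_pos; have [a a0 sa] := ess_inf_pos_bound sigma_pos.
have [K K0 HK] := solves_bound fval_lin fgrad_lin ftrace_lin fgrad_one
  S0 fpoincare.
pose s : Linfty mu := sigma; have ms : measurable_fun setT (s : _ -> R) by [].
have b f F t := HK _ _ _ ms (Linfty_ae s) (normr_ge0 s) a0 (Linfty_coercive sa (ltW a0)) f F t.
exists (`|s| * (K / a) * (K / a)); first by rewrite !mulr_ge0 ?invr_ge0 ?(ltW a0).
move=> f; have [F hF] := ntdP sigma_pos f.
set t := neumann_to_dirichlet sigma f in hF *; have [G hG] := ntdP sigma_pos t.
have [Ft _ _] := hF; have := gform_bound ms (Linfty_ae s) (normr_ge0 s) G F.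
rewrite (solves_pair ms (Linfty_ae s) (normr_ge0 s) hG Ft) dot_norm.
rewrite -[`|val _|]/(`|t|) ger0_norm ?sqr_ge0// => h.
have {}h : `|t| ^+ 2 <= `|s| * (K * `|t| / a * (K * `|f| / a)).
  apply: (le_trans h); apply: ler_wpM2l => //; apply: ler_pM; rewrite ?norm1_ge0//.
    exact: b hG.
  exact: b hF.
have := normr_ge0 t; rewrite le_eqVlt => /predU1P[<-|t0].
  by rewrite !mulr_ge0 ?invr_ge0 ?(ltW a0).
rewrite -(ler_pM2l t0) -expr2 (le_trans h)// le_eqVlt; apply/orP; left; apply/eqP.
by move: `|s| `|f| `|t| (lt0r_neq0 a0) => p q r aN; field.
Qed.

End domain.

(** * Linearity and separable range of the Neumann-to-Dirichlet map *)

Lemma L2_trivial d (T : measurableType d) (R : realType) (m : {measure set T -> \bar R})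
    (one f g : L2 m) : (\forall y \ae m, one y = 1) -> `|one| = 0 -> f = g.
Proof.
move=> h1 /normr0_eq0 one0; rewrite -[LHS]Lp_reprK -[RHS]Lp_reprK; apply/eq_Lp_class.
have h0 : \forall y \ae m, one y = 0.
  by apply: filterS (Lp_reprZ 0 one) => y; rewrite scale0r mul0r one0.
by apply: filterS2 h1 h0 => y -> /eqP; rewrite oner_eq0.
Qed.

Section symmetric_operator.
Context {R : realType} {H : normedModType R}.
Variable b : H -> H -> R.
Hypotheses (bC : forall f g, b f g = b g f)
  (b_lin : forall a f g h, b (a *: f + g) h = a * b f h + b g h)
  (b_norm : forall f, b f f = `|f| ^+ 2).

Lemma form_sub f g h : b (f - g) h = b f h - b g h.
Proof. by rewrite addrC -scaleN1r b_lin mulN1r addrC. Qed.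

(** Symmetry moves [L] to the other argument, where the form is linear; definiteness concludes. No
    linearity has to be read off the choice in [neumann_to_dirichlet]. *)
Lemma symmetric_linear (L : H -> H) : (forall f g, b (L f) g = b (L g) f) ->
  forall a f g, L (a *: f + g) = a *: L f + L g.
Proof.
move=> Ls a f g; apply/eqP; rewrite -subr_eq0 -normr_eq0 -sqrf_eq0 -b_norm; set d := _ - _.
have := form_sub (L (a *: f + g)) (a *: L f + L g) d; rewrite -/d => ->.
rewrite b_lin Ls (Ls f) (Ls g) bC b_lin !(bC _ (L d)).
by apply/eqP; ring.
Qed.

End symmetric_operator.

Section ntd.
Context {R : realType} {n : nat}.
Local Notation X := 'rV[R]_n.
Variable D : set X.
Hypotheses (n2 : (2 <= n)%N) (bD : bounded_connected_lipschitz_domain D).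
Local Notation mu := (volume D).
Local Notation nu := (surface D).
Local Notation H := (L2_diamond D).
Local Notation one := (ftrace n2 bD smooth_one).
Local Notation ntd := (@neumann_to_dirichlet R n D).
Local Notation bp := (@boundary_pairing R n D).

Lemma bpC (f g : H) : bp f g = bp g f.
Proof. exact: dotC. Qed.

Lemma bp_lin (a : R) (f g h : H) : bp (a *: f + g) h = a * bp f h + bp g h.
Proof. by rewrite /boundary_pairing -dotZl -dotDl. Qed.

Lemma bp_bound (f g : H) : `|bp f g| <= `|f| * `|g|.
Proof. exact: dot_bound. Qed.

Lemma bp_norm (f : H) : bp f f = `|f| ^+ 2.
Proof. exact: dot_norm. Qed.

Lemma L2_diamond_trivial (f g : H) : ~ (0 < dot_L2 one one) -> f = g.
Proof.
move=> /negP S0; have one0 : `|one| = 0.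
  apply/eqP; rewrite -sqrf_eq0 -dot_norm; apply/eqP/le_anti.
  by rewrite leNgt S0 dot_norm sqr_ge0.
by apply: val_inj; apply: L2_trivial one0; exact: L2_classE.
Qed.

Hypothesis S0 : 0 < dot_L2 one one.

Lemma C1_lipschitz_ball (x : X -> R) (r : R) : C1 x -> 0 < r -> exists2 L : R, 0 < L &
  forall p q, `|p| <= r -> `|q| <= r -> `|x q - x p| <= L * `|q - p|.
Proof.
(* The intermediate points of [C1_increment] are within $2|q-p|\le4r$ of [p], hence in the ball of
   radius $5r$. *)
move=> C1x r0; have cK : compact (closed_ball (0 : X) (r *+ 5)).
  apply: bounded_closed_compact; last exact: closed_ball_closed.
  exists (r *+ 5); split=> [|M' MM' y]; first exact: num_real.
  rewrite closed_ballE ?mulrn_wgt0// /closed_ball_ /= sub0r normrN => /le_trans; apply.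
  exact: ltW.
have ex i : exists M : R, 0 <= M /\ forall y, closed_ball (0 : X) (r *+ 5) y -> `|partial i x y| <= M.
  by have [M M0 HM] := compact_continuous_bound cK (C1_partial (i := i) C1x); exists M.
pose M i := projT1 (cid (ex i)).
have M0 i : 0 <= M i := (projT2 (cid (ex i))).1.
have HM i := (projT2 (cid (ex i))).2.
exists (\sum_i M i + 1); first by rewrite ltr_wpDl// sumr_ge0.
move=> p q pr qr; have [xi [Hxi E]] := C1_increment p (q - p) C1x.
rewrite (addrC p) subrK in E; rewrite E (le_trans (ler_norm_sum _ _ _))//.
rewrite mulrDl mul1r ler_wpDr// mulr_suml; apply: ler_sum => i _.
rewrite normrM mulrC; apply: ler_pM => //; last exact: coord_le_norm.
apply: HM; rewrite closed_ballE ?mulrn_wgt0// /closed_ball_ /= sub0r normrN.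
have h1 : `|q - p| <= r *+ 2 by rewrite mulr2n (le_trans (ler_normB _ _))// lerD.
have h2 := Hxi i; rewrite -(subrK p (xi i)) (le_trans (ler_normD _ _))//.
by apply: (le_trans (lerD h2 pr)); move: h1; move: `|q - p| => u; lra.
Qed.

(** A smooth function is described on the compact boundary, up to $3\cdot2^{-k}$ uniformly, by its
    values on a finite net rounded to multiples of $2^{-k}$. Such descriptions are countable, and
    one function is chosen for each description that occurs. *)
Lemma trace_separable : exists s : nat -> L2 nu, forall (x : smooth_fun) (e : R), 0 < e ->
  exists k, `|ftrace n2 bD x - s k| < e.
Proof.
have Dfin := hausdorff_boundary_fin n2 bD.
pose B := boundary D.
have [r r0 Br] : exists2 r : R, 0 < r & B `<=` ball (0 : X) r.
  have [M [_ HM]] := compact_bounded (compact_boundary bD); exists (`|M| + 2); first by rewrite ltr_wpDl.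
  move=> x Bx; rewrite -ball_normE /= sub0r normrN.
  apply: (@le_lt_trans _ _ (`|M| + 1)); last by rewrite ltrD2l ltr1n.
  by apply: HM => //; rewrite (le_lt_trans (ler_norm _))// ltrDl.
have [B0|B0] := pselect (B !=set0); last first.
  exists (fun=> 0) => x e e0; exists 0%N; rewrite subr0.
  suff -> : `|ftrace n2 bD x| = 0 by [].
  apply/eqP; rewrite -sqrf_eq0; apply/eqP; apply: EFin_inj; rewrite -L2_class_norm.
  rewrite (@ge0_integral_surface _ _ _ Dfin (fun y => ((val x y) ^+ 2)%:E)); last 2 first.
  - apply/measurable_EFinP; apply: measurable_funX.
    exact: (continuous_borel_fun (C1_continuous (smooth_fun_C1 x))).
  - by move=> y; rewrite lee_fin sqr_ge0.
  rewrite (_ : boundary D = set0) ?integral_set0//.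
  by apply/seteqP; split=> // y By; apply: B0; exists y.
have net N := finite_net (N := N.+1) r0 (ltn0Sn N) B0 Br.
pose t N := projT1 (cid (net N)).
have tB N c : B (t N c) := (projT2 (cid (net N))).1 c.
have tN N p : B p -> exists c, `|p - t N c| <= r *+ 2 / N.+1%:R := (projT2 (cid (net N))).2 p.
pose code N k (x : @smooth_fun R n) : seq int :=
  [seq Num.floor (2 ^+ k * val x (t N c)) | c : {ffun 'I_n -> 'I_N.+1}].
(* Equal rounded values force closeness only between net points; both functions must also vary
   little near each net point. *)
pose fine_at N k (x : @smooth_fun R n) := forall p c, B p -> `|p - t N c| <= r *+ 2 / N.+1%:R ->
  `|val x p - val x (t N c)| <= 2^-1 ^+ k.
pose P (w : nat * nat * seq int) x := fine_at w.1.1 w.1.2 x /\ code w.1.1 w.1.2 x = w.2.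
pose s (i : nat) : L2 nu := match unpickle i with
  | Some w => match pselect (exists x, P w x) with
              | left e => ftrace n2 bD (projT1 (cid e)) | right _ => 0 end
  | None => 0 end.
exists s => x e e0.
have [S S0' HS] : exists2 S : R, 0 < S & forall (y : smooth_fun) (c : R), 0 <= c ->
    (forall p, B p -> `|val y p| <= c) -> `|ftrace n2 bD y| <= c * S.
  pose m := fine (surfB Dfin B).
  have mE : surfB Dfin B = m%:E by rewrite fineK// ge0_fin_numE ?surfB_fin.
  have m0 : 0 <= m by rewrite fine_ge0.
  exists (m + 1); first by rewrite ltr_wpDl.
  move=> y c c0 Hy; rewrite -ler_sqr ?nnegrE ?mulr_ge0 ?addr_ge0//.
  rewrite -lee_fin -L2_class_norm.
  have my : measurable_fun setT (fun z : borel X => ((val y z) ^+ 2)%:E).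
    apply/measurable_EFinP; apply: measurable_funX.
    exact: (continuous_borel_fun (C1_continuous (smooth_fun_C1 y))).
  have y0 (z : borel X) : (0 <= ((val y z) ^+ 2)%:E)%E by rewrite lee_fin sqr_ge0.
  rewrite (ge0_integral_surface Dfin my y0).
  apply: (@le_trans _ _ (\int[surfB Dfin]_(z in boundary D) (c ^+ 2)%:E)%E).
    apply: ge0_le_integral => //.
    - exact: measurable_boundary.
    - exact: measurable_funTS.
    - move=> z Bz; rewrite lee_fin -(real_normK (num_real (val y z))) ler_sqr ?nnegrE//.
      exact: Hy.
  rewrite integral_cst; last exact: measurable_boundary.
  rewrite [X in (_ * X)%E](_ : _ = m%:E); last exact: mE.
  by rewrite -EFinM lee_fin exprMn ler_wpM2l ?sqr_ge0//; nra.
have [k Hk] : exists k, 3 * 2^-1 ^+ k * S < e.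
  have h : (3 * S * 2^-1 ^+ k @[k --> \oo] --> 3 * S * (0 : R)).
    by apply: cvgMl_tmp; apply: cvg_expr; rewrite gtr0_norm// invf_lt1// ltr1n.
  rewrite mulr0 in h; move/cvgrPdist_lt : h => /(_ e e0) [j _ /(_ j (leqnn j))] /=.
  by rewrite sub0r normrN gtr0_norm ?mulr_gt0 ?exprn_gt0// mulrAC => Hj; exists j.
have [L L0 HL] := C1_lipschitz_ball (smooth_fun_C1 x) r0.
have [N HN] : exists N : nat, L * (r *+ 2) * 2 ^+ k <= N.+1%:R.
  exists (Num.truncn (L * (r *+ 2) * 2 ^+ k)); exact/ltW/truncnS_gt.
have nB p : B p -> `|p| <= r.
  by move=> /Br; rewrite -ball_normE /= sub0r normrN => /ltW.
have q0 : 0 < 2 ^+ k :> R by rewrite exprn_gt0.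
have Px : P (N, k, code N k x) x.
  split=> //= p c Bp pc; apply: (le_trans (HL _ _ (nB _ (tB N c)) (nB _ Bp))).
  apply: (le_trans (ler_wpM2l (ltW L0) pc)); rewrite mulrA ler_pdivrMr ?ltr0n//.
  by rewrite exprVn [leRHS]mulrC ler_pdivlMr.
exists (pickle (N, k, code N k x)); rewrite /s pickleK; case: pselect => [e'|[]]; last by exists x.
case: (cid e') => y [/= yf cy]; apply: le_lt_trans Hk.
rewrite (_ : ftrace n2 bD x - ftrace n2 bD y = ftrace n2 bD (x - y)); last first.
  by rewrite addrC -scaleN1r -ftrace_lin scaleN1r addrC.
have xf := Px.1; apply: HS => [|p Bp]; first by rewrite mulr_ge0// exprn_ge0.
have [c pc] := tN N p Bp.
have xyc : `|val x (t N c) - val y (t N c)| <= 2^-1 ^+ k.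
  have : code N k x = code N k y by rewrite cy.
  move=> /eq_in_map /(_ c); rewrite mem_enum => /(_ isT) fl.
  have := floor_itv (2 ^+ k * val x (t N c)); rewrite fl => /andP[a1 a2].
  have /andP[a3 a4] := floor_itv (2 ^+ k * val y (t N c)).
  rewrite exprVn -(ler_pM2l q0) mulfV ?lt0r_neq0// -{1}(gtr0_norm q0) -normrM mulrBr ler_norml.
  by move: a1 a2 a3 a4; rewrite intrD; lra.
rewrite (_ : val (x - y) p = (val x p - val x (t N c)) + (val x (t N c) - val y (t N c)) +
   (val y (t N c) - val y p)); last by rewrite !subrKA.
rewrite (le_trans (ler_normD _ _))// (_ : 3 * _ = 2^-1 ^+ k + 2^-1 ^+ k + 2^-1 ^+ k); last by ring.
rewrite lerD//; last by rewrite distrC; exact: yf.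
by rewrite (le_trans (ler_normD _ _))// lerD//; exact: xf.
Qed.

(** Values of $\Lambda_\sigma$ are limits of smooth traces, so a countable set approximates them;
    replacing its elements by nearby values of $\Lambda_\sigma$ brings it back into the mean-zero
    space. *)
Lemma ntd_range_separable (sigma : Linf D) : Linf_pos D sigma ->
  exists s : nat -> H, forall (f : H) (e : R), 0 < e -> exists k, `|ntd sigma f - s k| < e.
Proof.
move=> sp; have [s Hs] := trace_separable.
pose P (kj : nat * nat) (f : H) := `|val (ntd sigma f : L2_mean0 nu) - s kj.1| < 2^-1 ^+ kj.2.
pose t (i : nat) : H := match unpickle i with
  | Some kj => match pselect (exists f, P kj f) with
               | left e => ntd sigma (projT1 (cid e)) | right _ => 0 end
  | None => 0 end.
exists t => f e e0.
have [j Hj] : exists j, 2 * 2^-1 ^+ j < e.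
  have h : (2 * 2^-1 ^+ k @[k --> \oo] --> 2 * (0 : R)).
    by apply: cvgMl_tmp; apply: cvg_expr; rewrite gtr0_norm// invf_lt1// ltr1n.
  rewrite mulr0 in h; move/cvgrPdist_lt : h => /(_ e e0) [j _ /(_ j (leqnn j))] /=.
  by rewrite sub0r normrN gtr0_norm ?mulr_gt0 ?exprn_gt0// => Hj; exists j.
have j0 : 0 < 2^-1 ^+ j :> R by rewrite exprn_gt0.
have [F [[x [_ xt]] _ _]] := ntdP S0 sp f.
have h0 : 0 < 2^-1 ^+ j / 2 :> R by rewrite divr_gt0.
move/cvgrPdist_lt : xt => /(_ _ h0) [m _ /(_ m (leqnn m))] /= xm.
have [k Hk] := Hs (x m) _ h0.
have Pf : P (k, j) f.
  rewrite /P /= -[_ - s k](subrKA (ftrace n2 bD (x m))) (le_lt_trans (ler_normD _ _))//.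
  by rewrite [ltRHS](splitr (2^-1 ^+ j)) ltrD.
exists (pickle (k, j)); rewrite /t pickleK; case: pselect => [e'|[]]; last by exists f.
case: (cid e') => f' Pf' /=; apply: lt_trans Hj.
have -> : `|ntd sigma f - ntd sigma f'| =
    `|(val (ntd sigma f : L2_mean0 nu) - s k) - (val (ntd sigma f' : L2_mean0 nu) - s k)|.
  by rewrite opprB addrA subrK.
have jj : 2 * 2^-1 ^+ j = 2^-1 ^+ j + 2^-1 ^+ j :> R by ring.
apply: (le_lt_trans (ler_normB _ _)); rewrite jj; exact: ltrD.
Qed.

End ntd.

(** * Gaussian estimates on the line *)

Section density.
Import HBNNSimple.
Local Open Scope ereal_scope.
Context d (T : measurableType d) (R : realType).
Variables (mu nu : {measure set T -> \bar R}) (p : T -> R).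
Hypotheses (mp : measurable_fun setT p) (p0 : (forall x, 0 <= p x)%R)
  (nuE : forall A, measurable A -> nu A = \int[mu]_(x in A) (p x)%:E).

Let integral_density_nnsfun (f : {nnsfun T >-> R}) :
  \int[nu]_x (f x)%:E = \int[mu]_x (f x * p x)%:E.
Proof.
under [LHS]eq_integral do rewrite fimfunE -fsumEFin//.
rewrite [LHS]ge0_integral_fsum//; last 2 first.
  - by move=> r; exact/measurable_EFinP/measurableT_comp.
  - by move=> r x _; rewrite EFinM nnfun_muleindic_ge0.
have mi r : measurable_fun setT (fun x => (r * \1_(f @^-1` [set r]) x)%R : R).
  by apply: measurable_funM => //; exact: measurable_indic.
under [RHS]eq_integral.
  move=> x _; rewrite EFinM fimfunE -fsumEFin// ge0_mule_fsuml; last first.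
    by move=> r; rewrite EFinM nnfun_muleindic_ge0.
  over.
rewrite [RHS]ge0_integral_fsum//; last 2 first.
  - move=> r; apply: emeasurable_funM; last exact/measurable_EFinP.
    exact/measurable_EFinP/mi.
  - by move=> r x _; rewrite mule_ge0 ?lee_fin// -lee_fin EFinM nnfun_muleindic_ge0.
apply: eq_fsbigr => r _.
have [r0|r0] := ltP r 0%R.
  rewrite (_ : f @^-1` [set r] = set0); last first.
    by apply/seteqP; split=> // x /= fr; have : (0 <= f x)%R by []; rewrite fr leNgt r0.
  under eq_integral do rewrite indic0 mulr0.
  under [RHS]eq_integral do rewrite indic0 mulr0 mul0e.
  by rewrite !integral0.
under eq_integral do rewrite EFinM.
under [RHS]eq_integral do rewrite EFinM -muleA.
have mfr : measurable (f @^-1` [set r]) by exact: measurable_sfunP.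
rewrite !ge0_integralZl//.
- congr (_ * _); rewrite integral_indic// setIT nuE// integral_mkcond.
  apply: eq_integral => x _; rewrite patchE indicE; case: ifPn => h; rewrite ?mul1e ?mul0e//.
- by apply: emeasurable_funM; apply/measurable_EFinP => //; exact: measurable_indic.
- by move=> x _; rewrite mule_ge0 ?lee_fin.
- by apply/measurable_EFinP; exact: measurable_indic.
Qed.

Lemma ge0_integral_density (f : T -> R) : measurable_fun setT f -> (forall x, 0 <= f x)%R ->
  \int[nu]_x (f x)%:E = \int[mu]_x (f x * p x)%:E.
Proof.
move=> mf f0; have mfE : measurable_fun setT (EFin \o f) by exact/measurable_EFinP.
pose f_ := nnsfun_approx measurableT mfE.
have fcvg x : (f_ n x)%:E @[n --> \oo] --> (f x)%:E.
  by apply: (cvg_nnsfun_approx measurableT mfE) => // y _ /=; rewrite lee_fin.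
have nd x : {homo (fun n => f_ n x) : a b / (a <= b)%N >-> (a <= b)%R}.
  by move=> a b ab; exact/lefP/nd_nnsfun_approx.
transitivity (limn (fun n => \int[nu]_x (f_ n x)%:E)).
  rewrite -monotone_convergence//.
  - by apply: eq_integral => x _; apply/esym/cvg_lim.
  - by move=> n; exact/measurable_EFinP/measurable_funP.
  - by move=> n x _; rewrite lee_fin.
  - by move=> x _ a b ab; rewrite lee_fin; exact: nd.
transitivity (limn (fun n => \int[mu]_x (f_ n x * p x)%:E)).
  by congr (limn _); apply/funext => n; exact: integral_density_nnsfun.
rewrite -monotone_convergence//.
- apply: eq_integral => x _; apply/cvg_lim => //.
  under eq_fun do rewrite EFinM.
  by rewrite EFinM; apply: cvgeZr => //; exact: fcvg.
- by move=> n; apply/measurable_EFinP/measurable_funM => //; exact: measurable_funP.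
- by move=> n x _; rewrite lee_fin mulr_ge0.
- by move=> x _ a b ab; rewrite lee_fin ler_wpM2r//; exact: nd.
Qed.

End density.

Section normal_estimates.
Context {R : realType}.
Variables (m s : R).
Hypothesis s0 : s != 0.
Local Notation leb := (@lebesgue_measure R).

Lemma normal_peak_le : normal_peak s <= (2 * `|s|)^-1.
Proof.
have sn : 0 < `|s| by rewrite normr_gt0.
have pi2 := @pi_ge2 R; have s2 : 0 <= s ^+ 2 by exact: sqr_ge0.
rewrite /normal_peak lef_pV2 ?posrE; last 2 first.
- by rewrite sqrtr_gt0 mulrn_wgt0// mulr_gt0 ?exprn_even_gt0// (lt_le_trans _ pi2).
- by rewrite mulr_gt0.
rewrite -[leLHS](ger0_norm (mulr_ge0 _ (ltW sn)))// -sqrtr_sqr ler_sqrt; last first.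
  by rewrite mulrn_wge0// mulr_ge0// (le_trans _ pi2).
rewrite exprMn real_normK ?num_real// -mulr_natl.
by move: (s ^+ 2) s2 pi2; move: (pi) => p u; nra.
Qed.

Lemma normal_small_ball (e : R) : 0 < e ->
  (normal_prob m s [set x : R | (`|x| < e)%R] <= (e / `|s|)%:E)%E.
Proof.
move=> e0; have sn : 0 < `|s| by rewrite normr_gt0.
have E : [set x : R | `|x| < e] = `]-e, e[%classic.
  by apply/seteqP; split=> x; rewrite /= in_itv /= ltr_norml.
rewrite E /normal_prob.
apply: (@le_trans _ _ (\int[leb]_(x in `](- e)%R, e[) ((2 * `|s|)^-1)%:E)%E).
  apply: ge0_le_integral => //.
  - by move=> x _; rewrite lee_fin normal_pdf_ge0.
  - by apply/measurable_EFinP; apply: measurable_funTS; exact: measurable_normal_pdf.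
  - by move=> x _; rewrite lee_fin (le_trans (normal_pdf_ub _ _ s0))// normal_peak_le.
rewrite integral_cst//= lebesgue_measure_itv /= lte_fin gtrN// -EFinD -EFinM lee_fin.
by rewrite le_eqVlt; apply/orP; left; apply/eqP; field; rewrite lt0r_neq0.
Qed.

(** Comparison with the normal density of deviation $2s$: with $v=(x-m)^2/(8s^2)$ the exponent is
    $-v-3v$, and $ve^{-3v}\le1$. The constant $16$ is crude but sufficient. *)
Lemma normal_second_moment :
  (\int[normal_prob m s]_x ((x - m) ^+ 2)%:E <= (16 * s ^+ 2)%:E)%E.
Proof.
have s20 : 2 * s != 0 by rewrite mulf_neq0.
rewrite (@ge0_integral_density _ _ R leb (normal_prob m s) (normal_pdf m s)); first last.
- by move=> x; exact: sqr_ge0.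
- by apply: measurable_funX; exact: measurable_funB.
- by [].
- by move=> x; exact: normal_pdf_ge0.
- exact: measurable_normal_pdf.
apply: (@le_trans _ _ (\int[leb]_x ((16 * s ^+ 2)%:E * (normal_pdf m (2 * s) x)%:E))%E).
  apply: ge0_le_integral => //.
  - by move=> x _; rewrite lee_fin mulr_ge0 ?sqr_ge0 ?normal_pdf_ge0.
  - apply/measurable_EFinP; apply: measurable_funM; last exact: measurable_normal_pdf.
    by apply: measurable_funX; exact: measurable_funB.
  - by apply: measurable_funeM; apply/measurable_EFinP; exact: measurable_normal_pdf.
  move=> x _; rewrite -EFinM lee_fin !normal_pdfE//.
  have -> : normal_peak (2 * s) = normal_peak s / 2.
    rewrite /normal_peak exprMn -mulrA -mulrnAr sqrtrM ?sqr_ge0// sqrtr_sqr ger0_norm//.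
    by rewrite invfM mulrC.
  rewrite /normal_fun; set p := normal_peak s; have p0 : 0 <= p by exact: normal_peak_ge0.
  set u := (x - m) ^+ 2; have u0 : 0 <= u by exact: sqr_ge0.
  have S : 0 < s ^+ 2 by rewrite exprn_even_gt0.
  pose v := u / (8 * s ^+ 2).
  have v0 : 0 <= v by rewrite divr_ge0// mulr_ge0// ltW.
  have -> : - u / (s ^+ 2 *+ 2) = - v - 3 * v by rewrite /v; field.
  have -> : - u / ((2 * s) ^+ 2 *+ 2) = - v by rewrite /v; field.
  rewrite expRD (expRN (3 * v)); set E := expR (- v); have E0 : 0 <= E by exact: expR_ge0.
  have u8 : u = 8 * s ^+ 2 * v by rewrite /v; field.
  have h : v / expR (3 * v) <= 1.
    rewrite ler_pdivrMr ?expR_gt0// mul1r (le_trans _ (expR_ge1Dx _))//; lra.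
  rewrite u8 (_ : _ * (p * _) = 8 * s ^+ 2 * p * E * (v / expR (3 * v))); last by ring.
  rewrite (_ : 16 * _ * _ = 8 * s ^+ 2 * p * E); last by field.
  have K : 0 <= 8 * s ^+ 2 * p * E by do 3 apply: mulr_ge0 => //; exact: ltW.
  exact: ler_piMr.
rewrite ge0_integralZl//; last 3 first.
- by apply/measurable_EFinP; exact: measurable_normal_pdf.
- by move=> x _; rewrite lee_fin normal_pdf_ge0.
- by rewrite lee_fin mulr_ge0 ?sqr_ge0.
by rewrite integral_normal_pdf mule1.
Qed.

End normal_estimates.

(** * Small ball estimate for a random bilinear measurement *)

(** Splits $p\le\min(1,A\eta^{n+1}/y)$ by the scale of $y$: for $\eta^{j+1}\le y<\eta^j$ it gives
    $p\le A\eta^{n-j}$, for $y<\eta^n$ the bound $1$ is used. If $y<\eta^j$ has probability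
    $O(\eta^j)$, every level contributes $O(\eta^n)$. *)
Lemma level_bound (R : realFieldType) (p y A eta : R) (n : nat) : 0 <= p -> p <= 1 -> 0 <= y -> 0 <= A -> 0 < eta -> eta <= 1 ->
  p * y <= A * eta ^+ n.+1 ->
  p <= (A + 1) * \sum_(j < n.+1) eta ^+ (n - j) * (y < eta ^+ j)%R%:R + A * eta ^+ n.+1.
Proof.
move=> p0 p1 y0 A0 e0 e1 py; have ek k : 0 < eta ^+ k by rewrite exprn_gt0.
have A1 : 0 <= A + 1 by rewrite addr_ge0.
have t0 (j : 'I_n.+1) : 0 <= eta ^+ (n - j) * (y < eta ^+ j)%R%:R by rewrite mulr_ge0// ltW.
have S0 : 0 <= A * eta ^+ n.+1 by rewrite mulr_ge0// ltW.
have [yn|yn] := ltP y (eta ^+ n).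
  rewrite big_ord_recr /= subnn expr0 yn mulr1 mulrDr mulr1 -addrA ler_wpDl//.
    by rewrite mulr_ge0// sumr_ge0// => i _; rewrite mulr_ge0// ltW.
  by rewrite -[p]addr0 lerD// -[p]add0r lerD.
have [y1|y1] := leP 1 y.
  rewrite ler_wpDl ?mulr_ge0 ?sumr_ge0//; apply: le_trans py; exact: ler_peMr.
have ex : exists k, eta ^+ k <= y by exists n.
case: (ex_minnP ex) => -[|j] Hj jmin; first by rewrite expr0 leNgt y1 in Hj.
have jn : (j < n)%N by exact: jmin.
have yj : y < eta ^+ j by rewrite ltNge; apply/negP => /jmin; rewrite ltnn.
rewrite ler_wpDr// (bigD1 (Ordinal (leqW jn : (j < n.+1)%N)))//= yj mulr1 mulrDr ler_wpDr//.
  by rewrite mulr_ge0// sumr_ge0.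
rewrite -(ler_pM2r (ek j.+1)); apply: (@le_trans _ _ (p * y)); first exact: ler_wpM2l.
apply: (le_trans py); rewrite -mulrA -exprD addnS subnK ?(ltnW jn)//.
by rewrite ler_wpM2r ?lerDl// ltW.
Qed.

Section gaussian_form.
Context {R : realType} {H : normedModType R}.
Local Notation BH := (borel H).
Local Notation TR := (measurableTypeR R).
Variable b : H -> H -> R.
Hypotheses (bC : forall f g, b f g = b g f)
  (b_lin : forall a f g h, b (a *: f + g) h = a * b f h + b g h)
  (b_norm : forall f, b f f = `|f| ^+ 2) (b_bound : forall f g, `|b f g| <= `|f| * `|g|).
Variables (gamma : probability BH R) (C : H -> H).
Hypotheses (gG : gaussian_measure gamma) (C_inj : injective C)
  (CE : forall h k, (b (C h) k)%:E = covariance gamma (fun x : H => b x h) (fun x : H => b x k)).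

Lemma form_continuous h : continuous (fun x : H => b x h).
Proof.
move=> x; apply/cvgrPdist_le => e e0; have h1 : 0 < `|h| + 1 by rewrite ltr_wpDl.
move/cvgrPdist_le : (@cvg_id _ (nbhs x)) => /(_ _ (divr_gt0 e0 h1)); apply: filterS => y Hy.
rewrite -(form_sub b_lin) (le_trans (b_bound _ _))//.
apply: (le_trans (ler_wpM2r (normr_ge0 _) Hy)).
by rewrite mulrAC ler_pdivrMr// ler_wpM2l ?(ltW e0)// lerDl.
Qed.

Lemma form_measurable h : measurable_fun setT (fun x : BH => b x h).
Proof.
apply: real_fun_measurable => U oU; apply: open_borel.
by have /continuousP := @form_continuous h; apply.
Qed.

Lemma form_law h : exists m s : R, forall A : set R, measurable A ->
  gamma ((fun x : H => b x h) @^-1` A) = gaussian_law m s A.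
Proof.
have lin : scalar (fun x : H => b x h) by move=> a x y; exact: b_lin.
pose L := GRing.isLinear.Build _ _ _ _ _ lin.
pose l : {scalar H} := HB.pack (fun x : H => b x h) L.
exact: (gG (l := l) (@form_continuous h)).
Qed.

Lemma second_moment h m s : (forall A : set R, measurable A ->
    gamma ((fun x : H => b x h) @^-1` A) = gaussian_law m s A) ->
  (\int[gamma]_x ((b x h - m) ^+ 2)%:E <= (16 * s ^+ 2)%:E)%E.
Proof.
move=> law; have mX : measurable_fun setT ((fun x : H => b x h) : BH -> TR) := form_measurable h.
have msq : measurable_fun setT (fun x : TR => ((x - m) ^+ 2)%:E).
  by apply/measurable_EFinP; apply: measurable_funX; exact: measurable_funB.
have sq0 (x : TR) : (0 <= ((x - m) ^+ 2)%:E)%E by rewrite lee_fin sqr_ge0.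
have -> : (\int[gamma]_x ((b x h - m) ^+ 2)%:E =
    \int[push_measure gamma mX]_x ((x - m) ^+ 2)%:E)%E.
  by rewrite -[RHS]/(\int[pushforward gamma _]_x _)%E ge0_integral_pushforward.
have [s0|s0] := eqVneq s 0.
  have -> : (\int[push_measure gamma mX]_x ((x - m) ^+ 2)%:E = \int[\d_(m : TR)]_x ((x - m) ^+ 2)%:E)%E.
    by apply: eq_measure_integral => A mA _; rewrite [LHS]law// /gaussian_law s0 eqxx.
  by rewrite integral_dirac// diracT mul1e subrr expr0n s0 expr0n mulr0.
apply: le_trans (normal_second_moment m s0); rewrite le_eqVlt; apply/orP; left; apply/eqP.
apply: eq_measure_integral => A mA _.
by rewrite [LHS]law// /gaussian_law (negbTE s0).
Qed.

(** The variance of a marginal is at most its second moment about [m]; an upper bound suffices,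
    since it becomes a lower bound on the deviation [s]. *)
Lemma covariance_le h m s : (forall A : set R, measurable A ->
    gamma ((fun x : H => b x h) @^-1` A) = gaussian_law m s A) ->
  b (C h) h <= 16 * s ^+ 2.
Proof.
move=> law; have smom := second_moment law.
have mX := form_measurable h; pose Y (x : BH) := b x h - m.
have mY : measurable_fun setT Y by exact: measurable_funB.
have Y2 : Y \in Lfun gamma 2%:E by apply: Lfun2P => //; apply: le_lt_trans smom _; rewrite ltry.
have XE : (fun x : BH => b x h) = (Y \+ cst m)%R by apply/funext => x; rewrite /Y /= subrK.
rewrite -lee_fin CE -[covariance _ _ _]/('V_gamma[fun x : BH => b x h])%E XE varianceD_cst_r//.
rewrite varianceE//; apply: le_trans smom.
rewrite (_ : 'E_gamma[Y ^+ 2]%E = \int[gamma]_x ((b x h - m) ^+ 2)%:E)%E; last first.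
  by rewrite unlock; apply: eq_integral.
have Y1 : Y \in Lfun gamma 1 by rewrite Lfun_subset12 ?fin_num_measure.
have E1 := expectation_fin_num Y1.
by rewrite leeBlDr ?fin_numX// leeDl// -(fineK E1) -EFin_expe lee_fin sqr_ge0.
Qed.

Lemma covariance_sym h k : b (C h) k = b (C k) h.
Proof. by apply: EFin_inj; rewrite !CE covarianceC. Qed.

Lemma covariance_ge0 h : 0 <= b (C h) h.
Proof. by rewrite -lee_fin CE; exact: variance_ge0. Qed.

Lemma measurable_small_ball h (e : R) : measurable ([set x : H | `|b x h| < e] : set BH).
Proof.
rewrite -[X in measurable X]setTI.
have mN : measurable_fun setT (fun x : BH => `|b x h|) by exact: measurableT_comp (form_measurable h).
rewrite (_ : [set x : H | _] = (fun x : BH => `|b x h|) @^-1` `]-oo, e[%classic).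
  exact: mN.
by apply/seteqP; split=> x; rewrite /= in_itv.
Qed.

(** The density of the marginal is at most $1/(2|s|)$, and $s^2$ is at least $\langle
    Ch,h\rangle/16$. For $s=0$ the variance vanishes and the claim is trivial; stating it as a
    product avoids dividing by the variance. *)
Lemma gaussian_small_ball h (e : R) : 0 < e ->
  fine (gamma [set x : H | `|b x h| < e]) ^+ 2 * b (C h) h <= (4 * e) ^+ 2.
Proof.
move=> e0; have [m [s law]] := form_law h; have cs := covariance_le law.
have [s0|s0] := eqVneq s 0.
  apply: (@le_trans _ _ 0); last exact: sqr_ge0.
  by rewrite mulr_ge0_le0 ?sqr_ge0//; move: cs; rewrite s0 expr0n mulr0.
set p := fine _; have p0 : 0 <= p by rewrite fine_ge0.
have ps : p <= e / `|s|.
  rewrite -lee_fin fineK ?fin_num_measure//; last first.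
    exact: measurable_small_ball.
  apply: le_trans (normal_small_ball m s0 e0); rewrite -[X in (X <= _)%E]/(gamma (_ @^-1` [set x : R | `|x| < e])).
  rewrite law; first by rewrite /gaussian_law (negbTE s0).
  rewrite (_ : [set x : R | _] = `](- e), e[%classic); first exact: measurable_itv.
  by apply/seteqP; split=> x; rewrite /= in_itv /= ltr_norml.
apply: (@le_trans _ _ ((e / `|s|) ^+ 2 * (16 * s ^+ 2))).
  apply: ler_pM => //; [exact: sqr_ge0|exact: covariance_ge0|].
  by rewrite ler_sqr ?nnegrE// divr_ge0 ?(ltW e0).
have sn : `|s| != 0 by rewrite normr_eq0.
by rewrite -[s ^+ 2]real_normK ?num_real// le_eqVlt; apply/orP; left; apply/eqP; field.
Qed.

Lemma form_zero h : (forall k, b h k = 0) -> h = 0.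
Proof. by move=> h0; apply/eqP; rewrite -normr_eq0 -sqrf_eq0 -b_norm h0. Qed.

Lemma formDl f g h : b (f + g) h = b f h + b g h.
Proof. by rewrite -[f in LHS]scale1r b_lin mul1r. Qed.

Lemma form0l h : b 0 h = 0.
Proof. by have := form_sub b_lin 0 0 h; rewrite !subrr. Qed.

Lemma formZl a f h : b (a *: f) h = a * b f h.
Proof. by rewrite -[a *: f]addr0 b_lin form0l addr0. Qed.

Lemma covariance_cauchy_schwarz h k : b (C h) k ^+ 2 <= b (C h) h * b (C k) k.
Proof.
apply: (psd_cauchy_schwarz (b := fun x y => b (C x) y)) => [x y z|a x z|x y|x].
- by rewrite !(covariance_sym _ z) !(bC (C z)) formDl.
- by rewrite !(covariance_sym _ z) !(bC (C z)) formZl.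
- exact: covariance_sym.
- exact: covariance_ge0.
Qed.

(** By Cauchy-Schwarz zero variance gives $Ch=0=C0$, and [C] is injective. *)
Lemma covariance_nondegenerate h : b (C h) h = 0 -> h = 0.
Proof.
move=> h0; apply: C_inj; apply: etrans (esym (form_zero _)).
  apply: form_zero => k; apply/eqP; rewrite -sqrf_eq0 eq_le sqr_ge0 andbT.
  by rewrite (le_trans (covariance_cauchy_schwarz _ _))// h0 mul0r.
by move=> k; rewrite covariance_sym bC -(scale0r (0 : H)) formZl mul0r.
Qed.


Section operator.
Variable L : H -> H.
Hypotheses (Lsym : forall f g, b (L f) g = b (L g) f) (M : R) (M0 : 0 <= M)
  (LM : forall f, `|L f| <= M * `|f|)
  (Lsep : exists s : nat -> H, forall f (e : R), 0 < e -> exists k, `|L f - s k| < e).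

Let L_sub f g : L (f - g) = L f - L g.
Proof. by rewrite addrC -scaleN1r (symmetric_linear bC b_lin b_norm Lsym) scaleN1r addrC. Qed.

Let L_dist_open h (e : R) : open [set f | `|L f - h| < e].
Proof.
rewrite (_ : [set f | _] = (fun f => `|L f - h|) @^-1` `]-oo, e[%classic); last first.
  by apply/seteqP; split=> x; rewrite /= in_itv.
have cL : continuous (fun f => `|L f - h|).
  move=> x; apply: cvg_norm; apply: cvgB; last exact: cvg_cst.
  apply/cvgrPdist_le => e' e'0; have M1 : 0 < M + 1 by rewrite ltr_wpDl.
  move/cvgrPdist_le : (@cvg_id _ (nbhs x)) => /(_ _ (divr_gt0 e'0 M1)); apply: filterS => y Hy.
  rewrite -L_sub (le_trans (LM _))//; apply: (le_trans (ler_wpM2l M0 Hy)).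
  by rewrite mulrCA ger_pMr// ler_pdivrMr// mul1r lerDl.
by move/continuousP : cL; apply; exact: interval_open.
Qed.

Let form_open h (e c : R) : open [set g | b h g + e * `|g| < c].
Proof.
rewrite (_ : [set g | _] = (fun g => b h g + e * `|g|) @^-1` `]-oo, c[%classic); last first.
  by apply/seteqP; split=> x; rewrite /= in_itv.
have cL : continuous (fun g => b h g + e * `|g|).
  have cb : continuous (b h).
    by rewrite (_ : b h = fun g => b g h); [exact: form_continuous|apply/funext => g].
  by move=> x; apply: (cvgD (cb x)); apply: cvgMl_tmp; apply: cvg_norm; exact: cvg_id.
by move/continuousP : cL; apply; exact: interval_open.
Qed.

(* Each sublevel set is a countable union of open rectangles because the range of
   [L] is separable; [H] itself need not be. *)
Lemma operator_form_measurable : measurable_fun setT (fun p : BH * BH => b (L p.1) p.2).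
Proof.
have [s Hs] := Lsep.
apply: (measurability _ (RGenInftyO.measurableE R)) => _ [_ [c ->] <-]; rewrite setTI.
rewrite (_ : _ @^-1` _ = \bigcup_k \bigcup_j
    ([set f : BH | `|L f - s k| < 2^-1 ^+ j] `*` [set g : BH | b (s k) g + 2^-1 ^+ j * `|g| < c])).
  apply: bigcupT_measurable => k; apply: bigcupT_measurable => j.
  by apply: measurableX; apply: open_borel; [exact: L_dist_open|exact: form_open].
apply/seteqP; split=> [[f g]|[f g] [k _ [j _ [/= h1 h2]]]]; rewrite /= in_itv /=; last first.
  apply: le_lt_trans h2; rewrite -lerBlDl -(form_sub b_lin).
  rewrite (le_trans (ler_norm _))// (le_trans (b_bound _ _))// ler_wpM2r// ltW//.
move=> fg; have [j Hj] : exists j, 2 * 2^-1 ^+ j * `|g| < c - b (L f) g.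
  have h : (2 * `|g| * 2^-1 ^+ k @[k --> \oo] --> 2 * `|g| * (0 : R)).
    by apply: cvgMl_tmp; apply: cvg_expr; rewrite gtr0_norm// invf_lt1// ltr1n.
  rewrite mulr0 in h; have cb : 0 < c - b (L f) g by rewrite subr_gt0.
  move/cvgrPdist_lt : h => /(_ _ cb) [j _ /(_ j (leqnn j))] /=.
  by rewrite sub0r normrN ger0_norm ?mulr_ge0 ?exprn_ge0// mulrAC => Hj; exists j.
have j0 : 0 < 2^-1 ^+ j :> R by rewrite exprn_gt0.
have [k Hk] := Hs f _ j0; exists k => //; exists j => //; split=> //=.
have := b_bound (s k - L f) g; rewrite (form_sub b_lin) (distrC (s k)) => /(le_trans (ler_norm _)).
have := ler_wpM2r (normr_ge0 g) (ltW Hk) => a2 a1.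
move: (le_trans a1 a2) Hj; set u := 2^-1 ^+ j * `|g|; rewrite -(mulrA 2) -/u; lra.
Qed.

Local Open Scope ereal_scope.

(** Integrate over $f$ the conditional probability in $g$. That probability is small unless
    $|\langle f,w\rangle|$ is, with $w=LCk$, and $\langle f,w\rangle$ is a Gaussian whose variance
    is bounded below by $\beta^2$; [level_bound] balances the two effects over $n+1$ scales. *)
Lemma product_small_ball (k : H) (beta D eta : R) (n : nat) :
  (0 < beta)%R -> (beta ^+ 2 <= b (C (L (C k))) (L (C k)))%R -> (0 < D)%R -> (0 < eta)%R -> (eta <= 1)%R ->
  (gamma \x gamma) [set p : BH * BH | (`|b (L p.1) p.2| < D * eta ^+ n.+1)%R] <=
  (((4 * (b (C k) k + 1) * D + 1) * (4 / beta) * n.+1%:R + 4 * (b (C k) k + 1) * D) * eta ^+ n)%:E.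
Proof.
move=> beta0 Hbeta D0 eta0 eta1; set w := L (C k); set e := (D * eta ^+ n.+1)%R.
have e0 : (0 < e)%R by rewrite mulr_gt0// exprn_gt0.
have ck0 := covariance_ge0 k; set A := (4 * (b (C k) k + 1) * D)%R.
have A0 : (0 <= A)%R by rewrite mulr_ge0 ?(ltW D0)// mulr_ge0// addr_ge0.
have gle1 (Z : set BH) : measurable Z -> (fine (gamma Z) <= 1)%R.
  by move=> mZ; rewrite -lee_fin fineK ?fin_num_measure// probability_le1.
pose E := [set p : BH * BH | (`|b (L p.1) p.2| < e)%R].
have xE f : xsection E f = [set g : H | (`|b g (L f)| < e)%R].
  by apply/seteqP; split=> g; rewrite /xsection /= ?inE /E /= ?inE/= bC.
(* $\langle f,w\rangle^2=\langle Ck,Lf\rangle^2\le\langle Ck,k\rangle\langle CLf,Lf\rangle$ bounds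
   the conditional variance from below. In [A], the number $\langle Ck,k\rangle+1$ stands for an
   upper bound of the square root. *)
have small f : (fine (gamma (xsection E f)) * `|b f w| <= A * eta ^+ n.+1)%R.
  rewrite xE; set q0 := fine _.
  have p0 : (0 <= q0)%R by rewrite fine_ge0.
  have h1 := gaussian_small_ball (L f) e0; rewrite -/q0 in h1.
  have h2 := covariance_cauchy_schwarz k (L f).
  have wE : b f w = b (C k) (L f) by rewrite bC /w Lsym bC.
  rewrite -wE in h2.
  have l0 : (0 <= q0 * `|b f w|)%R by exact: mulr_ge0.
  have r0 : (0 <= A * eta ^+ n.+1)%R by apply: mulr_ge0 => //; apply: exprn_ge0; exact: ltW.
  rewrite -(ler_sqr (l0 : _ \is Num.nneg) (r0 : _ \is Num.nneg)).
  rewrite exprMn real_normK ?num_real//.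
  apply: (@le_trans _ _ (q0 ^+ 2 * (b (C k) k * b (C (L f)) (L f)))%R).
    by rewrite ler_wpM2l ?sqr_ge0.
  rewrite mulrCA; apply: (le_trans (ler_wpM2l ck0 h1)).
  have -> : ((A * eta ^+ n.+1) ^+ 2 = (b (C k) k + 1) ^+ 2 * (4 * e) ^+ 2)%R by rewrite /A /e; ring.
  by rewrite ler_wpM2r ?sqr_ge0//; move: ck0; set q := b _ _; nra.
have wball t : (0 < t)%R -> (fine (gamma [set f : H | (`|b f w| < t)%R]) <= 4 / beta * t)%R.
  move=> t0; pose gw := fine (gamma [set f : H | (`|b f w| < t)%R]).
  have gw0 : (0 <= gw)%R by rewrite fine_ge0.
  have hp : (gw ^+ 2 * b (C w) w <= (4 * t) ^+ 2)%R := gaussian_small_ball w t0.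
  rewrite -/gw mulrAC ler_pdivlMr// -ler_sqr ?nnegrE ?mulr_ge0 ?(ltW beta0) ?(ltW t0)//.
  by rewrite exprMn (le_trans _ hp)// ler_wpM2l ?sqr_ge0.
have mB t : measurable ([set f : H | (`|b f w| < t)%R] : set BH) by exact: measurable_small_ball.
pose I j (f : BH) : R := (eta ^+ (n - j) * \1_[set f : H | (`|b f w| < eta ^+ j)%R] f)%R.
have mI j : measurable_fun setT (I j) by apply: measurable_funM => //; exact: measurable_indic.
have I0 j f : (0 <= I j f)%R by rewrite mulr_ge0// exprn_ge0// ltW.
rewrite -[X in X <= _]/(\int[gamma]_f gamma (xsection E f)).
have mE : measurable E.
  have mq : measurable_fun setT (fun p : BH * BH => `|b (L p.1) p.2|%R).
    exact: measurableT_comp operator_form_measurable.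
  rewrite (_ : E = (fun p : BH * BH => `|b (L p.1) p.2|%R) @^-1` `]-oo, e[%classic).
    by rewrite -[X in measurable X]setTI; exact: mq.
  by apply/seteqP; split=> x; rewrite /= in_itv.
apply: (@le_trans _ _ (\int[gamma]_f ((A + 1)%:E * (\sum_(j < n.+1) I j f)%:E + (A * eta ^+ n.+1)%:E))).
  apply: ge0_le_integral => //.
  - exact: measurable_fun_xsection.
  - apply: emeasurable_funD => //; apply: measurable_funeM; apply/measurable_EFinP.
    exact: measurable_sum.
  move=> f _; rewrite -[gamma _]fineK ?fin_num_measure//; last exact: measurable_xsection.
  rewrite -EFinM -EFinD lee_fin.
  apply: (le_trans (level_bound _ _ (normr_ge0 (b f w)) A0 eta0 eta1 (small f))).
  - by rewrite fine_ge0.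
  - by apply: gle1; exact: measurable_xsection.
  rewrite lerD2r ler_wpM2l ?addr_ge0//; apply: ler_sum => j _; rewrite /I indicE.
  rewrite le_eqVlt; apply/orP; left; apply/eqP; congr (_ * _%:R)%R; congr nat_of_bool.
  by apply/idP/idP; rewrite inE.
rewrite ge0_integralD//; last 3 first.
- by move=> f _; rewrite -EFinM lee_fin mulr_ge0 ?addr_ge0// sumr_ge0.
- by apply: measurable_funeM; apply/measurable_EFinP; exact: measurable_sum.
- by move=> f _; rewrite lee_fin mulr_ge0 ?exprn_ge0 ?(ltW eta0).
rewrite integral_cst// [X in _ + _ * X](_ : _ = 1); last exact: (probability_setT gamma).
rewrite mule1 ge0_integralZl//; last 3 first.
- by apply/measurable_EFinP; exact: measurable_sum.
- by move=> f _; rewrite lee_fin sumr_ge0.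
- by rewrite lee_fin addr_ge0.
under eq_integral do rewrite -sumEFin.
rewrite ge0_integral_sum//; last 2 first.
- by move=> j; exact/measurable_EFinP.
- by move=> j f _; rewrite lee_fin.
have Ij (j : 'I_n.+1) : \int[gamma]_f (I j f)%:E <= (4 / beta * eta ^+ n)%:E.
  under eq_integral do rewrite EFinM.
  rewrite ge0_integralZl//; last 2 first.
  - by apply/measurable_EFinP; exact: measurable_indic.
  - by rewrite lee_fin exprn_ge0// ltW.
  rewrite integral_indic// setIT.
  have wj : gamma [set f : H | (`|b f w| < eta ^+ j)%R] <= (4 / beta * eta ^+ j)%:E.
    by rewrite -[X in X <= _]fineK ?fin_num_measure// lee_fin wball// exprn_gt0.
  apply: (le_trans (lee_wpmul2l _ wj)); first by rewrite lee_fin exprn_ge0// ltW.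
  by rewrite -EFinM lee_fin mulrCA -exprD subnK// -ltnS.
apply: (@le_trans _ _ ((A + 1)%:E * \sum_(j < n.+1) (4 / beta * eta ^+ n)%:E + (A * eta ^+ n.+1)%:E)).
  by rewrite leeD2r// lee_wpmul2l ?lee_fin ?addr_ge0//; apply: lee_sum => j _; exact: Ij.
rewrite sumEFin sumr_const card_ord -EFinM -EFinD lee_fin -mulr_natr.
have en : (A * eta ^+ n.+1 <= A * eta ^+ n)%R.
  by rewrite ler_wpM2l// exprS ger_pMl ?exprn_gt0.
by rewrite [leRHS]mulrDl; apply: lerD => //; rewrite le_eqVlt; apply/orP; left; apply/eqP; ring.
Qed.

End operator.
End gaussian_form.

(** * Analytic maps are locally Lipschitz; manifolds have small nets *)

Section analytic_lipschitz.
Context {R : realType} {Y X : normedModType R}.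

Lemma multilinear0 j (F : ('I_j -> Y) -> X) (i : 'I_j) v : multilinear_map F ->
  F [eta v with i |-> 0] = 0.
Proof.
move=> mF; have := mF i v 1 0 0; rewrite scaler0 addr0 scale1r => E.
by apply: (@addrI _ (F [eta v with i |-> 0])); rewrite addr0 -E.
Qed.

Lemma multilinear_scale j (F : ('I_j -> Y) -> X) (v : 'I_j -> Y) (a : R) : multilinear_map F ->
  F (fun i => a *: v i) = a ^+ j *: F v.
Proof.
move=> mF; suff H k : (k <= j)%N ->
    F (fun i : 'I_j => if (i < k)%N then a *: v i else v i) = a ^+ k *: F v.
  rewrite -(H j (leqnn j)); congr F; apply/funext => i; by rewrite ltn_ord.
elim: k => [|k IH] kj; first by rewrite expr0 scale1r.
pose w (i : 'I_j) := if (i < k)%N then a *: v i else v i.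
pose i0 := Ordinal kj; have := mF i0 w a (v i0) 0.
rewrite multilinear0// !addr0 => E; rewrite exprS -scalerA -IH; last exact: ltnW.
transitivity (F [eta w with i0 |-> a *: v i0]).
  congr F; apply/funext => i /=; rewrite /w; case: eqP => [->|/eqP ii]; first by rewrite /= ltnSn.
  by rewrite ltnS leq_eqVlt -[(i == k :> nat)]/(i == i0) (negbTE ii).
rewrite E; congr (_ *: F _); apply/funext => i /=; rewrite /w; case: eqP => [->|//].
by rewrite /= ltnn.
Qed.

Lemma multilinear_bound j (F : ('I_j -> Y) -> X) (h : Y) : multilinear_map F ->
  (multilinear_norm F < +oo)%E -> `|F (fun=> h)| <= fine (multilinear_norm F) * `|h| ^+ j.
Proof.
move=> mF Foo.
have F0 v : (forall i, `|v i| <= 1) -> `|F v| <= fine (multilinear_norm F).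
  move=> v1; have h1 : ((`|F v|)%:E <= multilinear_norm F)%E by apply: ereal_sup_ubound; exists v.
  rewrite -lee_fin fineK// ge0_fin_numE// (le_trans _ h1)// lee_fin//.
have [->|h0] := eqVneq h 0.
  case: j F mF Foo F0 => [|j] F mF Foo F0.
    by rewrite expr0 mulr1; apply: F0 => -[].
  have -> : (fun=> 0 : Y) = fun i : 'I_j.+1 => (0 : R) *: (0 : Y) by apply/funext => i; rewrite scaler0.
  by rewrite (multilinear_scale _ _ mF) normr0 !expr0n/= scale0r normr0 mulr0.
have hn : `|h| != 0 by rewrite normr_eq0.
have -> : (fun=> h) = fun i : 'I_j => `|h| *: (`|h|^-1 *: h).
  by apply/funext => i; rewrite scalerA mulfV// scale1r.
rewrite (multilinear_scale _ _ mF) normrZ mulrC ger0_norm ?exprn_ge0// ler_wpM2r ?exprn_ge0//.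
by apply: F0 => i; rewrite normrZ normfV normr_id mulVf.
Qed.

(** Without its constant term the series is at most $\sum_j\|F_{j+1}\||h|^{j+1}\le(S/r)|h|$, because
    $|h|^{j+1}\le r^j|h|$. *)
Lemma analytic_lipschitz_at (U : set Y) (G : Y -> X) y : real_analytic U G -> U y ->
  exists r L : R, [/\ 0 < r, 0 <= L & forall h, `|h| < r -> `|G (y + h) - G y| <= L * `|h|].
Proof.
move=> aG Uy; have [r [F [r0 mF Foo HF]]] := aG y Uy.
have nn j : (0 <= multilinear_norm (F j))%E.
  apply: le_trans (_ : (`|F j (fun=> 0)|%:E <= _)%E); first by rewrite lee_fin.
  by apply: ereal_sup_ubound; exists (fun=> 0) => // i; rewrite normr0.
have nr j : (0 <= multilinear_norm (F j) * (r ^+ j)%:E)%E.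
  by rewrite mule_ge0// lee_fin exprn_ge0// ltW.
set T := (\sum_(0 <= j <oo) _)%E in Foo.
have Tge m : (\sum_(0 <= j < m) multilinear_norm (F j) * (r ^+ j)%:E <= T)%E.
  by apply: nneseries_lim_ge.
have Fj j : (multilinear_norm (F j) < +oo)%E.
  move: (le_lt_trans (Tge j.+1) Foo); rewrite big_nat_recr//= => h.
  have {}h : (multilinear_norm (F j) * (r ^+ j)%:E < +oo)%E.
    by apply: le_lt_trans h; rewrite leeDr// sume_ge0.
  rewrite ltNge; apply/negP; rewrite leye_eq => /eqP E; move: h.
  by rewrite E gt0_mulye ?lte_fin ?exprn_gt0// ltxx.
pose c j := fine (multilinear_norm (F j)).
have cE j : multilinear_norm (F j) = (c j)%:E by rewrite fineK// ge0_fin_numE.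
have c0 j : 0 <= c j by rewrite fine_ge0.
pose S := fine T; have T0 : (0 <= T)%E by rewrite (le_trans _ (Tge 0%N))// big_nil.
have TE : T = S%:E by rewrite fineK// ge0_fin_numE.
have Sge m : \sum_(0 <= j < m) c j * r ^+ j <= S.
  have := Tge m; rewrite TE; under eq_bigr do rewrite cE -EFinM.
  by rewrite sumEFin lee_fin.
have S0 : 0 <= S by rewrite fine_ge0.
pose F0 := F 0%N (fun=> 0).
have key h : `|h| < r -> `|G (y + h) - F0| <= S / r * `|h|.
  move=> hr; have := HF h hr.
  move=> cv; have cv2 : `|series (fun j => F j (fun=> h)) k - F0| @[k --> \oo] --> `|G (y + h) - F0|.
    by apply: cvg_norm; apply: cvgB => //; exact: cvg_cst.
  apply: (ler_cvg_to cv2 (cvg_cst (S / r * `|h|))); exists 1%N => // -[//|m] _ /=.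
  rewrite /series /= big_nat_recl// (_ : F 0%N (fun=> h) = F0); last first.
    by congr (F 0%N); apply/funext => -[].
  rewrite addrC addKr (le_trans (ler_norm_sum _ _ _))//.
  apply: (@le_trans _ _ (\sum_(0 <= j < m) c j.+1 * r ^+ j.+1 * (`|h| / r))); last first.
    have r0' := ltW r0; rewrite -mulr_suml -mulrA (mulrC r^-1); apply: ler_wpM2r; first exact: divr_ge0.
    apply: le_trans (Sge m.+1); rewrite big_nat_recl// lerDr mulr_ge0 ?exprn_ge0// ltW.
  apply: ler_sum => j _; have [mFj _ _] := mF j.+1.
  apply: (le_trans (multilinear_bound h mFj (Fj _))); rewrite -/(c _) -mulrA ler_wpM2l//.
  have -> : r ^+ j.+1 * (`|h| / r) = r ^+ j * `|h|.
    have rN := lt0r_neq0 r0; rewrite exprSr; move: (r ^+ j) `|h| => q u; by field.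
  by rewrite exprSr ler_wpM2r// lerXn2r ?nnegrE// ltW.
have F0E : G y = F0.
  have := key 0; rewrite normr0 => /(_ r0); rewrite mulr0 addr0 normr_le0 subr_eq0 => /eqP//.
exists r, (S / r); split=> //; first by rewrite divr_ge0// ltW.
by move=> h hr; rewrite F0E; exact: key.
Qed.

End analytic_lipschitz.

Section net_dim.
Context {R : realType} {X : normedModType R}.

(* Box dimension at most [d], with all centres inside the set that is covered. *)
Definition net_dim d (A : set X) := exists2 K : R, 0 < K &
  forall (B : set X) (Q : nat), B !=set0 -> B `<=` A -> (0 < Q)%N ->
  exists t : {ffun 'I_d -> 'I_Q} -> X, (forall c, B (t c)) /\
    forall x, B x -> exists c, `|x - t c| <= K / Q%:R.

(** A chart is Lipschitz at each parameter with a constant depending on that parameter. Sorting the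
    parameters by the size of the constant gives countably many pieces, each the image of a bounded
    set under a uniformly Lipschitz map, so [finite_net] carries over. *)
Lemma manifold_net d (M : set X) a : analytic_manifold d M -> M a ->
  exists (W : set X) (A : nat -> set X), [/\ open W, W a, M `&` W `<=` \bigcup_N A N,
    forall N, A N `<=` M & forall N, net_dim d (A N)].
Proof.
move=> mM Ma; have [V [phi [oV aphi _ [_ _ Va Vopen]]]] := mM a Ma.
have [W oW VW] := Vopen V oV (@subset_refl _ V).
(* The Lipschitz bound is imposed against every [s'] with bounded image, not only nearby ones. For
   distant [s'] the bound $2(N+1)$ on the difference suffices once $(N+1)r\ge2$. *)
pose T (N : nat) : set 'rV[R]_d := [set s | [/\ V s, `|s| < N.+1%:R, `|phi s| <= N.+1%:R &
  forall s', V s' -> `|phi s'| <= N.+1%:R -> `|phi s' - phi s| <= N.+1%:R ^+ 2 * `|s' - s|]].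
exists W, (fun N => phi @` T N); split=> //.
- have : (M `&` W) a by rewrite -VW.
  by case.
- rewrite -VW => _ [s Vs <-].
  have [r [L [r0 L0 HL]]] := analytic_lipschitz_at aphi Vs.
  pose B := L + `|s| + `|phi s| + 2 / r.
  have B0 : 0 <= B by rewrite !addr_ge0// divr_ge0// ltW.
  exists (Num.truncn B) => //; exists s => //.
  have NB := truncnS_gt B; move: NB; set N := (Num.truncn B).+1%:R => NB.
  have N1 : 1 <= N by rewrite ler1n.
  have r2 : 0 <= 2 / r by rewrite divr_ge0// ltW.
  have [s0 p0] := (normr_ge0 s, normr_ge0 (phi s)).
  split=> //; [by move: NB; rewrite /B; lra|by move: NB; rewrite /B; lra|].
  move=> s' Vs' ps'; have [h|h] := ltP `|s' - s| r.
    have := HL _ h; rewrite (addrC s) subrK => /le_trans; apply; rewrite ler_wpM2r//.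
    have : L <= N by move: NB; rewrite /B; lra.
    move=> LN; rewrite expr2 (le_trans LN)// ler_peMl//; lra.
  apply: (@le_trans _ _ (N + N)); first by rewrite (le_trans (ler_normB _ _))// lerD//; move: NB; rewrite /B; lra.
  apply: (@le_trans _ _ (N ^+ 2 * r)); last by rewrite ler_wpM2l ?sqr_ge0.
  have Nr : 2 <= N * r by rewrite -ler_pdivrMr//; move: NB; rewrite /B; lra.
  by rewrite expr2; nra.
- move=> N _ [s [Vs _ _ _] <-]; have : (phi @` V) (phi s) by exists s.
  by rewrite VW => -[].
move=> N; exists (N.+1%:R ^+ 2 * (N.+1%:R *+ 2)); first by rewrite mulr_gt0 ?exprn_gt0 ?mulrn_wgt0.
move=> B Q [x0 Bx0] BA Q0; pose T' := [set s | T N s /\ B (phi s)].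
have T'0 : T' !=set0 by have [s Ts sx] := BA _ Bx0; exists s; split=> //; rewrite sx.
have N0 : 0 < N.+1%:R :> R by [].
have T'b : T' `<=` ball (0 : 'rV[R]_d) N.+1%:R.
  by move=> s [[_ sN _ _] _]; rewrite -ball_normE /= sub0r normrN.
have [t [tT tn]] := finite_net N0 Q0 T'0 T'b.
exists (fun c => phi (t c)); split=> [c|x Bx]; first by have [] := tT c.
have [s Ts sx] := BA _ Bx; have [|c sc] := tn s; first by split=> //; rewrite sx.
have [[Vs _ ps _] [[_ _ _ Hc] _]] := (Ts, tT c).
exists c; rewrite -sx (le_trans (Hc _ Vs ps))// -mulrA ler_wpM2l// sqr_ge0//.
Qed.

End net_dim.

(** * Null sets, union bounds and independence *)

Lemma negligible_eps d (T : measurableType d) (R : realType) (P : {measure set T -> \bar R}) (A : set T) :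
  (forall e : R, 0 < e -> exists B, [/\ measurable B, A `<=` B & (P B <= e%:E)%E]) -> P.-negligible A.
Proof.
move=> H; have ex k : exists B, [/\ measurable B, A `<=` B & (P B <= (k.+1%:R^-1 : R)%:E)%E].
  by apply: H; rewrite invr_gt0.
pose B k := projT1 (cid (ex k)); have HB k := projT2 (cid (ex k)).
have mB : measurable (\bigcap_k B k) by apply: bigcapT_measurable => k; have [] := HB k.
exists (\bigcap_k B k); split => //; last by move=> x Ax k _; have [_ + _] := HB k; apply.
apply/eqP; rewrite eq_le measure_ge0 andbT; apply/lee_addgt0Pr => e e0; rewrite add0e.
pose k := Num.truncn e^-1; have [mBk _ Pk] := HB k.
apply: (@le_trans _ _ (P (B k))).
  by apply: le_measure; rewrite ?inE//; exact: bigcap_inf.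
apply: (le_trans Pk); rewrite lee_fin -[leRHS]invrK lef_pV2 ?posrE ?invr_gt0//.
exact/ltW/truncnS_gt.
Qed.

Lemma measure_bigsetU_le d (T : measurableType d) (R : realType) (P : {measure set T -> \bar R})
    (I : Type) (s : seq I) (F : I -> set T) : (forall i, measurable (F i)) ->
  (P (\big[setU/set0]_(i <- s) F i) <= \sum_(i <- s) P (F i))%E.
Proof.
move=> mF; elim: s => [|i s IH]; first by rewrite !big_nil measure0.
rewrite !big_cons; apply: (le_trans (measureU2 _ (mF i) _)); last exact: leeD2l.
exact: bigsetU_measurable.
Qed.

(** Since $c\le1$, the exponent may be lowered from the number of samples to [k]. *)
Lemma independent_bound d (S : measurableType d) (R : realType) (P : probability S R)
    d' (T : measurableType d') N (X : 'I_N -> {RV P >-> T}) (nu : {measure set T -> \bar R})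
    (A : set T) (c : R) k :
  mutually_independent X -> (forall i, has_law (X i) nu) -> measurable A -> (nu A <= c%:E)%E ->
  0 <= c -> c <= 1 -> (k <= N)%N ->
  measurable (\bigcap_(i in [set: 'I_N]) X i @^-1` A) /\
  (P (\bigcap_(i in [set: 'I_N]) X i @^-1` A) <= (c ^+ k)%:E)%E.
Proof.
move=> ind law mA nuA c0 c1 kN.
have mX i : measurable (X i @^-1` A) by rewrite -[X in measurable X]setTI; exact: measurable_funP.
split; first by apply: fin_bigcap_measurable => //; exact: finite_finset.
have := ind [set: 'I_N]%SET (fun=> A) (fun=> mA).
rewrite (_ : [set` [set: 'I_N]%SET] = [set: 'I_N]); last by apply/seteqP; split=> i //= _; rewrite inE.
move=> ->; pose p := fine (nu A).
have pE : nu A = p%:E by rewrite fineK// ge0_fin_numE// (le_lt_trans nuA)// ltry.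
have p0 : 0 <= p by rewrite fine_ge0.
rewrite (eq_bigr (fun=> p%:E)) => [|i _]; last by rewrite -pE; exact: (law i).
rewrite prodEFin prodr_const cardsT card_ord lee_fin.
have pc : p <= c by rewrite -lee_fin -pE.
apply: (@le_trans _ _ (c ^+ N)); first by rewrite lerXn2r ?nnegrE.
exact: ler_wiXn2l.
Qed.

(** With $2d=n-1$ the exponent of $q$ is $(n+1)(n-1)-n^2=-1$; this is where $2d+1$ samples are just
    enough. *)
Lemma covering_count (R : realFieldType) (q G : R) (d n : nat) : 0 < q -> n = (2 * d + 1)%N ->
  (q ^+ n.+1) ^+ d * (q ^+ n.+1) ^+ d * (G * q^-1 ^+ n) ^+ n = G ^+ n / q.
Proof.
move=> q0 nE; have qN : q != 0 by exact: lt0r_neq0.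
rewrite -exprD -exprM exprMn -exprM mulrCA; congr (_ * _).
have -> : (n * n = n.+1 * (d + d) + 1)%N.
  by rewrite nE mul2n -addnn; move: (d + d)%N => m; rewrite addn1 mulSn mulnS addn1 [in RHS]mulSn; ring.
by rewrite exprVn exprD expr1 invfM mulrA mulfV ?mul1r// expf_neq0.
Qed.

(** * The covering argument *)

Section embedding.
Context {R : realType} {H : normedModType R} {X : normedModType R}.
Local Notation BH := (borel H).
Variable b : H -> H -> R.
Hypotheses (bC : forall f g, b f g = b g f)
  (b_lin : forall a f g h, b (a *: f + g) h = a * b f h + b g h)
  (b_norm : forall f, b f f = `|f| ^+ 2) (b_bound : forall f g, `|b f g| <= `|f| * `|g|).
Variables (gamma : probability BH R) (C : H -> H).
Hypotheses (gG : gaussian_measure gamma) (C_inj : injective C)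
  (CE : forall h k, (b (C h) k)%:E = covariance gamma (fun x : H => b x h) (fun x : H => b x k)).
Variables (Pos : set X) (Lam : X -> H -> H).
Hypotheses (Lam_sym : forall s, Pos s -> forall f g, b (Lam s f) g = b (Lam s g) f)
  (Lam_bound : forall s, Pos s -> exists2 M : R, 0 <= M & forall f, `|Lam s f| <= M * `|f|)
  (Lam_sep : forall s, Pos s -> exists u : nat -> H, forall f (e : R), 0 < e ->
     exists k, `|Lam s f - u k| < e)
  (Lam_lip : forall a, Pos a -> exists r K : R, [/\ 0 < r, 0 <= K, forall s, `|s - a| < r -> Pos s &
     forall s t, `|s - a| < r -> `|t - a| < r -> forall f g,
       `|b (Lam s f) g - b (Lam t f) g| <= K * `|s - t| * (`|f| * `|g|)]).

Let D (s t : X) (f : H) : H := Lam s f - Lam t f.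

Let D_form s t f g : b (D s t f) g = b (Lam s f) g - b (Lam t f) g.
Proof. exact: (form_sub b_lin). Qed.

Let D_sym s t : Pos s -> Pos t -> forall f g, b (D s t f) g = b (D s t g) f.
Proof. by move=> ps pt f g; rewrite !D_form (Lam_sym ps) (Lam_sym pt). Qed.

Let D_bound s t : Pos s -> Pos t -> exists2 M : R, 0 <= M & forall f, `|D s t f| <= M * `|f|.
Proof.
move=> ps pt; have [M1 M10 H1] := Lam_bound ps; have [M2 M20 H2] := Lam_bound pt.
exists (M1 + M2); first exact: addr_ge0.
by move=> f; rewrite (le_trans (ler_normB _ _))// mulrDl lerD.
Qed.

Let D_sep s t : Pos s -> Pos t ->
  exists u : nat -> H, forall f (e : R), 0 < e -> exists k, `|D s t f - u k| < e.
Proof.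
move=> ps pt; have [u1 H1] := Lam_sep ps; have [u2 H2] := Lam_sep pt.
exists (fun k => if unpickle k is Some ij then u1 (ij : nat * nat).1 - u2 ij.2 else 0) => f e e0.
have e2 : 0 < e / 2 by rewrite divr_gt0.
have [i Hi] := H1 f _ e2; have [j Hj] := H2 f _ e2.
exists (pickle (i, j)); rewrite pickleK/= /D.
have -> : Lam s f - Lam t f - (u1 i - u2 j) = (Lam s f - u1 i) - (Lam t f - u2 j).
  rewrite !opprB -!addrA; congr (_ + _).
  by rewrite addrCA [RHS]addrCA [- Lam t f + _]addrC.
by rewrite (le_lt_trans (ler_normB _ _))// [ltRHS](splitr e) ltrD.
Qed.

Let D_measurable s t (e : R) : Pos s -> Pos t ->
  measurable ([set p | `|b (D s t p.1) p.2| < e] : set (BH * BH)).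
Proof.
move=> ps pt; have [M M0 HM] := D_bound ps pt.
have mq : measurable_fun setT (fun p : BH * BH => `|b (D s t p.1) p.2|).
  exact: measurableT_comp (operator_form_measurable bC b_lin b_norm b_bound (D_sym ps pt) M0 HM (D_sep ps pt)).
rewrite (_ : mkset _ = (fun p : BH * BH => `|b (D s t p.1) p.2|) @^-1` `]-oo, e[%classic).
  by rewrite -[X in measurable X]setTI; exact: mq.
by apply/seteqP; split=> x; rewrite /= in_itv.
Qed.

(** Otherwise $AC=0$ for $A$ = [D a1 a2], so $\langle CAh,Ah\rangle=\langle ACAh,h\rangle=0$ and
    $Ah=0$ for every $h$. *)
Let nondegenerate a1 a2 : Pos a1 -> Pos a2 -> Lam a1 <> Lam a2 ->
  exists k, b (C (D a1 a2 (C k))) (D a1 a2 (C k)) != 0.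
Proof.
move=> p1 p2 L12; apply: contrapT => nex; apply: L12; apply/funext => h.
have c0 k : D a1 a2 (C k) = 0.
  apply: (covariance_nondegenerate bC b_lin b_norm C_inj CE).
  by apply: contrapT => /eqP ck; apply: nex; exists k.
apply/eqP; rewrite -subr_eq0; apply/eqP.
apply: (covariance_nondegenerate bC b_lin b_norm C_inj CE).
rewrite -/(D a1 a2 h) bC D_sym// c0.
by have := form_sub b_lin 0 0 h; rewrite !subrr.
Qed.

Section sampling.
Context disp (S : measurableType disp) (P : probability S R) (N d : nat)
  (fg : 'I_N -> {RV P >-> (BH * BH)%type}).
Hypotheses (indep : mutually_independent fg) (law : forall i, has_law (fg i) (gamma \x gamma)%E)
  (dN : (2 * d + 1 <= N)%N).

Definition indistinguishable (B1 B2 : set X) (w : S) := exists s t, [/\ B1 s, B2 t &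
  forall i, b (Lam s (fg i w).1) (fg i w).2 = b (Lam t (fg i w).1) (fg i w).2].

(** If $s$ and $t$ give equal measurements, then their centres give measurements that differ by
    $O(q^{-(n+1)})$ when the sample norms are at most [m]. The union bound over pairs of centres,
    with [product_small_ball] and independence, is $G^n/q$. *)
Lemma indistinguishable_piece (B1 B2 : set X) (K1 K2 beta m : R) (k : H) :
  B1 `<=` Pos -> B2 `<=` Pos -> net_dim d B1 -> net_dim d B2 -> 0 <= K1 -> 0 <= K2 ->
  (forall s t, B1 s -> B1 t -> forall f g,
     `|b (Lam s f) g - b (Lam t f) g| <= K1 * `|s - t| * (`|f| * `|g|)) ->
  (forall s t, B2 s -> B2 t -> forall f g,
     `|b (Lam s f) g - b (Lam t f) g| <= K2 * `|s - t| * (`|f| * `|g|)) ->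
  0 < beta -> (forall s t, B1 s -> B2 t -> beta ^+ 2 <= b (C (D s t (C k))) (D s t (C k))) ->
  P.-negligible [set w | (forall i, `|(fg i w).1 : H| <= m /\ `|(fg i w).2 : H| <= m) /\
    indistinguishable B1 B2 w].
Proof.
move=> B1P B2P [k1 k10 net1] [k2 k20 net2] K10 K20 lip1 lip2 beta0 Hbeta.
have [B1ne|B1e] := pselect (B1 !=set0); last first.
  apply: negligibleS (negligible_set0 P) => w [_ [s [t [B1s _ _]]]].
  by apply: B1e; exists s.
have [B2ne|B2e] := pselect (B2 !=set0); last first.
  apply: negligibleS (negligible_set0 P) => w [_ [s [t [_ B2t _]]]].
  by apply: B2e; exists t.
(* [Dl] times the net scale bounds the error of replacing both conductivities by their centres; the
   summand $1$ makes the bound strict. *)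
pose n := (2 * d + 1)%N; pose Dl := (K1 * k1 + K2 * k2) * m ^+ 2 + 1.
have Dl0 : 0 < Dl.
  by rewrite ltr_wpDl// mulr_ge0 ?sqr_ge0// addr_ge0// mulr_ge0// ltW.
have ck0 := covariance_ge0 CE k.
pose G := (4 * (b (C k) k + 1) * Dl + 1) * (4 / beta) * n.+1%:R + 4 * (b (C k) k + 1) * Dl.
have c1 : 0 <= 4 * (b (C k) k + 1) * Dl by rewrite mulr_ge0 ?(ltW Dl0)// mulr_ge0// addr_ge0.
have G0 : 0 <= G.
  apply: addr_ge0 => //; apply: mulr_ge0 => //; apply: mulr_ge0; first exact: addr_ge0.
  by rewrite divr_ge0// ltW.
apply: negligible_eps => e e0.
(* $q>G$ makes the single-sample bound at most $1$, as [independent_bound] requires, and $q>G^n/e$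
   makes the total at most [e]. *)
pose qn := (Num.truncn (G + G ^+ n / e)).+1; pose q : R := qn%:R.
have q0 : 0 < q by rewrite ltr0n.
have qG : G + G ^+ n / e < q by exact: truncnS_gt.
have Ge0 : 0 <= G ^+ n / e by rewrite divr_ge0 ?exprn_ge0// ltW.
have eta0 : 0 < q^-1 by rewrite invr_gt0.
have eta1 : q^-1 <= 1 by rewrite invf_le1// ler1n.
pose Q := (qn ^ n.+1)%N; have Q0 : (0 < Q)%N by rewrite expn_gt0.
have [t1 [t1B t1n]] := net1 B1 Q B1ne (@subset_refl _ B1) Q0.
have [t2 [t2B t2n]] := net2 B2 Q B2ne (@subset_refl _ B2) Q0.
pose I := ({ffun 'I_d -> 'I_Q} * {ffun 'I_d -> 'I_Q})%type.
pose E (c : I) := [set p : BH * BH | `|b (D (t1 c.1) (t2 c.2) p.1) p.2| < Dl * q^-1 ^+ n.+1].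
have P1 c := B1P _ (t1B c); have P2 c := B2P _ (t2B c).
have mE c : measurable (E c) by exact: D_measurable.
have EP c : ((gamma \x gamma) (E c) <= (G * q^-1 ^+ n)%:E)%E.
  have [M M0 HM] := D_bound (P1 c.1) (P2 c.2).
  have h := (product_small_ball bC b_lin b_norm b_bound gG CE (D_sym (P1 c.1) (P2 c.2)) M0 HM
    (D_sep (P1 c.1) (P2 c.2)) n beta0 (Hbeta _ _ (t1B c.1) (t2B c.2)) Dl0 eta0 eta1).
  exact: h.
have Gq0 : 0 <= G * q^-1 ^+ n by rewrite mulr_ge0// exprn_ge0// ltW.
have Gq1 : G * q^-1 ^+ n <= 1.
  rewrite /n addn1 exprS mulrA; apply: mulr_ile1.
  - by rewrite mulr_ge0// ltW.
  - by rewrite exprn_ge0// ltW.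
  - by rewrite ler_pdivrMr// mul1r; move: qG; lra.
  - by rewrite exprn_ile1// ltW.
have ib c := independent_bound indep law (mE c) (EP c) Gq0 Gq1 dN.
exists (\big[setU/set0]_(c <- index_enum I) \bigcap_(i in [set: 'I_N]) fg i @^-1` E c); split.
- by apply: bigsetU_measurable => c _; exact: (ib c).1.
- move=> w [wm [s [t [B1s B2t st]]]].
  have [c1' Hc1] := t1n s B1s; have [c2' Hc2] := t2n t B2t.
  rewrite -bigcup_seq; exists (c1', c2'); first by rewrite /= mem_index_enum.
  move=> i _; rewrite /E /=; set f := (fg i w).1; set g := (fg i w).2.
  have [fm gm] : `|f : H| <= m /\ `|g : H| <= m by exact: wm.
  have fgm : `|f : H| * `|g : H| <= m ^+ 2 by rewrite expr2 ler_pM.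
  have QE : Q%:R = q ^+ n.+1 :> R by rewrite /Q natrX.
  have l1 := lip1 _ _ B1s (t1B c1') f g; have l2 := lip2 _ _ B2t (t2B c2') f g.
  have x1 : K1 * `|s - t1 c1'| * (`|f : H| * `|g : H|) <= K1 * (k1 / Q%:R) * m ^+ 2.
    by apply: ler_pM; [rewrite mulr_ge0|rewrite mulr_ge0|rewrite ler_wpM2l|exact: fgm].
  have x2 : K2 * `|t - t2 c2'| * (`|f : H| * `|g : H|) <= K2 * (k2 / Q%:R) * m ^+ 2.
    by apply: ler_pM; [rewrite mulr_ge0|rewrite mulr_ge0|rewrite ler_wpM2l|exact: fgm].
  rewrite D_form (_ : _ - _ = (b (Lam t f) g - b (Lam (t2 c2') f) g) - (b (Lam s f) g - b (Lam (t1 c1') f) g)); last first.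
    by rewrite (st i) -/f -/g; ring.
  apply: (le_lt_trans (ler_normB _ _)); apply: (le_lt_trans (lerD (le_trans l2 x2) (le_trans l1 x1))).
  rewrite exprVn -QE /Dl mulrDl mul1r.
  have -> : K2 * (k2 / Q%:R) * m ^+ 2 + K1 * (k1 / Q%:R) * m ^+ 2 = (K1 * k1 + K2 * k2) * m ^+ 2 / Q%:R.
    by move: (Q%:R^-1) => z; ring.
  by rewrite ltrDl invr_gt0 ltr0n.
apply: (le_trans (measure_bigsetU_le _ _ (fun c => (ib c).1))).
apply: (@le_trans _ _ (\sum_(c <- index_enum I) ((G * q^-1 ^+ n) ^+ n)%:E)%E).
  by apply: lee_sum => c _; exact: (ib c).2.
rewrite sumEFin lee_fin sumr_const card_prod !card_ffun !card_ord -mulr_natl natrM !natrX.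
rewrite (covering_count _ q0 (erefl n)) ler_pdivrMr// mulrC -ler_pdivrMr//.
by move: qG; lra.
Qed.

(** The direction [k] found at $(a_1,a_2)$ serves all nearby pairs: $\langle Cw_0,w\rangle$ is
    Lipschitz in $(s,t)$ and equals [q] at $(a_1,a_2)$, so it stays above $q/2$ for a small [r]. *)
Let local_data a1 a2 : Pos a1 -> Pos a2 -> Lam a1 <> Lam a2 -> exists (r K beta : R) (k : H),
  [/\ 0 < r, 0 <= K, 0 < beta &
  [/\ forall s, `|s - a1| < r -> Pos s, forall s, `|s - a2| < r -> Pos s,
    forall s t, `|s - a1| < r -> `|t - a1| < r -> forall f g,
       `|b (Lam s f) g - b (Lam t f) g| <= K * `|s - t| * (`|f| * `|g|),
    forall s t, `|s - a2| < r -> `|t - a2| < r -> forall f g,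
       `|b (Lam s f) g - b (Lam t f) g| <= K * `|s - t| * (`|f| * `|g|) &
    forall s t, `|s - a1| < r -> `|t - a2| < r ->
       beta ^+ 2 <= b (C (D s t (C k))) (D s t (C k))]].
Proof.
move=> p1 p2 L12; have [k k0] := nondegenerate p1 p2 L12.
have [r1 [K1 [r10 K10 pos1 lip1]]] := Lam_lip p1.
have [r2 [K2 [r20 K20 pos2 lip2]]] := Lam_lip p2.
pose w0 := D a1 a2 (C k); pose q := b (C w0) w0.
have q0 : 0 < q by rewrite lt0r k0 (covariance_ge0 CE).
pose K := K1 + K2; have K0 : 0 <= K by exact: addr_ge0.
pose Z := K * (`|C k| * `|C w0|) *+ 2 + 1.
have Z0 : 0 < Z by rewrite ltr_wpDl// mulrn_wge0// !mulr_ge0.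
pose r := Num.min r1 (Num.min r2 (q / 2 / Z)).
have qZ : 0 < q / 2 / Z by rewrite !divr_gt0.
have r0 : 0 < r by rewrite !lt_min r10 r20.
have rr1 x : x < r -> x < r1 by rewrite /r lt_min => /andP[].
have rr2 x : x < r -> x < r2 by rewrite /r !lt_min => /and3P[].
have rrZ x : x < r -> x < q / 2 / Z by rewrite /r !lt_min => /and3P[].
have KK1 x : 0 <= x -> K1 * x <= K * x by move=> x0; rewrite ler_wpM2r// lerDl.
have KK2 x : 0 <= x -> K2 * x <= K * x by move=> x0; rewrite ler_wpM2r// lerDr.
have L1 s t : `|s - a1| < r -> `|t - a1| < r -> forall f g,
    `|b (Lam s f) g - b (Lam t f) g| <= K * `|s - t| * (`|f| * `|g|).
  move=> /rr1 h1 /rr1 h2 f g; apply: (le_trans (lip1 _ _ h1 h2 f g)).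
  by apply: ler_wpM2r; [exact: mulr_ge0|exact: KK1].
have L2 s t : `|s - a2| < r -> `|t - a2| < r -> forall f g,
    `|b (Lam s f) g - b (Lam t f) g| <= K * `|s - t| * (`|f| * `|g|).
  move=> /rr2 h1 /rr2 h2 f g; apply: (le_trans (lip2 _ _ h1 h2 f g)).
  by apply: ler_wpM2r; [exact: mulr_ge0|exact: KK2].
(* $(q/2)^2\le\langle Cw_0,w\rangle^2\le q\langle Cw,w\rangle$ gives $\langle Cw,w\rangle\ge q/4$,
   hence this value of [beta]. *)
exists r, K, (Num.sqrt q / 2), k; split=> //; first by rewrite divr_gt0// sqrtr_gt0.
split=> //; [by move=> s /rr1; exact: pos1|by move=> s /rr2; exact: pos2|].
move=> s t sr tr; pose w := D s t (C k); rewrite -/w.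
have ps := pos1 s (rr1 _ sr); have pt := pos2 t (rr2 _ tr).
have aa1 : `|a1 - a1| < r by rewrite subrr normr0.
have aa2 : `|a2 - a2| < r by rewrite subrr normr0.
have l1 := L1 _ _ sr aa1 (C k) (C w0); have l2 := L2 _ _ tr aa2 (C k) (C w0).
have dw : `|b w (C w0) - b w0 (C w0)| <= q / 2.
  rewrite !D_form (_ : _ - _ = (b (Lam s (C k)) (C w0) - b (Lam a1 (C k)) (C w0)) -
    (b (Lam t (C k)) (C w0) - b (Lam a2 (C k)) (C w0))); last by ring.
  apply: (le_trans (ler_normB _ _)); apply: (le_trans (lerD l1 l2)).
  set u := `|C k| * `|C w0|; have u0 : 0 <= u by exact: mulr_ge0.
  have h1 := ltW (rrZ _ sr); have h2 := ltW (rrZ _ tr).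
  have Ku : 0 <= K * u by exact: mulr_ge0.
  apply: (@le_trans _ _ (K * u * (q / 2 / Z) + K * u * (q / 2 / Z))).
    by apply: lerD; rewrite mulrAC; exact: ler_wpM2l.
  rewrite -mulr2n -mulrnAl mulrA ler_pdivrMr// mulrC ler_wpM2l//; first by rewrite divr_ge0// ltW.
  by rewrite /Z lerDl.
have wq : q / 2 <= b (C w0) w.
  move: dw; rewrite !(bC _ (C w0)) -/q ler_norml => /andP[h _].
  by move: h; set x := b _ w; lra.
have cs := covariance_cauchy_schwarz bC b_lin CE w0 w; rewrite -/q in cs.
rewrite exprMn sqr_sqrtr ?(ltW q0)// -(ler_pM2l q0); apply: le_trans cs.
apply: (@le_trans _ _ ((q / 2) ^+ 2)); first by rewrite le_eqVlt; apply/orP; left; apply/eqP; field.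
by rewrite lerXn2r ?nnegrE ?divr_ge0 ?(ltW q0)// (le_trans _ wq)// divr_ge0// ltW.
Qed.

Variable M : set X.
Hypotheses (mM : analytic_manifold d M) (M2 : second_countable_set M)
  (Lam_inj : set_inj (Pos `&` M) Lam).

(** A countable union of null sets from [indistinguishable_piece]: over the pieces of the two nets,
    and over the integer bounds on the norms of the samples. *)
Lemma indistinguishable_local a1 a2 : (Pos `&` M) a1 -> (Pos `&` M) a2 -> a1 <> a2 ->
  exists U1 U2 : set X, [/\ open U1, open U2, U1 a1, U2 a2 &
    P.-negligible (indistinguishable (M `&` U1) (M `&` U2))].
Proof.
move=> [p1 M1] [p2 M2'] a12.
have L12 : Lam a1 <> Lam a2 by move=> E; apply: a12; apply: Lam_inj E; rewrite inE.
have [r [K [beta [k [r0 K0 beta0 [pos1 pos2 lip1 lip2 Hbeta]]]]]] := local_data p1 p2 L12.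
have [W1 [A1 [oW1 W1a W1A A1M net1]]] := manifold_net mM M1.
have [W2 [A2 [oW2 W2a W2A A2M net2]]] := manifold_net mM M2'.
have ballE (a s : X) : ball a r s -> `|s - a| < r by rewrite -ball_normE /= distrC.
exists (W1 `&` ball a1 r), (W2 `&` ball a2 r); split.
- by apply: openI => //; exact: ball_open.
- by apply: openI => //; exact: ball_open.
- by split=> //; exact: ballxx.
- by split=> //; exact: ballxx.
have netS A (B : set X) : net_dim d A -> B `<=` A -> net_dim d B.
  move=> [k' k'0 Hk'] BA; exists k' => // B' Q B'0 B'B; apply: Hk' => //.
  exact: subset_trans B'B BA.
pose B1 i := A1 i `&` ball a1 r; pose B2 i := A2 i `&` ball a2 r.
have HN (i j l : nat) : P.-negligible [set w | (forall i, `|(fg i w).1 : H| <= l%:R /\ `|(fg i w).2 : H| <= l%:R) /\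
    indistinguishable (B1 i) (B2 j) w].
  apply: (@indistinguishable_piece _ _ K K beta _ k) => //.
  - by move=> s [_ /ballE]; exact: pos1.
  - by move=> s [_ /ballE]; exact: pos2.
  - by apply: netS (net1 i) _; exact: subIsetl.
  - by apply: netS (net2 j) _; exact: subIsetl.
  - by move=> s t [_ /ballE h1] [_ /ballE h2]; exact: lip1.
  - by move=> s t [_ /ballE h1] [_ /ballE h2]; exact: lip2.
  - by move=> s t [_ /ballE h1] [_ /ballE h2]; exact: Hbeta.
have HU : P.-negligible (\bigcup_i \bigcup_j \bigcup_l [set w |
    (forall i, `|(fg i w).1 : H| <= l%:R /\ `|(fg i w).2 : H| <= l%:R) /\
    indistinguishable (B1 i) (B2 j) w]).
  by apply: negligible_bigcup => i; apply: negligible_bigcup => j; apply: negligible_bigcup => l; exact: HN.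
apply: negligibleS HU => w [s [t [[Ms [W1s b1s]] [Mt [W2t b2t]] st]]].
have [i _ Ai] : (\bigcup_i A1 i) s by apply: W1A.
have [j _ Aj] : (\bigcup_i A2 i) t by apply: W2A.
exists i => //; exists j => //.
pose m := \sum_i (`|(fg i w).1 : H| + `|(fg i w).2 : H|).
exists (Num.truncn m).+1 => //; split; last by exists s, t.
move=> i'; have mi : `|(fg i' w).1 : H| + `|(fg i' w).2 : H| <= m.
  by rewrite /m (bigD1 i')//= lerDl sumr_ge0// => ? _; rewrite addr_ge0.
have ml := ltW (truncnS_gt m); have := le_trans mi ml.
by have := normr_ge0 ((fg i' w).1 : H); have := normr_ge0 ((fg i' w).2 : H); split; lra.
Qed.

(** Every pair of distinct points lies in a product of two base sets of [M] for which
    [indistinguishable_local] gives a null event, and there are only countably many such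
    products. *)
Theorem generic_injectivity : {ae P, forall w, forall s t : X, (Pos `&` M) s -> (Pos `&` M) t ->
  (forall i, b (Lam s (fg i w).1) (fg i w).2 = b (Lam t (fg i w).1) (fg i w).2) -> s = t}.
Proof.
have [BB cB [oB bB]] := M2.
have base (a : X) (U : set X) : M a -> open U -> U a ->
    exists O : set (set_type M), [/\ BB O, exists z, O z /\ set_val z = a & forall z, O z -> U (set_val z)].
  move=> Ma oU Ua; pose z : set_type M := SigSub (mem_set Ma).
  have oV : open ((set_val : set_type M -> X) @^-1` U).
    by have /continuousP := @initial_continuous _ _ (set_val : set_type M -> X); apply.
  have nV : nbhs z ((set_val : set_type M -> X) @^-1` U) by exact: open_nbhs_nbhs.
  have [V0 [BV Vz] VV] := bB z _ nV.
  by exists V0; split=> //; exists z.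
pose im (O : set (set_type M)) : set X := [set set_val z | z in O].
have /countable_injP[c cinj] := cB.
pose good E1 E2 := [/\ BB E1, BB E2 & P.-negligible (indistinguishable (im E1) (im E2))].
(* The code [c] is injective on the base, so each [F i j] comes from at most one pair of base
   sets. *)
pose F i j := [set w | exists E1 E2, [/\ good E1 E2, c E1 = i, c E2 = j & indistinguishable (im E1) (im E2) w]].
have nF i j : P.-negligible (F i j).
  have [[E1 [E2 [g1 ci cj]]]|nex] := pselect (exists E1 E2, [/\ good E1 E2, c E1 = i & c E2 = j]).
    have [b1 b2 ng] := g1; apply: negligibleS ng => w [E1' [E2' [[b1' b2' _] ci' cj' h]]].
    have <- : E1' = E1 by apply: cinj; rewrite ?inE// ci' ci.
    by have <- : E2' = E2 by apply: cinj; rewrite ?inE// cj' cj.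
  by apply: negligibleS (negligible_set0 P) => w [E1 [E2 [g1 ci cj _]]]; apply: nex; exists E1, E2.
have nU : P.-negligible (\bigcup_i \bigcup_j F i j).
  by apply: negligible_bigcup => i; apply: negligible_bigcup => j; exact: nF.
apply: negligibleS nU => w /= nw; apply: contrapT => nwU; apply: nw => s t Ms Mt st.
apply: contrapT => sNt; have [U1 [U2 [oU1 oU2 U1s U2t ng]]] := indistinguishable_local Ms Mt sNt.
have [E1 [B1 [z1 [E1z z1E]] E1U]] := base s U1 Ms.2 oU1 U1s.
have [E2 [B2 [z2 [E2z z2E]] E2U]] := base t U2 Mt.2 oU2 U2t.
apply: nwU; exists (c E1) => //; exists (c E2) => //; exists E1, E2; split=> //.
  split=> //; apply: negligibleS ng => w' [x [y [[x' Ox <-] [y' Oy <-] h]]].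
  exists (set_val x'), (set_val y'); split=> //.
    by split; [exact: set_valP|exact: E1U].
  by split; [exact: set_valP|exact: E2U].
by exists s, t; split=> //; [exists z1|exists z2].
Qed.

End sampling.
End embedding.

(** * Application to the Neumann-to-Dirichlet map *)

(** On the $L^\infty$ ball of radius $e/2$ around a conductivity bounded below by [e], the lower
    bound $e/2$ is common to all, so [ntd_lipschitz] applies with one constant. *)
Lemma ntd_lipschitz_near (R : realType) n (D : set 'rV[R]_n) (n2 : (2 <= n)%N)
    (bD : bounded_connected_lipschitz_domain D)
    (S0 : 0 < dot_L2 (ftrace n2 bD smooth_one) (ftrace n2 bD smooth_one)) (a : Linf D) :
  Linf_pos D a -> exists r K : R, [/\ 0 < r, 0 <= K, forall s, `|s - a| < r -> Linf_pos D s &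
    forall s t, `|s - a| < r -> `|t - a| < r -> forall f g,
      `|boundary_pairing (neumann_to_dirichlet s f) g - boundary_pairing (neumann_to_dirichlet t f) g| <=
      K * `|s - t| * (`|f| * `|g|)].
Proof.
move=> pa; have [e e0 ea] := ess_inf_pos_bound pa; have [K K0 HK] := ntd_lipschitz S0.
have near (s : Linf D) : `|s - a| < e / 2 ->
    ((e / 2)%:E <= ess_inf (volume D) (EFin \o ((s : Linfty (volume D)) : _ -> R)))%E.
  by move=> /ltW sa; apply: (ess_inf_near ea).
have e2 : 0 < e / 2 by rewrite divr_gt0.
have c0 : 0 <= K / (e / 2) by rewrite divr_ge0// ltW.
exists (e / 2), (K / (e / 2) * (K / (e / 2))); split=> //; first exact: mulr_ge0.
  by move=> s /near h; apply: lt_le_trans h; rewrite lte_fin.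
move=> s t /near hs /near ht f g; apply: (le_trans (HK _ _ _ e2 hs ht f g)).
rewrite le_eqVlt; apply/orP; left; apply/eqP.
move: (e / 2)^-1 `|s - t| `|f| `|g| => z u v w; ring.
Qed.

Theorem theorem3p1 (R : realType) (m : nat) (Omega : set 'rV[R]_m)
    (d : nat) (calM : set (Linf Omega))
    (gamma : probability (borel (L2_diamond Omega)) R)
    (M : nat) (disp : measure_display) (S : measurableType disp)
    (P : probability S R)
    (fg : 'I_M -> {RV P >->
      (borel (L2_diamond Omega) * borel (L2_diamond Omega))%type}) :
  (2 <= m)%N ->
  bounded_connected_lipschitz_domain Omega ->
  analytic_manifold d calM ->
  second_countable_set calM ->
  set_inj (Linf_pos Omega `&` calM) (@neumann_to_dirichlet R m Omega) ->
  gaussian_measure gamma ->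
  injective_covariance gamma ->
  (2 * d + 1 <= M)%N ->
  mutually_independent fg ->
  (forall i, has_law (fg i) (gamma \x gamma)%E) ->
  {ae P, forall w, forall sigma1 sigma2 : Linf Omega,
    (Linf_pos Omega `&` calM) sigma1 ->
    (Linf_pos Omega `&` calM) sigma2 ->
    (forall i : 'I_M,
      boundary_pairing (neumann_to_dirichlet sigma1 (fg i w).1) (fg i w).2 =
      boundary_pairing (neumann_to_dirichlet sigma2 (fg i w).1) (fg i w).2) ->
    sigma1 = sigma2}.
Proof.
move=> m2 bO mM M2 inj gG [C CE C_inj] dM indep law.
(* If the boundary had zero surface measure, the boundary space would be trivial and all
   Neumann-to-Dirichlet maps equal, so injectivity alone would conclude. *)
have [S0|S0] := pselect (0 < dot_L2 (ftrace m2 bO smooth_one) (ftrace m2 bO smooth_one)); last first.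
  apply: aeW => w s t ps pt _; apply: inj; rewrite ?inE//.
  by apply/funext => f; exact: (L2_diamond_trivial _ _ S0).
exact: (generic_injectivity (@bpC R m Omega) (@bp_lin R m Omega) (@bp_norm R m Omega)
  (@bp_bound R m Omega) gG C_inj CE (fun s ps f g => ntd_sym S0 f g ps) (@ntd_bounded _ _ _ _ _ S0)
  (ntd_range_separable S0) (ntd_lipschitz_near S0) indep law dM mM M2 inj).
Qed.
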